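(* Let $K$ be an algebraically closed field of characteristic $0$ and let $C\subset\mathbb{P}^2$ be a smooth curve over $K$ of degree four. Then $$\delta'[2]\le 21.$$ Furthermore, the equality holds if and only if $C$ is projectively equivalent to the curve defined by $$X^4+Y^4+Z^4+a(X^2Y^2+Y^2Z^2+Z^2X^2)=0,$$ where $a\in K$ satisfies $a^2+3a+18=0$.
   Context: For $P\in\mathbb{P}^2$, $\pi_P:C\dashrightarrow\mathbb{P}^1$ is the projection from $P$, and $G[P]=\{\tau\in\mathrm{Bir}(C)\mid \pi_P\circ\tau=\pi_P\}$. $P$ is called quasi-Galois if $|G[P]|\ge 2$. $\delta'[2]$ denotes the number of quasi-Galois points $P\in\mathbb{P}^2\setminus C$ with $|G[P]|=2$. Two plane curves are projectively equivalent if a linear transformation of $\mathbb{P}^2$ maps one onto the other. *)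

(* Defs.v *)
From mathcomp Require Import all_boot all_order all_algebra.
From mathcomp Require Import mpoly.

Set Implicit Arguments.
Unset Strict Implicit.
Unset Printing Implicit Defensive.

Import GRing.Theory.
Local Open Scope ring_scope.

(* [A] consists of exactly [n] classes of the equivalence relation [R]. *)
Definition card_mod (T : Type) (R : T -> T -> Prop) (A : T -> Prop) (n : nat) :
    Prop :=
  exists x : 'I_n -> T,
    [/\ forall i, A (x i),
        forall i j, R (x i) (x j) -> i = j
      & forall y, A y -> exists i, R (x i) y].

Section PlaneCurves.

Variable K : fieldType.

Implicit Types (F G : {mpoly K[3]}) (P : {vspace 'rV[K]_3}).

(* A point of the projective plane is a line of the vector space K^3; a plane
   curve is given by a form F, homogeneous coordinates of points being nonzero
   row vectors. *)
Definition is_point P : Prop := \dim P = 1%N.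

Definition on_curve F P : Prop :=
  forall v : 'rV[K]_3, v \in P -> F.@[v 0] = 0.

(* A smooth plane curve is reduced and irreducible, so that F is determined by
   its zero set up to a scalar, and d is the degree of the curve. *)
Definition smooth_plane_curve (d : nat) F : Prop :=
  [/\ F \is d.-homog, F != 0
    & forall v : 'rV[K]_3, v != 0 -> F.@[v 0] = 0 ->
        exists i : 'I_3, (F^`M(i)).@[v 0] != 0].

Definition vanishes_on F G : Prop :=
  forall v : 'rV[K]_3, v != 0 -> F.@[v 0] = 0 -> G.@[v 0] = 0.

(* Rational maps from the curve F = 0 to P^n are represented by tuples of forms
   of the same degree, not all vanishing on the curve. As the curves considered
   are irreducible, two representatives agree on a dense open subset if and
   only if the 2 x 2 minors vanish on the whole curve. *)
Definition ratmap F n (phi : n.+1.-tuple {mpoly K[3]}) : Prop :=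
  (exists d : nat, forall i, tnth phi i \is d.-homog) /\
  (exists i, ~ vanishes_on F (tnth phi i)).

Definition eq_ratmap F n (phi psi : n.+1.-tuple {mpoly K[3]}) : Prop :=
  forall i j,
    vanishes_on F (tnth phi i * tnth psi j - tnth phi j * tnth psi i).

Definition self_ratmap F (tau : 3.-tuple {mpoly K[3]}) : Prop :=
  ratmap F tau /\ vanishes_on F (F \mPo tau).

Definition comp_forms n (phi : n.+1.-tuple {mpoly K[3]})
    (tau : 3.-tuple {mpoly K[3]}) : n.+1.-tuple {mpoly K[3]} :=
  [tuple tnth phi i \mPo tau | i < n.+1].

(* The composite of phi and tau is defined and equal to psi. *)
Definition comp_ratmap_eq F n (phi : n.+1.-tuple {mpoly K[3]})
    (tau : 3.-tuple {mpoly K[3]}) (psi : n.+1.-tuple {mpoly K[3]}) : Prop :=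
  ratmap F (comp_forms phi tau) /\ eq_ratmap F (comp_forms phi tau) psi.

Definition id_forms : 3.-tuple {mpoly K[3]} := [tuple 'X_i | i < 3].

Definition birational_self F (tau : 3.-tuple {mpoly K[3]}) : Prop :=
  self_ratmap F tau /\
  exists sigma : 3.-tuple {mpoly K[3]},
    [/\ self_ratmap F sigma,
        comp_ratmap_eq F tau sigma id_forms
      & comp_ratmap_eq F sigma tau id_forms].

(* pi is a pair of linear forms defining P; it is unique up to a linear change
   of coordinates on the target P^1. *)
Definition projection_from P (pi : 2.-tuple {mpoly K[3]}) : Prop :=
  (forall i, tnth pi i \is 1.-homog) /\
  (forall v : 'rV[K]_3, v \in P <-> forall i, (tnth pi i).@[v 0] = 0).

Definition galois_set F P (tau : 3.-tuple {mpoly K[3]}) : Prop :=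
  birational_self F tau /\
  forall pi, projection_from P pi -> comp_ratmap_eq F pi tau pi.

(* |G[P]| = m, birational maps being counted up to equality on the curve. *)
Definition galois_order F P (m : nat) : Prop :=
  card_mod (@eq_ratmap F 2) (galois_set F P) m.

(* delta'[m] = n. *)
Definition outer_qgalois_number F (m n : nat) : Prop :=
  card_mod eq
    (fun P => [/\ is_point P, ~ on_curve F P, (2 <= m)%N & galois_order F P m])
    n.

Definition projectively_equivalent F G : Prop :=
  exists2 A : 'M[K]_3, A \in unitmx &
    forall v : 'rV[K]_3, v != 0 -> F.@[v 0] = 0 <-> G.@[(v *m A) 0] = 0.

Definition quartic_form (a : K) : {mpoly K[3]} :=
  let X : {mpoly K[3]} := 'X_0 in
  let Y : {mpoly K[3]} := 'X_1 in
  let Z : {mpoly K[3]} := 'X_(2 : 'I_3) in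
  X ^+ 4 + Y ^+ 4 + Z ^+ 4
    + a *: (X ^+ 2 * Y ^+ 2 + Y ^+ 2 * Z ^+ 2 + Z ^+ 2 * X ^+ 2).

End PlaneCurves.

(* Main.v *)
Require Import Defs.
From mathcomp Require Import all_boot all_order all_algebra.
From mathcomp Require Import all_field generic_quotient fraction.
From mathcomp Require Import mpoly.
From mathcomp Require Import ring zify.
From Stdlib Require Import Classical.
Set Implicit Arguments.
Unset Strict Implicit.
Unset Printing Implicit Defensive.
Import GRing.Theory.
Local Open Scope ring_scope.

(* Write F(x) = Phi(x,x,x,x) with Phi symmetric and 4-linear. Projecting from an
   outer point v, the curve is z^4 + p z^2 + q z + r = 0 over K(x), a quartic
   which smoothness makes irreducible. A second root t in the function field L
   gives the root (z + t)^2 of the cubic resolvent; as 3 does not divide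
   [L : K(x)] = 4, the resolvent has a root in K(x), and smoothness then forces
   q = 0. Hence |G[v]| = 2 exactly when q = 0 and p <> 0, that is, when F is
   preserved by the involutive homology of center v but not by a homology of
   order four.

   Two such centers either are orthogonal for the polarity of Phi, or generate
   a symmetric group of order 6 or a dihedral group of order 8 whose other
   centers are known. If no two centers commute, fixing one of them leaves at
   most 9 points. Otherwise two commuting centers complete to a frame in which
   F = x^4 + y^4 + z^4 + 6 (A x^2 y^2 + B x^2 z^2 + C y^2 z^2), and the centers
   are among 1 + 4 + 8 + 8 = 21 explicit points (12 if there is a homology of
   order four). When all of them occur, a frame can be chosen with
   A = B = C = a / 6; applying the same to the other frames yields
   (a - 2) (a^2 + 3 a + 18) = 0, and a = 2 is singular. *)

(** For two centers put s = Phi(v,v,v,v') and s' = Phi(v',v',v',v). The product of their involutions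
    has trace 4 s s' - 2 on the plane they span, so the values 0, 1/4, 1/2 of s s' mean order 2, 3,
    4. Comparing the two center conditions gives only (s'^2 - s^2)(1 - 2 s s') = 0; for s nonzero,
    smoothness forces s s' = 1/4 on the first factor. The group G[v] consists of birational maps
    given by tuples of forms modulo equality on the curve, with no linearity assumed. The bridge is
    the generic point (X : 1 : z) over L: a map commuting with the projection is determined by the
    root of the quartic to which it sends z, and homologies realize the roots that matter. This
    needs a form to vanish on the curve exactly when it vanishes at the generic point, which is
    proved directly with a resultant. The bound 21 is the length of a list of candidates attached to
    a frame. Equality makes every candidate occur, for every frame at once, and this uniformity
    yields the equations on A, B, C. *)

Section LinearAlgebra.

Variable K : fieldType.
Local Notation V := 'rV[K]_3.

Definition spanning (u v w : V) : Prop :=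
  forall y : V, exists a b c, y = a *: u + b *: v + c *: w.

Definition rows3 (u v w : V) : 'M[K]_3 :=
  \matrix_(i, j) (if i == 0 then u 0 j else if i == 1 then v 0 j else w 0 j).

Lemma mul_rows3 (u v w x : V) :
  x *m rows3 u v w = x 0 0 *: u + x 0 1 *: v + x 0 (2 : 'I_3) *: w.
Proof.
apply/rowP=> j; rewrite !mxE !big_ord_recl big_ord0 !mxE /=.
rewrite addr0 !addrA.
by congr (_ * _ + x _ _ * _ + x _ _ * _); apply/val_inj.
Qed.

Lemma row3_eq (x y : V) : x 0 0 = y 0 0 -> x 0 1 = y 0 1 ->
  x 0 (2 : 'I_3) = y 0 (2 : 'I_3) -> x = y.
Proof.
move=> h0 h1 h2; apply/rowP=> -[[|[|[|//]]] Hj].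
- by move: h0; congr (x _ _ = y _ _); apply/val_inj.
- by move: h1; congr (x _ _ = y _ _); apply/val_inj.
by move: h2; congr (x _ _ = y _ _); apply/val_inj.
Qed.

Lemma free_spanning (u v w : V) :
  (forall a b c, a *: u + b *: v + c *: w = 0 -> [/\ a = 0, b = 0 & c = 0]) ->
  spanning u v w.
Proof.
move=> Hfree y; set M := rows3 u v w.
have freeM : row_free M.
  apply/inj_row_free => x; rewrite mul_rows3 => /Hfree [x0 x1 x2].
  by apply: row3_eq; rewrite mxE.
have unitM : M \in unitmx by rewrite -row_free_unit.
exists ((y *m invmx M) 0 0), ((y *m invmx M) 0 1), ((y *m invmx M) 0 (2 : 'I_3)).
by rewrite -mul_rows3 mulmxKV.
Qed.

Definition row3 (a b c : K) : V :=
  \row_j (if j == 0 then a else if j == 1 then b else c).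

Lemma mul_row3 (u v w : V) a b c :
  row3 a b c *m rows3 u v w = a *: u + b *: v + c *: w.
Proof. by rewrite mul_rows3 !mxE /=. Qed.

Lemma spanning_unit (u v w : V) : spanning u v w -> rows3 u v w \in unitmx.
Proof.
move=> Hs; rewrite -row_full_unit; apply/row_fullP.
have H (i : 'I_3) : exists x : V, x *m rows3 u v w == delta_mx 0 i.
  case: (Hs (delta_mx 0 i)) => a [b [c Hy]]; exists (row3 a b c).
  by rewrite mul_row3 Hy.
exists (\matrix_(i, j) xchoose (H i) 0 j); apply/row_matrixP=> i.
rewrite row_mul row1; apply/eqP; rewrite -[X in _ == X](eqP (xchooseP (H i))).
by apply/eqP; congr (_ *m _); apply/rowP=> j; rewrite !mxE.
Qed.

Lemma spanning_free (u v w : V) a b c : spanning u v w ->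
  a *: u + b *: v + c *: w = 0 -> [/\ a = 0, b = 0 & c = 0].
Proof.
move=> /spanning_unit Mu; rewrite -mul_row3 => /(congr1 (mulmx^~ (invmx (rows3 u v w)))).
rewrite mulmxK // mul0mx => /rowP H; have := (H 0, H 1, H (2 : 'I_3)).
by rewrite !mxE /= => -[[-> ->] ->].
Qed.

(** If coordinate [i] of [v] is nonzero, the standard vectors of the other two indices,
    [lift i ord0] and [lift i ord_max], complete [v] to a basis. *)
Lemma spanning_nz (v : V) : v != 0 -> exists a b : V, spanning v a b.
Proof.
case/rV0Pn => i vi0.
exists (delta_mx 0 (lift i ord0)), (delta_mx 0 (lift i ord_max)).
move=> y.
exists (y 0 i / v 0 i),
   (y 0 (lift i ord0) - y 0 i / v 0 i * v 0 (lift i ord0)),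
   (y 0 (lift i ord_max) - y 0 i / v 0 i * v 0 (lift i ord_max)).
apply/rowP=> j; rewrite !mxE /=.
case: (unliftP i j) => [k ->|->].
  case: (unliftP ord0 k) => [l ->|->].
    have -> : lift ord0 l = ord_max :> 'I_2 by apply/val_inj; case: l => [[|//]].
    rewrite !eqxx (inj_eq (@lift_inj _ i)) /=.
    by rewrite mulr0 mulr1 addr0 addrC subrK.
  rewrite eqxx (inj_eq (@lift_inj _ i)) /=.
  by rewrite mulr0 mulr1 addr0 addrC subrK.
rewrite !(negbTE (neq_lift _ _)) !mulr0 !addr0.
by rewrite divfK.
Qed.

End LinearAlgebra.

Section CharacteristicZero.

Variable K : fieldType.
Hypothesis charK0 : [pchar K] =i pred0.

Lemma char0_succ_neq0 n : (n.+1%:R : K) != 0.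
Proof. by rewrite (proj1 (pcharf0P K) charK0). Qed.

Lemma char0_nat_neq0 n : (0 < n)%N -> (n%:R : K) != 0.
Proof. by case: n => // n _; apply: char0_succ_neq0. Qed.

End CharacteristicZero.

Section LinearCombination.

Variable R : comNzRingType.
Implicit Types A B c l r : R.

(** Certificates for identities modulo hypotheses: the cofactors are supplied by hand, and [ring] or
    [field] checks the combination. *)
Lemma lincomb1 c1 l1 r1 A B : l1 = r1 -> A - B = c1 * (l1 - r1) -> A = B.
Proof. by move=> -> /eqP; rewrite subrr mulr0 subr_eq0 => /eqP. Qed.

Lemma lincomb2 c1 c2 l1 r1 l2 r2 A B : l1 = r1 -> l2 = r2 ->
  A - B = c1 * (l1 - r1) + c2 * (l2 - r2) -> A = B.
Proof. by move=> -> ->; rewrite !subrr !mulr0 addr0 => /eqP; rewrite subr_eq0 => /eqP. Qed.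

Lemma lincomb3 c1 c2 c3 l1 r1 l2 r2 l3 r3 A B : l1 = r1 -> l2 = r2 -> l3 = r3 ->
  A - B = c1 * (l1 - r1) + c2 * (l2 - r2) + c3 * (l3 - r3) -> A = B.
Proof. by move=> -> -> ->; rewrite !subrr !mulr0 !addr0 => /eqP; rewrite subr_eq0 => /eqP. Qed.

End LinearCombination.

(** * Homologies preserving a plane quartic *)

Record quartic_tensor (R : comNzRingType) (V : lmodType R)
    (Phi : V -> V -> V -> V -> R) : Prop := QuarticTensor {
  tensD : forall u u' a b c, Phi (u + u') a b c = Phi u a b c + Phi u' a b c;
  tensZ : forall k u a b c, Phi (k *: u) a b c = k * Phi u a b c;
  tens12 : forall a b c d, Phi a b c d = Phi b a c d;
  tens23 : forall a b c d, Phi a b c d = Phi a c b d;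
  tens34 : forall a b c d, Phi a b c d = Phi a b d c }.

Section TensorExpansion.

Variables (R : comNzRingType) (V : lmodType R) (Phi : V -> V -> V -> V -> R).
Hypothesis HPhi : quartic_tensor Phi.

Let T12 := tens12 HPhi.
Let T23 := tens23 HPhi.
Let T34 := tens34 HPhi.

Lemma tensD2 u u' a b c : Phi a (u + u') b c = Phi a u b c + Phi a u' b c.
Proof. by rewrite T12 (tensD HPhi) !(T12 _ a). Qed.
Lemma tensD3 u u' a b c : Phi a b (u + u') c = Phi a b u c + Phi a b u' c.
Proof. by rewrite T23 tensD2 !(T23 _ _ b). Qed.
Lemma tensD4 u u' a b c : Phi a b c (u + u') = Phi a b c u + Phi a b c u'.
Proof. by rewrite T34 tensD3 !(T34 _ _ _ c). Qed.
Lemma tensZ2 k u a b c : Phi a (k *: u) b c = k * Phi a u b c.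
Proof. by rewrite T12 (tensZ HPhi) !(T12 _ a). Qed.
Lemma tensZ3 k u a b c : Phi a b (k *: u) c = k * Phi a b u c.
Proof. by rewrite T23 tensZ2 !(T23 _ _ b). Qed.
Lemma tensZ4 k u a b c : Phi a b c (k *: u) = k * Phi a b c u.
Proof. by rewrite T34 tensZ3 !(T34 _ _ _ c). Qed.

Lemma tensN1 u a b c : Phi (- u) a b c = - Phi u a b c.
Proof. by rewrite -scaleN1r (tensZ HPhi) mulN1r. Qed.
Lemma tensN2 u a b c : Phi a (- u) b c = - Phi a u b c.
Proof. by rewrite -scaleN1r tensZ2 mulN1r. Qed.
Lemma tensN3 u a b c : Phi a b (- u) c = - Phi a b u c.
Proof. by rewrite -scaleN1r tensZ3 mulN1r. Qed.
Lemma tensN4 u a b c : Phi a b c (- u) = - Phi a b c u.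
Proof. by rewrite -scaleN1r tensZ4 mulN1r. Qed.

Definition tens_lin := (tensD HPhi, tensD2, tensD3, tensD4,
  (tensN1, tensN2, tensN3, tensN4), (tensZ HPhi, tensZ2, tensZ3, tensZ4)).

(** Rewriting with it moves every [u] in front of every [v], which gives equal entries of the tensor
    one normal form for [ring]. *)
Definition tens_sort (u v : V) := ((fun c d => T12 v u c d),
  (fun a d => T23 a v u d), (fun a b => T34 a b v u)).

End TensorExpansion.

Section PlaneQuartic.

Variables (K : closedFieldType) (Phi : 'rV[K]_3 -> 'rV[K]_3 -> 'rV[K]_3 -> 'rV[K]_3 -> K).
Hypothesis charK0 : [pchar K] =i pred0.
Hypothesis HPhi : quartic_tensor Phi.
Hypothesis smooth : forall x : 'rV[K]_3, x != 0 -> exists y, Phi x x x y != 0.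

Local Notation V := 'rV[K]_3.
Implicit Types (u v w x y z r : V) (a b k s eta : K).

Let lin := tens_lin HPhi.
Let srt := tens_sort HPhi.

Let natf_neq0K := char0_succ_neq0 charK0.
Let natP_neq0 := char0_nat_neq0 charK0.

Lemma spanning_singular u v w x : spanning u v w -> x != 0 ->
  Phi x x x u = 0 -> Phi x x x v = 0 -> Phi x x x w = 0 -> False.
Proof.
move=> Hs x0 Hu Hv Hw; case: (smooth x0) => y.
by case: (Hs y) => a [b [c ->]]; rewrite !lin Hu Hv Hw !mulr0 !addr0 eqxx.
Qed.

Lemma closed_root n (a : K) : (0 < n)%N -> exists b, b ^+ n = a.
Proof.
move=> n0; case: (@solve_monicpoly K n (fun i => if i == 0%N then a else 0) n0) => b Hb.
exists b; rewrite Hb; case: n n0 {Hb} => // n _.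
by rewrite big_ord_recl /= mulr1 big1 ?addr0 // => i _; rewrite mul0r.
Qed.

(* In coordinates adapted to [v] and to the polar line [Phi v v v x = 0], the
   identity says that F is even in the coordinate along [v]: F is invariant
   under the involutive homology [x |-> x - 2 Phi(v,v,v,x) v] of center [v]. *)
Definition center v : Prop := Phi v v v v = 1 /\
  forall x y z, Phi v x y z =
    Phi v v v x * Phi v v y z + Phi v v v y * Phi v v x z
    + Phi v v v z * Phi v v x y - 2 * Phi v v v x * Phi v v v y * Phi v v v z.

(* Together with [center v]: F = l ^ 4 + G with [l] and [G] independent, so that
   the homologies of center [v] form a group of order four. *)
Definition galois v : Prop :=
  forall x y, Phi v v v x = 0 -> Phi v v v y = 0 -> Phi v v x y = 0.

Lemma tens0 x y z : Phi 0 x y z = 0.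
Proof. by rewrite -[X in Phi X](scale0r (0:V)) (tensZ HPhi) mul0r. Qed.

Lemma tens0r x y z : Phi x y z 0 = 0.
Proof. by rewrite -[X in Phi _ _ _ X](scale0r (0:V)) (tensZ4 HPhi) mul0r. Qed.

Lemma center_nz v : center v -> v != 0.
Proof.
case=> H _; apply/eqP=> v0; move/eqP: H.
by rewrite v0 tens0 eq_sym oner_eq0.
Qed.

Lemma polar_basis v : Phi v v v v = 1 -> exists e0 e1,
  [/\ Phi v v v e0 = 0, Phi v v v e1 = 0 & spanning v e0 e1].
Proof.
move=> F1.
have v0 : v != 0.
  by apply/eqP=> v0; move/eqP: F1; rewrite v0 tens0 eq_sym oner_eq0.
case: (spanning_nz v0) => a [b Hs].
exists (a - Phi v v v a *: v), (b - Phi v v v b *: v); split.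
- by rewrite !lin F1 mulr1 subrr.
- by rewrite !lin F1 mulr1 subrr.
move=> y; case: (Hs y) => c [d [e ->]].
exists (c + d * Phi v v v a + e * Phi v v v b), d, e.
by apply/rowP=> j; rewrite !mxE; ring.
Qed.


(** The vector [r] spans the intersection of the axes of the two homologies, so both fix it. *)
Lemma polar_kernel2 v v' : Phi v v v v = 1 -> exists2 r, r != 0 &
  Phi v v v r = 0 /\ Phi v' v' v' r = 0.
Proof.
move=> F1; case: (polar_basis F1) => e0 [e1 [l0 l1 Hs]].
have e0n : e0 != 0.
  apply/eqP=> e00; case: (@spanning_free _ _ _ _ 0 1 0 Hs).
    by rewrite e00 !scale0r scaler0 !addr0.
  by move=> _ /eqP; rewrite oner_eq0.
have e1n : e1 != 0.
  apply/eqP=> e10; case: (@spanning_free _ _ _ _ 0 0 1 Hs).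
    by rewrite e10 !scale0r scaler0 !addr0.
  by move=> _ _ /eqP; rewrite oner_eq0.
have [l0'|l0'] := eqVneq (Phi v' v' v' e0) 0; first by exists e0.
exists (Phi v' v' v' e1 *: e0 - Phi v' v' v' e0 *: e1); last first.
  by rewrite !lin l0 l1; split; ring.
apply/eqP=> H.
case: (@spanning_free _ _ _ _ 0 (Phi v' v' v' e1) (- Phi v' v' v' e0) Hs).
  by rewrite scale0r add0r scaleNr.
by move=> _ _ /eqP; rewrite oppr_eq0 (negbTE l0').
Qed.

(** * Products of two involutive homologies *)

Lemma pair_rel v v' : center v -> Phi v' v' v' v =
  3 * Phi v v v v' * Phi v v v' v' - 2 * Phi v v v v' ^+ 3.
Proof. by case=> _ H; rewrite !(srt v v') H; ring. Qed.

Lemma center_comm v v' : center v -> center v' ->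
  Phi v v v v' = 0 -> Phi v' v' v' v = 0.
Proof. by move=> Cv _ H; rewrite (pair_rel v' Cv) H; ring. Qed.

Lemma polar0 v x y z : center v ->
  Phi v v v x = 0 -> Phi v v v y = 0 -> Phi v x y z = Phi v v v z * Phi v v x y.
Proof. by case=> _ H hx hy; rewrite H hx hy; ring. Qed.

(* A vector [r] in both polar kernels satisfies [Phi v v' v' r = 2 s Phi v v v' r]
   and its mirror image, hence [(1 - 4 s s') Phi v v v' r = 0]. *)
Lemma pair_order3 v v' :
  center v -> center v' -> (forall k, v' != k *: v) ->
  Phi v v v v' != 0 -> (Phi v' v' v' v) ^+ 2 = (Phi v v v v') ^+ 2 ->
  4 * Phi v v v v' * Phi v' v' v' v = 1.
Proof.
move=> Cv Cv' Hprop.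
set s := Phi v v v v'; set s' := Phi v' v' v' v => s0 Hss.
have [F1 pv] := Cv; have [F1' pv'] := Cv'.
have [w Ew] : exists w, w = v' - s *: v by exists (v' - s *: v).
have Ev' : v' = s *: v + w by rewrite Ew addrC subrK.
have lw : Phi v v v w = 0 by rewrite Ew !lin F1 mulr1 subrr.
have l'w : Phi v' v' v' w = 1 - s * s' by rewrite Ew !lin F1'.
have w0 : w != 0.
  by apply: contra (Hprop s) => /eqP w0; rewrite {1}Ev' w0 addr0.
have Rel := pair_rel v' Cv; rewrite -/s -/s' in Rel.
have B3 : s * (3 * Phi v v w w) = s' - s ^+ 3.
  by rewrite Ew !lin !(srt v v') F1 -/s Rel; ring.
have Fw : Phi w w w w = (1 - s * s') ^+ 2.
  rewrite Ew !lin !(srt v v') F1 F1' -/s.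
  have -> : Phi v v' v' v' = s' by rewrite /s' !(srt v v').
  set b := Phi v v v' v' in Rel *.
  by apply: (lincomb2 (c1 := - s ^+2) (c2 := -2 * s) Hss Rel); ring.
have vwww : Phi v w w w = 0 by rewrite (polar0 _ Cv lw lw) lw mul0r.
(* For s s' = 1 the product of the two involutions is unipotent on their span, and [w] turns out to
   be a singular point. *)
have [ss1|ss1] := eqVneq (s * s') 1.
  exfalso.
  have Bww : Phi v v w w = 0.
    have : s * (3 * Phi v v w w) * s = 0.
      by rewrite B3; apply: (lincomb2 (c1 := - (s * s')) (c2 := s^+2) ss1 Hss); ring.
    move/eqP; rewrite !mulf_eq0 (negbTE s0) (negbTE (natf_neq0K 2)) /= orbF.
    by move/eqP.
  have l'w0 : Phi v' v' v' w = 0 by rewrite l'w ss1 subrr.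
  have Fw0 : Phi w w w w = 0 by rewrite Fw ss1 subrr expr0n.
  have B'ww : Phi v' v' w w = 0.
    by rewrite Ev' !lin !(srt v w) Bww vwww Fw0; ring.
  have He e : Phi v v v e = 0 -> Phi w w w e = 0.
    move=> le; rewrite {1}Ew !lin.
    have -> : Phi v w w e = 0 by rewrite (polar0 _ Cv lw lw) le mul0r.
    by rewrite (polar0 _ Cv' l'w0 l'w0) B'ww; ring.
  case: (polar_basis F1) => e0 [e1 [l0 l1 Hs]].
  apply: (spanning_singular Hs w0); [| exact: He | exact: He].
  by rewrite !(srt v w).
case: (polar_kernel2 v' F1) => r r0 [lr l'r].
have [//|s41] := eqVneq (4 * s * s') 1; exfalso.
have beta' : Phi v v' v' r = 2 * s * Phi v v v' r by rewrite pv lr -/s; ring.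
have beta : Phi v v v' r = 2 * s' * Phi v v' v' r.
  have E1 : Phi v' v v r = Phi v v v' r by rewrite !(srt v v').
  have E2 : Phi v' v' v r = Phi v v' v' r by rewrite !(srt v v').
  by rewrite -E1 pv' l'r -/s' E2; ring.
have b0 : Phi v v v' r = 0.
  have : (1 - 4 * s * s') * Phi v v v' r = 0.
    by rewrite mulrBl mul1r {1}beta beta'; ring.
  by move/eqP; rewrite mulf_eq0 subr_eq0 eq_sym (negbTE s41) => /eqP.
have b'0 : Phi v v' v' r = 0 by rewrite beta' b0 mulr0.
have Hs : spanning v w r.
  apply: free_spanning => a b c H.
  have a0 : a = 0.
    by move/(congr1 (Phi v v v)): H; rewrite tens0r !lin F1 lw lr => <-; ring.
  have b00 : b = 0.
    move/(congr1 (Phi v' v' v')): H; rewrite tens0r a0 !lin l'r l'w.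
    rewrite mul0r add0r mulr0 addr0 => /eqP; rewrite mulf_eq0 subr_eq0 eq_sym.
    by rewrite [1 == _]eq_sym (negbTE ss1) orbF => /eqP.
  move: H; rewrite a0 b00 !scale0r !add0r => /eqP; rewrite scaler_eq0 (negbTE r0) orbF.
  by move/eqP.
have s'0 : s' != 0.
  by apply: contraNneq s0 => s'0; move/eqP: Hss; rewrite s'0 expr0n /= eq_sym expf_eq0.
(* With this [a], F(t v + w) = t^4 - 2 a^2 t^2 + a^4 = (t^2 - a^2)^2, so a v + w is a double zero on
   the line through the two centers. As the derivative along [r] vanishes on that whole line, the
   point is singular on the curve. *)
have [a Ha] := closed_root (s^+2 - s' / s) (isT : (0 < 2)%N).
have B3' : 3 * Phi v v w w = - a ^+ 2.
  by apply: (mulfI s0); rewrite B3 Ha; field.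
have x0 : a *: v + w != 0.
  apply/eqP=> H; case: (@spanning_free _ _ _ _ a 1 0 Hs).
    by rewrite scale1r scale0r addr0.
  by move=> _ /eqP; rewrite oner_eq0.
apply: (spanning_singular Hs x0).
- rewrite !lin !(srt v w) F1 lw vwww.
  by apply: (lincomb1 (c1 := a) B3'); ring.
- rewrite !lin !(srt v w) lw vwww Fw.
  have E : (1 - s * s')^+2 = a ^+ 4.
    have -> : a ^+ 4 = (a ^+ 2) ^+ 2 by ring.
    rewrite Ha; apply: (mulfI (expf_neq0 2 s0)).
    have -> : s ^+ 2 * (s ^+ 2 - s' / s) ^+ 2 = (s ^+ 3 - s') ^+ 2 by field.
    by apply: (lincomb1 (c1 := s ^+ 4 - 1) Hss); ring.
  by apply: (lincomb2 (c1 := a^+2) (c2 := 1) B3' E); ring.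
have vvwr : Phi v v w r = 0 by rewrite Ew !lin b0 lr; ring.
have vwwr : Phi v w w r = 0 by rewrite (polar0 _ Cv lw lw) lr mul0r.
have wwwr : Phi w w w r = 0.
  rewrite {1}Ew !lin vwwr Ew !lin l'r !(srt v v') b'0 b0; ring.
by rewrite !lin !(srt v w) lr vvwr vwwr wwwr; ring.
Qed.


Definition reflection v x := x - (2 * Phi v v v x) *: v.

Lemma reflect_inv v x y z t : center v ->
  Phi (reflection v x) (reflection v y) (reflection v z) (reflection v t) = Phi x y z t.
Proof.
move=> Cv; have F1 := Cv.1.
have dec u : exists2 u0, Phi v v v u0 = 0 & u = u0 + Phi v v v u *: v.
  exists (u - Phi v v v u *: v); last by rewrite subrK.
  by rewrite !lin F1 mulr1 subrr.
have drefl u0 a : Phi v v v u0 = 0 -> reflection v (u0 + a *: v) = u0 - a *: v.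
  move=> l0; rewrite /reflection !lin l0 F1.
  by apply/rowP=> j; rewrite !mxE; ring.
case: (dec x) => x0 lx ->; case: (dec y) => y0 ly ->.
case: (dec z) => z0 lz ->; case: (dec t) => t0 lt ->.
move: (Phi v v v x) (Phi v v v y) (Phi v v v z) (Phi v v v t) => a b c d.
rewrite !drefl // !lin !(srt v x0, srt v y0, srt v z0).
rewrite !(polar0 _ Cv lx ly) !(polar0 _ Cv lx lz) !(polar0 _ Cv ly lz) lx ly lz lt.
ring.
Qed.

Lemma reflectK v x : center v -> reflection v (reflection v x) = x.
Proof.
case=> F1 _; rewrite /reflection !lin F1.
by apply/rowP=> j; rewrite !mxE; ring.
Qed.

Lemma center_reflect v x : center v -> center x -> center (reflection v x).
Proof.
move=> Cv Cx; split; first by rewrite reflect_inv //; case: Cx.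
move=> y z t.
rewrite -[y](reflectK _ Cv) -[z](reflectK _ Cv) -[t](reflectK _ Cv) !reflect_inv //.
by case: Cx.
Qed.

Lemma centerN v : center v -> center (- v).
Proof.
case=> F1 H; split; first by rewrite !lin F1; ring.
by move=> x y z; rewrite !lin H; ring.
Qed.

(** The cases are the orders 2, 3 and 4 of the product. The vector [x] is the component of c / s on
    the polar line of [v]. In order 3, s^4 = 1/16, in accordance with F(v + x) = 1 + 6 + 9. In order
    4, - x is the image of [v] under the homology of [c], so the dihedral group supplies a center
    commuting with [v]. *)
Lemma pair_cases v c : center v -> center c -> (forall k, c != k *: v) ->
  [\/ Phi v v v c = 0,
      exists2 x, c = Phi v v v c *: (v + x) &
        [/\ Phi v v v x = 0, Phi v v x x = 1 & Phi x x x x = 9] |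
      exists2 x, c = Phi v v v c *: (v + x) & Phi v v v x = 0 /\ center x].
Proof.
move=> Cv Cc Hp.
have [s0|s0] := eqVneq (Phi v v v c) 0; first by constructor 1.
have F1 := Cv.1.
have R1 := pair_rel c Cv; have R2 := pair_rel v Cc.
(* Eliminating Phi(v,v,c,c) between [R1] and [R2] leaves a relation between s and s' alone. *)
have R0 : (Phi c c c v ^+ 2 - Phi v v v c ^+ 2) * (1 - 2 * Phi v v v c * Phi c c c v) = 0.
  have E : Phi c c v v = Phi v v c c by rewrite !(srt v c).
  rewrite E in R2.
  by apply: (lincomb2 (c1 := Phi c c c v) (c2 := - Phi v v v c) R1 R2); ring.
have [x Ex] : exists x, x = (Phi v v v c)^-1 *: c - v by eexists.
have Ec : c = Phi v v v c *: (v + x).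
  by rewrite Ex addrCA subrr addr0 scalerA divff // scale1r.
have lx : Phi v v v x = 0.
  by rewrite Ex !lin F1 mulVf // subrr.
case/eqP: R0; rewrite mulf_eq0 => /orP[|] /eqP R0.
- constructor 2; exists x => //.
  have Hss : Phi c c c v ^+ 2 = Phi v v v c ^+ 2 by apply/eqP; rewrite -subr_eq0 R0.
  have H4 := pair_order3 Cv Cc Hp s0 Hss.
  set s := Phi v v v c in s0 R1 H4 Hss *; set s' := Phi c c c v in R1 R2 H4 Hss *.
  have Fc : Phi c c c c = 1 by case: Cc.
  have s4 : 16 * s ^+ 4 = 1.
    apply: (lincomb2 (c1 := 4 * s * s' + 1) (c2 := - 16 * s ^+ 2) H4 Hss); ring.
  have E0 : s ^+ 3 != 0 by rewrite expf_neq0.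
  have E12 : 12 * s ^+ 3 != 0 by rewrite mulf_neq0 ?natP_neq0.
  have E24 : 2 * s ^+ 4 != 0 by rewrite mulf_neq0 ?natP_neq0 ?expf_neq0.
  split=> //.
    apply: (mulfI E12); apply: (lincomb3 (c1 := - 4) (c2 := - 4 * s') (c3 := 16 * s) R1 H4 Hss).
    rewrite Ex !lin !(srt v c) F1 -/s.
    by move: (Phi v v c c) => b; field.
  apply: (mulfI E24); apply: (lincomb3 (c1 := - 4 * s) (c2 := -1) (c3 := -1) R1 H4 s4).
  rewrite Ex !lin !(srt v c) F1 Fc -/s.
  have -> : Phi v c c c = s' by rewrite /s' !(srt v c).
  by move: (Phi v v c c) => b; field.
- constructor 3; exists x => //; split=> //.
  have -> : x = - reflection c v.
    rewrite /reflection [X in _ *: X]Ec scalerA.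
    have -> : 2 * Phi c c c v * Phi v v v c = 1 by apply: (lincomb1 (c1 := -1) R0); ring.
    by rewrite scale1r opprB addrC addKr.
  exact/centerN/center_reflect.
Qed.

Lemma binary_quartic_roots (d0 d1 d2 d3 d4 : K) :
  ~ [/\ d0 = 0, d1 = 0, d2 = 0, d3 = 0 & d4 = 0] ->
  exists2 l : seq (K * K), (size l <= 4)%N & forall a b, (a, b) != (0, 0) ->
    d4 * a ^+ 4 + d3 * a ^+ 3 * b + d2 * a ^+ 2 * b ^+ 2 + d1 * a * b ^+ 3
      + d0 * b ^+ 4 = 0 ->
    exists2 p, p \in l & exists k, a = k * p.1 /\ b = k * p.2.
Proof.
move=> Hd; pose P := Poly [:: d0; d1; d2; d3; d4].
have Pe (t : K) : P.[t] = d4 * t ^+ 4 + d3 * t ^+ 3 + d2 * t ^+ 2 + d1 * t + d0.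
  by rewrite horner_Poly /=; ring.
have P0 : P != 0.
  apply/eqP=> P0; apply: Hd.
  have H i : P`_i = 0 by rewrite P0 coef0.
  by have := (H 0%N, H 1%N, H 2%N, H 3%N, H 4%N); rewrite !coef_Poly /= => -[[[[-> ->] ->] ->] ->].
have [rs Ers] := closed_field_poly_normal P.
have Ps : (size P <= 5)%N by apply: leq_trans (size_Poly _) _.
have lP : lead_coef P != 0 by rewrite lead_coef_eq0.
have Srs : size P = (size rs).+1.
  by rewrite Ers size_scale // size_prod_XsubC.
have Hrs a b : b != 0 -> P.[a / b] = 0 -> a / b \in rs.
  move=> b0 /eqP; rewrite Ers hornerZ mulf_eq0 (negbTE lP) /= => H.
  by rewrite -root_prod_XsubC.
have E a b : b != 0 -> d4 * a ^+ 4 + d3 * a ^+ 3 * b + d2 * a ^+ 2 * b ^+ 2 + d1 * a * b ^+ 3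
      + d0 * b ^+ 4 = 0 -> exists2 p, p \in [seq (t, 1) | t <- rs] & exists k, a = k * p.1 /\ b = k * p.2.
  move=> b0 H; exists (a / b, 1).
    apply/mapP; exists (a / b) => //; apply: Hrs => //.
    apply: (mulfI (expf_neq0 4 b0)); rewrite mulr0 -[RHS]H Pe; by field.
  by exists b; rewrite /= mulr1 mulrCA divff // mulr1.
(* The root (1, 0) at infinity makes up for the degree lost by the dehomogenized polynomial, so the
   bound 4 is kept. *)
have [d40|d40] := eqVneq d4 0.
  exists ((1, 0) :: [seq (t, 1) | t <- rs]).
    rewrite /= size_map -Srs.
    apply/leq_sizeP => j; rewrite coef_Poly.
    by case: j => [|[|[|[|[|j]]]]] //= _; rewrite nth_nil.
  move=> a b ab H; have [b0|b0] := eqVneq b 0.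
    exists (1, 0); first by rewrite inE eqxx.
    by exists a; rewrite /= mulr1 mulr0 b0.
  by case: (E a b b0 H) => p Hp Hk; exists p; rewrite // inE Hp orbT.
exists [seq (t, 1) | t <- rs].
  by rewrite size_map -ltnS -Srs.
move=> a b ab H; apply: E => //; apply: contraNneq ab => b0.
move/eqP: H; rewrite b0 !expr0n /= !mulr0 !addr0 mulf_eq0 (negbTE d40) expf_eq0 /=.
by move/eqP->.
Qed.

(** With B(x) = Phi(v,v,x,x), the conditions give F = 9 B^2 on the polar line of [v]. This binary
    quartic has at most four zeros up to scalars, and B(x) = 1 fixes the scalar up to sign. *)
Lemma order3_list v : center v -> exists2 l : seq V, size l = 8 &
  forall x, Phi v v v x = 0 -> Phi v v x x = 1 -> Phi x x x x = 9 -> x \in l.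
Proof.
move=> Cv; have F1 := Cv.1.
case: (polar_basis F1) => e0 [e1 [l0 l1 Hs]].
have B01 : Phi v v e1 e0 = Phi v v e0 e1 by rewrite !(srt e0 e1).
have [B00 HB0] : exists b : K, b = Phi v v e0 e0 by eexists.
have [B11 HB1] : exists b : K, b = Phi v v e1 e1 by eexists.
have [b01 Hb] : exists b : K, b = Phi v v e0 e1 by eexists.
have [f0 H0] : exists b : K, b = Phi e0 e0 e0 e0 by eexists.
have [f1 H1] : exists b : K, b = Phi e0 e0 e0 e1 by eexists.
have [f2 H2] : exists b : K, b = Phi e0 e0 e1 e1 by eexists.
have [f3 H3] : exists b : K, b = Phi e0 e1 e1 e1 by eexists.
have [f4 H4] : exists b : K, b = Phi e1 e1 e1 e1 by eexists.
pose D a b := 9 * (B00 * a ^+ 2 + 2 * b01 * a * b + B11 * b ^+ 2) ^+ 2 -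
   (f0 * a ^+ 4 + 4 * f1 * a ^+ 3 * b + 6 * f2 * a ^+ 2 * b ^+ 2 + 4 * f3 * a * b ^+ 3 + f4 * b ^+ 4).
have EB a b : Phi v v (a *: e0 + b *: e1) (a *: e0 + b *: e1) = B00 * a ^+ 2 + 2 * b01 * a * b + B11 * b ^+ 2.
  by rewrite !lin !(srt e0 e1) HB0 HB1 Hb; ring.
have EF a b : Phi (a *: e0 + b *: e1) (a *: e0 + b *: e1) (a *: e0 + b *: e1) (a *: e0 + b *: e1)
   = f0 * a ^+ 4 + 4 * f1 * a ^+ 3 * b + 6 * f2 * a ^+ 2 * b ^+ 2 + 4 * f3 * a * b ^+ 3 + f4 * b ^+ 4.
  by rewrite !lin !(srt e0 e1) H0 H1 H2 H3 H4; ring.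
(* If F = 9 B^2 held identically on the polar line, the curve would be the double conic (z^2 + 3
   B)^2 = 0. Agreement to first order at [e0] already makes a v + e0 singular. *)
have Hd : ~ [/\ 9 * B11 ^+ 2 - f4 = 0, 36 * b01 * B11 - 4 * f3 = 0,
   36 * b01 ^+ 2 + 18 * B00 * B11 - 6 * f2 = 0, 36 * B00 * b01 - 4 * f1 = 0 & 9 * B00 ^+ 2 - f0 = 0].
  case=> _ _ _ D1 D0.
  have [a Ha] := closed_root (- (3 * B00)) (isT : (0 < 2)%N).
  have x0 : a *: v + e0 != 0.
    apply/eqP=> H; case: (@spanning_free _ _ _ _ a 1 0 Hs).
      by rewrite scale1r scale0r addr0.
    by move=> _ /eqP; rewrite oner_eq0.
  have v000 : Phi v e0 e0 e0 = 0 by rewrite (polar0 _ Cv l0 l0) l0 mul0r.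
  have v001 : Phi v e0 e0 e1 = 0 by rewrite (polar0 _ Cv l0 l0) l1 mul0r.
  have Ef1 : f1 = 9 * B00 * b01.
    by apply: (mulfI (natP_neq0 (isT : 0 < 4)%N)); apply: (lincomb1 (c1 := -1) D1); ring.
  apply: (spanning_singular Hs x0); rewrite !lin !(srt v e0) ?F1 ?l0 ?v000 ?l1 ?v001 -?HB0 -?Hb -?H0 -?H1.
  - by apply: (lincomb1 (c1 := a) Ha); ring.
  - by apply: (lincomb2 (c1 := 3 * B00) (c2 := -1) Ha D0); ring.
  - by rewrite Ef1; apply: (lincomb1 (c1 := 3 * b01) Ha); ring.
case: (binary_quartic_roots Hd) => l sl Hl.
(* The representative [w p] has to be a function of the root, so a square root is selected by
   [xchoose], with default 0 at k = 0. *)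
have sq k : {c : K | k != 0 -> c ^+ 2 * k = 1}.
  have [_|k0] := eqVneq k 0; first by exists 0.
  have H : exists c, c ^+ 2 == k^-1 by case: (closed_root k^-1 (isT : (0 < 2)%N)) => c <-; exists c.
  by exists (xchoose H); rewrite (eqP (xchooseP H)) mulVf.
pose w (p : K * K) := sval (sq (B00 * p.1 ^+ 2 + 2 * b01 * p.1 * p.2 + B11 * p.2 ^+ 2)) *: (p.1 *: e0 + p.2 *: e1).
pose L := [seq w p | p <- l] ++ [seq - w p | p <- l].
have sL : (size L <= 8)%N.
  by rewrite size_cat !size_map -[8%N]/(4 + 4)%N leq_add.
(* Zero vectors pad the list to length exactly 8, so that the lists built from it have a fixed
   length. *)
exists (L ++ nseq (8 - size L) 0).
  by rewrite size_cat size_nseq subnKC.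
move=> x lx Bx Fx; rewrite mem_cat; apply/orP; left.
case: (Hs x) => c [a [b Ex]].
have c0 : c = 0 by move: lx; rewrite Ex !lin F1 l0 l1 => <-; ring.
rewrite c0 scale0r add0r in Ex.
have Bab := EB a b; rewrite -Ex Bx in Bab.
have Fab := EF a b; rewrite -Ex Fx in Fab.
have ab0 : (a, b) != (0, 0).
  apply/eqP=> -[a0 b0]; move/eqP: Bab; rewrite a0 b0.
  by rewrite !expr0n /= !mulr0 !addr0 oner_eq0.
have Dab : 0 = D a b by rewrite /D -Bab -Fab; ring.
have Dab' : (9 * B00 ^+ 2 - f0) * a ^+ 4 + (36 * B00 * b01 - 4 * f1) * a ^+ 3 * b
    + (36 * b01 ^+ 2 + 18 * B00 * B11 - 6 * f2) * a ^+ 2 * b ^+ 2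
    + (36 * b01 * B11 - 4 * f3) * a * b ^+ 3 + (9 * B11 ^+ 2 - f4) * b ^+ 4 = 0.
  by rewrite [RHS]Dab /D; ring.
have [p pl [k [Ek1 Ek2]]] := Hl a b ab0 Dab'.
have Bp : k ^+ 2 * (B00 * p.1 ^+ 2 + 2 * b01 * p.1 * p.2 + B11 * p.2 ^+ 2) = 1.
  by rewrite [RHS]Bab Ek1 Ek2; ring.
have Bp0 : B00 * p.1 ^+ 2 + 2 * b01 * p.1 * p.2 + B11 * p.2 ^+ 2 != 0.
  by apply/eqP=> H; move/eqP: Bp; rewrite H mulr0 eq_sym oner_eq0.
have Ewp := svalP (sq (B00 * p.1 ^+ 2 + 2 * b01 * p.1 * p.2 + B11 * p.2 ^+ 2)) Bp0.
have Exp : x = k *: (p.1 *: e0 + p.2 *: e1).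
  by rewrite Ex Ek1 Ek2 scalerDr !scalerA.
move: Ewp; rewrite -[X in _ = X]Bp => /(mulIf Bp0)/eqP; rewrite eqf_sqr mem_cat => /orP[] /eqP E.
  by apply/orP; left; apply/mapP; exists p; rewrite // /w E.
by apply/orP; right; apply/mapP; exists p; rewrite // /w E scaleNr opprK.
Qed.

(** * Frames of three commuting centers and the even form of the quartic *)

Definition frame v w r : Prop :=
  [/\ center v, center w & center r] /\
  [/\ Phi v v v w = 0, Phi v v v r = 0 & Phi w w w r = 0].

Lemma frame_swap12 v w r : frame v w r -> frame w v r.
Proof. by case=> -[Cv Cw Cr] [vw vr wr]; split; split=> //; apply: (center_comm Cv). Qed.

Lemma frame_swap23 v w r : frame v w r -> frame v r w.
Proof. by case=> -[Cv Cw Cr] [vw vr wr]; split; split=> //; apply: (center_comm Cw). Qed.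

Lemma frame_spanning v w r : frame v w r -> spanning v w r.
Proof.
case=> -[Cv Cw Cr] [vw vr wr]; have wv := center_comm Cv Cw vw.
have rv := center_comm Cv Cr vr; have rw := center_comm Cw Cr wr.
have [[[Fv _] [Fw _]] [Fr _]] := (Cv, Cw, Cr).
apply: free_spanning => a b k H; split.
- by move/(congr1 (Phi v v v)): H; rewrite tens0r !lin Fv vw vr => <-; ring.
- by move/(congr1 (Phi w w w)): H; rewrite tens0r !lin Fw wv wr => <-; ring.
- by move/(congr1 (Phi r r r)): H; rewrite tens0r !lin Fr rv rw => <-; ring.
Qed.

(** The six ways to give index 1 to two of the four arguments and index 2 to the others: the
    polarization of 6 x1^2 x2^2. *)
Definition mixed (x1 y1 z1 t1 x2 y2 z2 t2 : K) :=
  x1 * y1 * z2 * t2 + x1 * z1 * y2 * t2 + x1 * t1 * y2 * z2 +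
  y1 * z1 * x2 * t2 + y1 * t1 * x2 * z2 + z1 * t1 * x2 * y2.

(** Each of the three homologies changes the sign of one coordinate, so only the monomials even in
    every coordinate survive. *)
Lemma frame_tens v w r (x1 x2 x3 y1 y2 y3 z1 z2 z3 t1 t2 t3 : K) : frame v w r ->
  Phi (x1 *: v + x2 *: w + x3 *: r) (y1 *: v + y2 *: w + y3 *: r)
      (z1 *: v + z2 *: w + z3 *: r) (t1 *: v + t2 *: w + t3 *: r) =
  x1 * y1 * z1 * t1 + x2 * y2 * z2 * t2 + x3 * y3 * z3 * t3 +
  Phi v v w w * mixed x1 y1 z1 t1 x2 y2 z2 t2 +
  Phi v v r r * mixed x1 y1 z1 t1 x3 y3 z3 t3 +
  Phi w w r r * mixed x2 y2 z2 t2 x3 y3 z3 t3.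
Proof.
case=> -[Cv Cw Cr] [vw vr wr]; have wv := center_comm Cv Cw vw.
have rv := center_comm Cv Cr vr; have rw := center_comm Cw Cr wr.
have [[[Fv _] [Fw _]] [Fr _]] := (Cv, Cw, Cr).
have vvwr : Phi v v w r = 0.
  by have := polar0 v Cw wv wr; rewrite wv mul0r !(srt v w, srt v r, srt w r).
have vwwr : Phi v w w r = 0.
  by have := polar0 w Cv vw vr; rewrite vw mul0r !(srt v w, srt v r, srt w r).
have vwrr : Phi v w r r = 0.
  by have := polar0 r Cv vw vr; rewrite vr mul0r.
have vwww : Phi v w w w = 0 by rewrite !(srt v w) in wv.
have vrrr : Phi v r r r = 0 by rewrite !(srt v r) in rv.
have wrrr : Phi w r r r = 0 by rewrite !(srt w r) in rw.
rewrite !lin !(srt v w, srt v r, srt w r).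
rewrite Fv Fw Fr vw vr wr vvwr vwwr vwrr vwww vrrr wrrr /mixed.
ring.
Qed.

Lemma frame_gradient v w r (x1 x2 x3 z1 z2 z3 : K) : frame v w r ->
  let p := x1 *: v + x2 *: w + x3 *: r in
  Phi p p p (z1 *: v + z2 *: w + z3 *: r) =
  x1 * (x1 ^+ 2 + 3 * (Phi v v w w * x2 ^+ 2 + Phi v v r r * x3 ^+ 2)) * z1 +
  x2 * (x2 ^+ 2 + 3 * (Phi v v w w * x1 ^+ 2 + Phi w w r r * x3 ^+ 2)) * z2 +
  x3 * (x3 ^+ 2 + 3 * (Phi v v r r * x1 ^+ 2 + Phi w w r r * x2 ^+ 2)) * z3.
Proof. by move=> Hf p; rewrite /p frame_tens // /mixed; ring. Qed.

Lemma frame_nonsingular v w r (x1 x2 x3 : K) : frame v w r ->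
  x1 * (x1 ^+ 2 + 3 * (Phi v v w w * x2 ^+ 2 + Phi v v r r * x3 ^+ 2)) = 0 ->
  x2 * (x2 ^+ 2 + 3 * (Phi v v w w * x1 ^+ 2 + Phi w w r r * x3 ^+ 2)) = 0 ->
  x3 * (x3 ^+ 2 + 3 * (Phi v v r r * x1 ^+ 2 + Phi w w r r * x2 ^+ 2)) = 0 ->
  [/\ x1 = 0, x2 = 0 & x3 = 0].
Proof.
move=> Hf E1 E2 E3.
have Hs := frame_spanning Hf.
have [x0|x0] := eqVneq (x1 *: v + x2 *: w + x3 *: r) 0.
  exact: spanning_free Hs x0.
case: (smooth x0) => y; case: (Hs y) => a [b [k ->]].
by rewrite frame_gradient // E1 E2 E3 !mul0r !addr0 eqxx.
Qed.

(** If 3 C is 1 or -1, with C = Phi(w,w,r,r), the curve meets the line x = 0 in (y^2 + z^2)^2 = 0 or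
    (y^2 - z^2)^2 = 0, and a double zero there is a singular point. *)
Lemma frame_coef_neq v w r : frame v w r -> 9 * Phi w w r r ^+ 2 != 1.
Proof.
move=> Hf; apply/eqP=> H.
have [b Hb] := closed_root (- (3 * Phi w w r r)) (isT : (0 < 2)%N).
case: (@frame_nonsingular _ _ _ 0 b 1 Hf).
- by rewrite mul0r.
- by rewrite Hb; ring.
- by rewrite Hb; apply: (lincomb1 (c1 := -1) H); ring.
by move=> _ _ /eqP; rewrite oner_eq0.
Qed.

Lemma frame_center3 v w r : frame v w r -> center r. Proof. by case=> -[]. Qed.

Lemma center_scale v k : center v -> k ^+ 4 = 1 -> center (k *: v).
Proof.
case=> F1 H k4; split.
  by rewrite !lin F1 -[RHS]k4; ring.
move=> x y z; rewrite !lin H.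
apply: (lincomb1 (c1 := - k * (Phi v v v x * Phi v v y z + Phi v v v y * Phi v v x z
  + Phi v v v z * Phi v v x y) + k * (k ^+ 4 + 1) * (2 * Phi v v v x * Phi v v v y * Phi v v v z)) k4); ring.
Qed.

Lemma center_scale_root v k : center v -> center (k *: v) -> k ^+ 4 = 1.
Proof.
case=> F1 _ [H _]; move: H; rewrite !lin F1 => H.
by rewrite -[RHS]H; ring.
Qed.

Lemma frame_scale3 v w r k : frame v w r -> k ^+ 4 = 1 -> frame v w (k *: r).
Proof.
case=> -[Cv Cw Cr] [vw vr wr] k4; split; split=> //; first exact: center_scale.
  by rewrite !lin vr mulr0.
by rewrite !lin wr mulr0.
Qed.

(** The third center is the intersection of the two polar lines. It lies off the curve, where
    otherwise all first derivatives would vanish at it, and can thus be scaled to F = 1. *)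
Lemma frame_third v w : center v -> center w -> Phi v v v w = 0 ->
  exists r, frame v w r.
Proof.
move=> Cv Cw vw; have wv := center_comm Cv Cw vw.
have [[Fv pv] [Fw pw]] := (Cv, Cw).
have [r0 r00 [vr wr]] := polar_kernel2 w Fv.
have Hs : spanning v w r0.
  apply: free_spanning => a b k H.
  have a0 : a = 0.
    by move/(congr1 (Phi v v v)): H; rewrite tens0r !lin Fv vw vr => <-; ring.
  have b0 : b = 0.
    by move/(congr1 (Phi w w w)): H; rewrite tens0r !lin Fw wv wr => <-; ring.
  move: H; rewrite a0 b0 !scale0r !add0r => /eqP; rewrite scaler_eq0 (negbTE r00) orbF.
  by move/eqP.
have vrrr : Phi v r0 r0 r0 = 0 by rewrite (polar0 _ Cv vr vr) vr mul0r.
have wrrr : Phi w r0 r0 r0 = 0 by rewrite (polar0 _ Cw wr wr) wr mul0r.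
have Fr : Phi r0 r0 r0 r0 != 0.
  apply/eqP=> Fr; apply: (spanning_singular Hs r00) => //.
    by rewrite !(srt v r0).
  by rewrite !(srt w r0).
have [k Hk] := closed_root (Phi r0 r0 r0 r0)^-1 (isT : (0 < 4)%N).
exists (k *: r0); split; split=> //; last first.
- by rewrite !lin wr mulr0.
- by rewrite !lin vr mulr0.
have k0 : k != 0.
  by apply/eqP=> k0; move/eqP: Hk; rewrite k0 expr0n /= eq_sym invr_eq0 (negbTE Fr).
have [r Er] : exists r, r = k *: r0 by eexists.
have vr' : Phi v v v r = 0 by rewrite Er !lin vr mulr0.
have wr' : Phi w w w r = 0 by rewrite Er !lin wr mulr0.
have Frr : Phi r r r r = 1.
  rewrite Er !lin; transitivity (k ^+ 4 * Phi r0 r0 r0 r0); first by ring.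
  by rewrite Hk mulVf.
have Hs' : spanning v w r.
  move=> y; case: (Hs y) => a [b [c ->]]; exists a, b, (c / k).
  by rewrite Er scalerA divfK.
rewrite -Er.
have vrrr' : Phi v r r r = 0 by rewrite (polar0 _ Cv vr' vr') vr' mul0r.
have wrrr' : Phi w r r r = 0 by rewrite (polar0 _ Cw wr' wr') wr' mul0r.
have vvwr : Phi v v w r = 0.
  by have := polar0 v Cw wv wr'; rewrite wv mul0r !(srt v w, srt v r, srt w r).
have vwwr : Phi v w w r = 0.
  by have := polar0 w Cv vw vr'; rewrite vw mul0r !(srt v w, srt v r, srt w r).
have vwrr : Phi v w r r = 0.
  by have := polar0 r Cv vw vr'; rewrite vr' mul0r.
split=> // x y z.
case: (Hs' x) => x1 [x2 [x3 ->]]; case: (Hs' y) => y1 [y2 [y3 ->]].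
case: (Hs' z) => z1 [z2 [z3 ->]].
rewrite !lin !(srt v w, srt v r, srt w r).
rewrite Frr vr' wr' vvwr vwwr vwrr vrrr' wrrr'; ring.
Qed.

Lemma frame_polar1 v w r (x1 x2 x3 : K) : frame v w r ->
  Phi v v v (x1 *: v + x2 *: w + x3 *: r) = x1.
Proof.
move=> Hf; have := frame_tens 1 0 0 1 0 0 1 0 0 x1 x2 x3 Hf.
by rewrite scale1r !scale0r !addr0 /mixed => ->; ring.
Qed.

Lemma frame_polar2 v w r (x1 x2 x3 y1 y2 y3 : K) : frame v w r ->
  Phi v v (x1 *: v + x2 *: w + x3 *: r) (y1 *: v + y2 *: w + y3 *: r) =
  x1 * y1 + Phi v v w w * x2 * y2 + Phi v v r r * x3 * y3.
Proof.
move=> Hf; have := frame_tens 1 0 0 1 0 0 x1 x2 x3 y1 y2 y3 Hf.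
by rewrite scale1r !scale0r !addr0 /mixed => ->; ring.
Qed.

Lemma galois_frame v w r : frame v w r ->
  Phi v v w w = 0 -> Phi v v r r = 0 -> galois v.
Proof.
move=> Hf A0 B0 x y; have Hs := frame_spanning Hf.
case: (Hs x) => x1 [x2 [x3 ->]]; case: (Hs y) => y1 [y2 [y3 ->]] Hx Hy.
rewrite !(frame_polar1 _ _ _ Hf) in Hx Hy.
by rewrite (frame_polar2 _ _ _ _ _ _ Hf) Hx Hy A0 B0; ring.
Qed.

Let linZ := (tensZ HPhi, tensZ2 HPhi, tensZ3 HPhi, tensZ4 HPhi).

(** For A = B the exchange of [w] with [- r] preserves F, and it is the homology of center w + r.
    The normalization comes from F(w + r) = 2 + 6 C. *)
Lemma swap_center1 v w r k : frame v w r -> Phi v v w w = Phi v v r r ->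
  k ^+ 4 * (2 + 6 * Phi w w r r) = 1 -> center (k *: (w + r)).
Proof.
move=> Hf AB Hk; have Hs := frame_spanning Hf.
have Ef : w + r = 0 *: v + 1 *: w + 1 *: r by rewrite scale0r !scale1r add0r.
split.
  rewrite !linZ Ef frame_tens // /mixed -[RHS]Hk; ring.
move=> x y z.
case: (Hs x) => x1 [x2 [x3 ->]]; case: (Hs y) => y1 [y2 [y3 ->]].
case: (Hs z) => z1 [z2 [z3 ->]].
rewrite !linZ.
rewrite Ef !frame_tens // /mixed -AB.
move: (Phi v v w w) (Phi w w r r) Hk => A C Hk.
pose B (a1 a2 a3 b1 b2 b3 : K) := 2 * A * a1 * b1 + a2 * b2 + a3 * b3
  + C * (a2 * b2 + a3 * b3 + 2 * (a2 * b3 + a3 * b2)).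
apply: (mulfI (natP_neq0 (isT : (0 < 2)%N))).
apply: (lincomb1 (c1 := - k * ((x2 + x3) * B y1 y2 y3 z1 z2 z3
  + (y2 + y3) * B x1 x2 x3 z1 z2 z3 + (z2 + z3) * B x1 x2 x3 y1 y2 y3)
  + k * (1 + 3 * C) * (k ^+ 4 * (2 + 6 * C) + 1) * (x2 + x3) * (y2 + y3) * (z2 + z3)) Hk).
rewrite /B; ring.
Qed.


Lemma swap_center v w r k eta : frame v w r -> eta ^+ 4 = 1 ->
  Phi v v w w = eta ^+ 2 * Phi v v r r ->
  k ^+ 4 * (2 + 6 * eta ^+ 2 * Phi w w r r) = 1 -> center (k *: (w + eta *: r)).
Proof.
move=> Hf He AB Hk; apply: (swap_center1 (frame_scale3 Hf He)).
  by rewrite !lin AB; ring.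
by rewrite !lin -[RHS]Hk; ring.
Qed.

(** Both [v] and g = w - eta r lie on the polar line of the center f, so [polar0] gives Phi(f,v,g,v)
    = 0, whose left side is a multiple of the difference to be killed. *)
Lemma swap_rel v w r k eta : frame v w r -> eta ^+ 4 = 1 ->
  center (k *: (w + eta *: r)) -> Phi v v w w = eta ^+ 2 * Phi v v r r.
Proof.
move=> Hf He Cf; have k0 : k != 0.
  by apply/eqP=> k0; have := center_nz Cf; rewrite k0 scale0r eqxx.
have e0 : eta != 0.
  by apply/eqP=> e0; move/eqP: He; rewrite e0 expr0n /= eq_sym oner_eq0.
have Ef : k *: (w + eta *: r) = 0 *: v + k *: w + (k * eta) *: r.
  by rewrite scale0r add0r scalerDr scalerA.
rewrite Ef in Cf.
have Ev : v = 1 *: v + 0 *: w + 0 *: r by rewrite scale1r !scale0r !addr0.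
have lv : Phi (0 *: v + k *: w + (k * eta) *: r) (0 *: v + k *: w + (k * eta) *: r)
    (0 *: v + k *: w + (k * eta) *: r) (1 *: v + 0 *: w + 0 *: r) = 0.
  by rewrite frame_tens // /mixed; ring.
have lg : Phi (0 *: v + k *: w + (k * eta) *: r) (0 *: v + k *: w + (k * eta) *: r)
    (0 *: v + k *: w + (k * eta) *: r) (0 *: v + 1 *: w + (- eta) *: r) = 0.
  rewrite frame_tens // /mixed.
  by apply: (lincomb1 (c1 := - k ^+ 3) He); ring.
have := polar0 (1 *: v + 0 *: w + 0 *: r) Cf lv lg.
rewrite lv mul0r frame_tens // /mixed => H.
apply/eqP; rewrite -subr_eq0; apply/eqP; apply: (mulfI k0); rewrite mulr0 -[RHS]H.
ring.
Qed.

(** Apply [pair_cases] to [w] and [f]. Order 3 would give 9 C^2 = 1; order 4 makes (c / b) r a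
    center, whence c / b is a fourth root of unity. *)
Lemma commuting_centers v w r f : frame v w r -> center f -> Phi v v v f = 0 ->
  [\/ exists k, f = k *: w, exists k, f = k *: r |
      exists k eta, eta ^+ 4 = 1 /\ f = k *: (w + eta *: r)].
Proof.
move=> Hf Cf vf; have [[Cv Cw Cr] [vw vr wr]] := Hf.
have Hs := frame_spanning Hf.
case: (Hs f) => a [b [c Ef]].
have a0 : a = 0 by move: vf; rewrite Ef (frame_polar1 _ _ _ Hf).
rewrite a0 scale0r add0r in Ef.
have [b0|b0] := eqVneq b 0.
  by constructor 2; exists c; rewrite Ef b0 scale0r add0r.
have [c0|c0] := eqVneq c 0.
  by constructor 1; exists b; rewrite Ef c0 scale0r addr0.
have wf : Phi w w w f = b.
  by rewrite Ef !lin wr; case: Cw => -> _; ring.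
have Hp k : f != k *: w.
  apply: contra c0 => /eqP H; apply/eqP.
  have H0 : 0 *: v + (b - k) *: w + c *: r = 0.
    by rewrite scale0r add0r scalerBl addrAC -Ef H subrr.
  by case: (spanning_free Hs H0).
constructor 3; exists b, (c / b).
have Ef' : f = b *: (w + (c / b) *: r).
  by rewrite Ef scalerDr scalerA mulrCA divff // mulr1.
split=> //; case: (pair_cases Cw Cf Hp).
- by rewrite wf => H; rewrite H eqxx in b0.
- rewrite wf => -[x Efx [lx Bx Fx]]; exfalso.
  have Ex : x = (c / b) *: r.
    by apply: (addrI w); apply: (scalerI b0); rewrite -Efx -Ef'.
  move/eqP: (frame_coef_neq Hf); apply.
  move: Bx Fx; rewrite Ex !lin; case: (Cr) => -> _ Bx Fx.
  apply: (lincomb2 (c1 := (c / b) ^+ 2 * Phi w w r r + 1) (c2 := - Phi w w r r ^+ 2) Bx Fx).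
  ring.
rewrite wf => -[x Efx [lx Cx]].
have Ex : x = (c / b) *: r.
  by apply: (addrI w); apply: (scalerI b0); rewrite -Efx -Ef'.
by apply: (center_scale_root Cr); rewrite -Ex.
Qed.

(** * Finite lists containing all centers *)

Lemma half_root v x : (forall c, center c -> ~ galois c) ->
  center v -> center x -> Phi v v v x = 0 ->
  exists eta, forall theta k, theta ^+ 4 = 1 -> center (k *: (v + theta *: x)) ->
    theta = eta \/ theta = - eta.
Proof.
move=> Hng Cv Cx vx; case: (frame_third Cv Cx vx) => r Hf.
have Hf' : frame r v x := frame_swap12 (frame_swap23 Hf).
case: (classic (exists theta k, theta ^+ 4 = 1 /\ center (k *: (v + theta *: x)))); last first.
  by move=> H; exists 0 => theta k H4 Ck; case: H; exists theta, k.
move=> [t0 [k0 [Ht0 Ck0]]]; exists t0 => t k Ht Ck.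
have R0 := swap_rel Hf' Ht0 Ck0; have R := swap_rel Hf' Ht Ck.
(* If this coefficient vanished, so would Phi(r,r,v,v), and [r] would be galois. Hence theta^2 is
   the ratio of the two, the same for all theta. *)
have X0 : Phi r r x x != 0.
  apply/eqP=> X0; apply: (Hng r (frame_center3 Hf)).
  by apply: (galois_frame Hf') => //; rewrite R0 X0 mulr0.
move: R; rewrite R0 => /(mulIf X0)/eqP; rewrite eqf_sqr => /orP[] /eqP ->; first by left.
by right; rewrite opprK.
Qed.

(** The candidates are [v] and the four points w, r, w + eta r, w - eta r commuting with it, eight
    points v + x of order 3, and two points v + e y, v - e y for each of the four commuting y. The
    point [w + eta *: r] is kept apart because equality in the count is used to force this one to
    occur. *)
Lemma cover_frame v w r : (forall c, center c -> ~ galois c) -> frame v w r ->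
  exists2 eta, eta ^+ 4 = 1 & exists2 l : seq V, size l = 20 &
  forall c, center c -> exists2 y, y \in (w + eta *: r) :: l & exists k, c = k *: y.
Proof.
move=> Hng Hf; have [[Cv Cw Cr] [vw vr wr]] := Hf.
have [eta [He Heta]] : exists eta, eta ^+ 4 = 1 /\ forall theta k, theta ^+ 4 = 1 ->
    center (k *: (w + theta *: r)) -> theta = eta \/ theta = - eta.
  case: (classic (exists theta k, theta ^+ 4 = 1 /\ center (k *: (w + theta *: r)))); last first.
    (* No center of this shape exists, so any fourth root of unity serves; the candidates built from
       it only lengthen the list. *)
    move=> H; exists 1; split; first exact: expr1n.
    by move=> theta k H4 Ck; case: H; exists theta, k.
  case=> t0 [k0 [Ht0 Ck0]]; exists t0; split=> // t k Ht Ck.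
  case: (half_root Hng Cw Cr wr) => e H.
  by case: (H _ _ Ht0 Ck0) => ->; case: (H _ _ Ht Ck) => ->; rewrite ?opprK; auto.
exists eta => //.
have [l8 sl8 Hl8] := order3_list Cv.
have half x : exists eta, center x -> Phi v v v x = 0 ->
    forall theta k, theta ^+ 4 = 1 -> center (k *: (v + theta *: x)) ->
    theta = eta \/ theta = - eta.
  case: (classic (center x /\ Phi v v v x = 0)) => [[Cx vx]|H].
    by case: (half_root Hng Cv Cx vx) => e He'; exists e.
  by exists 0 => Cx vx; case: H.
(* The list must be written down uniformly, whether or not a multiple of w + e r is a center; k = 0
   is the default when none is. *)
have scaled e : exists k, center (k *: (w + e *: r)) \/ forall k, ~ center (k *: (w + e *: r)).
  case: (classic (exists k, center (k *: (w + e *: r)))) => [[k Hk]|H].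
    by exists k; left.
  by exists 0; right=> k Ck; apply: H; exists k.
have [k1 Hk1] := scaled eta; have [k2 Hk2] := scaled (- eta).
pose f1 := k1 *: (w + eta *: r); pose f2 := k2 *: (w - eta *: r).
have [e1 He1] := half w; have [e2 He2] := half r.
have [e3 He3] := half f1; have [e4 He4] := half f2.
exists ([:: v; w; r; w - eta *: r] ++ [seq v + x | x <- l8] ++
   [:: v + e1 *: w; v - e1 *: w; v + e2 *: r; v - e2 *: r;
       v + e3 *: f1; v - e3 *: f1; v + e4 *: f2; v - e4 *: f2]).
  by rewrite !size_cat size_map sl8.
move=> c Cc.
case: (classic (exists k, c = k *: v)) => [[k Hk]|Hp].
  by exists v; [rewrite !inE eqxx ?orbT | exists k].
have {}Hp k : c != k *: v by apply/eqP=> H; apply: Hp; exists k.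
case: (pair_cases Cv Cc Hp) => [vc|[x Ec [lx Bx Fx]]|[x Ec [lx Cx]]].
- case: (commuting_centers Hf Cc vc) => [[k Ek]|[k Ek]|[k [t [Ht Ek]]]].
  + by exists w; [rewrite !inE eqxx ?orbT | exists k].
  + by exists r; [rewrite !inE eqxx ?orbT | exists k].
  rewrite Ek in Cc; case: (Heta _ _ Ht Cc) => Et.
    by exists (w + eta *: r); [rewrite !inE eqxx ?orbT | exists k; rewrite Ek Et].
  by exists (w - eta *: r); [rewrite !inE eqxx ?orbT | exists k; rewrite Ek Et scaleNr].
- exists (v + x); last by exists (Phi v v v c).
  by rewrite !(inE, mem_cat) (map_f (fun x => v + x)) ?orbT // Hl8.
(* Two proportional centers differ by a fourth root of unity k, and v + x = v + k y allows only two
   values of k. *)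
have Hhalf y k e : x = k *: y -> center y -> (center y -> Phi v v v y = 0 ->
    forall theta k, theta ^+ 4 = 1 -> center (k *: (v + theta *: y)) ->
    theta = e \/ theta = - e) ->
    exists2 z, z \in [:: v + e *: y; v - e *: y] & exists k, c = k *: z.
  move=> Ex Cy H; have k4 : k ^+ 4 = 1 by apply: (center_scale_root Cy); rewrite -Ex.
  have k0 : k != 0 by apply/eqP=> k0; move/eqP: k4; rewrite k0 expr0n eq_sym oner_eq0.
  have ly : Phi v v v y = 0.
    by apply: (mulfI k0); rewrite mulr0 -[LHS](tensZ4 HPhi) -Ex.
  rewrite Ec Ex in Cc; case: (H Cy ly _ _ k4 Cc) => Ek.
    by exists (v + e *: y); [rewrite !inE eqxx ?orbT | exists (Phi v v v c); rewrite {1}Ec Ex Ek].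
  by exists (v - e *: y); [rewrite !inE eqxx ?orbT | exists (Phi v v v c); rewrite {1}Ec Ex Ek scaleNr].
case: (commuting_centers Hf Cx lx) => [[k Ek]|[k Ek]|[k [t [Ht Ek]]]].
- case: (Hhalf _ _ _ Ek Cw He1) => z Hz Hk; exists z => //.
  by move: Hz; rewrite !(inE, mem_cat) => /orP[] ->; rewrite ?orbT.
- case: (Hhalf _ _ _ Ek Cr He2) => z Hz Hk; exists z => //.
  by move: Hz; rewrite !(inE, mem_cat) => /orP[] ->; rewrite ?orbT.
have Hscale k' (f := k' *: (w + t *: r)) : center f -> exists k, x = k *: f.
  move=> Cf; have k'0 : k' != 0.
    by apply/eqP=> k'0; have := center_nz Cf; rewrite /f k'0 scale0r eqxx.
  by exists (k / k'); rewrite /f scalerA divfK.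
have Ct : center (k *: (w + t *: r)) by rewrite -Ek.
case: (Heta _ _ Ht Ct) => Et.
  case: Hk1 => [Ck1|Hk1]; last by case: (Hk1 k); rewrite -Et.
  rewrite Et in Hscale; case: (Hscale k1 Ck1) => k' Ek'.
  case: (Hhalf _ _ _ Ek' Ck1 He3) => z Hz Hk; exists z => //.
  by move: Hz; rewrite !(inE, mem_cat) => /orP[] ->; rewrite ?orbT.
case: Hk2 => [Ck2|Hk2]; last by case: (Hk2 k); rewrite -Et.
rewrite Et in Hscale; case: (Hscale k2 Ck2) => k' Ek'.
rewrite scaleNr in Ek' Ck2.
case: (Hhalf _ _ _ Ek' Ck2 He4) => z Hz Hk; exists z => //.
by move: Hz; rewrite !(inE, mem_cat) => /orP[] ->; rewrite ?orbT.
Qed.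

(** Order 2 is excluded by hypothesis and order 4 would supply a center commuting with [v]; [v] and
    the eight points of order 3 remain. *)
Lemma cover_isolated v : center v -> (forall w, center w -> Phi v v v w != 0) ->
  exists2 l : seq V, size l = 9 &
  forall c, center c -> exists2 y, y \in l & exists k, c = k *: y.
Proof.
move=> Cv Hw; have [l8 sl8 Hl8] := order3_list Cv.
exists (v :: [seq v + x | x <- l8]); first by rewrite /= size_map sl8.
move=> c Cc; case: (classic (exists k, c = k *: v)) => [[k Hk]|Hp].
  by exists v; [rewrite !inE eqxx ?orbT | exists k].
have {}Hp k : c != k *: v by apply/eqP=> H; apply: Hp; exists k.
case: (pair_cases Cv Cc Hp) => [vc|[x Ec [lx Bx Fx]]|[x Ec [lx Cx]]].
- by move: (Hw c Cc); rewrite vc eqxx.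
- exists (v + x); last by exists (Phi v v v c).
  by rewrite inE (map_f (fun x => v + x)) ?orbT // Hl8.
by move: (Hw x Cx); rewrite lx eqxx.
Qed.

Lemma galois_scale v k : galois v -> galois (k *: v).
Proof.
move=> Gv x y; have [->|k0] := eqVneq k 0; first by rewrite scale0r !tens0.
rewrite !linZ => /eqP; rewrite !mulf_eq0 (negbTE k0) /= => /eqP Hx.
move=> /eqP; rewrite !mulf_eq0 (negbTE k0) /= => /eqP Hy.
by rewrite Gv // !mulr0.
Qed.

(** In a frame with third center [r], the center v + x makes Phi(r,r,v,v) and Phi(r,r,x,x) equal,
    and the first is zero because [v] is galois. *)
Lemma galois_half v x k : center v -> galois v -> center x -> Phi v v v x = 0 ->
  center (k *: (v + x)) -> galois x.
Proof.
move=> Cv Gv Cx vx Ck; case: (frame_third Cv Cx vx) => r Hf.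
have [_ [_ vr _]] := Hf.
have Hf' : frame r v x := frame_swap12 (frame_swap23 Hf).
have R : Phi r r v v = 1 ^+ 2 * Phi r r x x.
  by apply: (swap_rel Hf' (expr1n _ 4)) (_ : center (k *: _)); rewrite scale1r.
have vvrr : Phi v v r r = 0 by apply: Gv.
have rrvv : Phi r r v v = 0 by rewrite !(srt v r).
apply: (galois_frame (frame_swap12 Hf)).
  have -> : Phi x x v v = Phi v v x x by rewrite !(srt v x).
  exact: Gv.
have -> : Phi x x r r = Phi r r x x by rewrite !(srt r x).
by move: R; rewrite rrvv expr1n mul1r.
Qed.

Lemma root4P : exists iota : K, forall eta, eta ^+ 4 = 1 ->
  eta \in [:: 1; -1; iota; - iota].
Proof.
have [i Hi] := closed_root (-1 : K) (isT : (0 < 2)%N); exists i => eta He.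
have : (eta ^+ 2 - 1) * (eta ^+ 2 - i ^+ 2) == 0.
  by rewrite Hi; apply/eqP; apply: (lincomb1 (c1 := 1) He); ring.
rewrite mulf_eq0 !subr_eq0 -[1](expr1n _ 2) !eqf_sqr !inE expr1n.
by case/orP => /orP[] ->; rewrite ?orbT.
Qed.

Lemma swap_not_galois v w r k eta : frame v w r -> Phi w w r r = 0 -> eta ^+ 4 = 1 ->
  center (k *: (w + eta *: r)) -> ~ galois (k *: (w + eta *: r)).
Proof.
move=> Hf C0 He Ck Gk.
have k0 : k != 0.
  by apply/eqP=> k0; have := center_nz Ck; rewrite k0 scale0r eqxx.
have Ef : w + eta *: r = 0 *: v + 1 *: w + eta *: r.
  by rewrite scale0r add0r scale1r.
have lg : Phi (k *: (w + eta *: r)) (k *: (w + eta *: r)) (k *: (w + eta *: r))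
   (0 *: v + 1 *: w + (- eta) *: r) = 0.
  rewrite !linZ Ef frame_tens // /mixed C0.
  by apply: (lincomb1 (c1 := - k ^+ 3) He); ring.
have := Gk _ _ lg lg; rewrite !linZ Ef frame_tens // /mixed C0 => H.
have : 2 * (k ^+ 2 * 1) = 0.
  by rewrite -[RHS]H; apply: (lincomb1 (c1 := - k ^+ 2) He); ring.
by move/eqP; rewrite !mulf_eq0 (negbTE (natf_neq0K 1)) (negbTE k0) oner_eq0.
Qed.

(** Order 3 cannot occur, since Phi(v,v,x,x) = 0 on the polar line of a galois center. If a second
    galois center commutes with [v], the frame shows the Fermat quartic, and the centers to be
    covered are among the 12 points on the sides of the triangle. Otherwise only w, r and the four w
    + e r can occur. *)
Lemma cover_galois v : center v -> galois v ->
  exists2 l : seq V, (size l <= 12)%N &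
  forall c, center c -> ~ galois c -> exists2 y, y \in l & exists k, c = k *: y.
Proof.
move=> Cv Gv.
have cases c : center c -> ~ galois c ->
    Phi v v v c = 0 \/ exists2 x, c = Phi v v v c *: (v + x) &
      [/\ Phi v v v x = 0, center x & galois x].
  move=> Cc Gc.
  have Hp k : c != k *: v by apply/eqP=> H; apply: Gc; rewrite H; apply: galois_scale.
  case: (pair_cases Cv Cc Hp) => [vc|[x Ec [lx Bx Fx]]|[x Ec [lx Cx]]]; first by left.
    by move/eqP: Bx; rewrite Gv // eq_sym oner_eq0.
  right; exists x => //; split=> //.
  by rewrite Ec in Cc; apply: (galois_half Cv Gv Cx lx Cc).
have [i Hi] := root4P.
have [[w [Cw vw]]|Hno] := classic (exists w, center w /\ Phi v v v w = 0); last first.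
  exists [::] => // c Cc Gc; case: (cases c Cc Gc) => [vc|[x _ [lx Cx _]]].
    by case: Hno; exists c.
  by case: Hno; exists x.
have swaps w' r c k eta (S := [seq w' + e *: r | e <- [:: 1; -1; i; - i]]) : eta ^+ 4 = 1 ->
    c = k *: (w' + eta *: r) -> exists2 y, y \in S & exists k, c = k *: y.
  move=> He Ec; exists (w' + eta *: r); last by exists k.
  by rewrite /S (map_f (fun e => w' + e *: r)) // Hi.
have [[w' [Cw' vw' Gw']]|Hng] := classic (exists w, [/\ center w, Phi v v v w = 0 & galois w]).
  case: (frame_third Cv Cw' vw') => r Hf.
  have [[_ _ Cr] [_ vr wr]] := Hf.
  have C0 : Phi w' w' r r = 0 by apply: Gw'.
  exists ([seq w' + e *: r | e <- [:: 1; -1; i; - i]] ++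
      [seq v + e *: w' | e <- [:: 1; -1; i; - i]] ++
      [seq v + e *: r | e <- [:: 1; -1; i; - i]]) => // c Cc Gc.
  have Gr : galois r.
    apply: (galois_frame (frame_swap12 (frame_swap23 Hf))).
      have -> : Phi r r v v = Phi v v r r by rewrite !(srt v r).
      exact: Gv.
    by have -> : Phi r r w' w' = Phi w' w' r r by rewrite !(srt w' r).
  case: (cases c Cc Gc) => [vc|[x Ec [lx Cx Gx]]].
    case: (commuting_centers Hf Cc vc) => [[k Ek]|[k Ek]|[k [t [Ht Ek]]]].
    - by case: Gc; rewrite Ek; apply: galois_scale.
    - by case: Gc; rewrite Ek; apply: galois_scale.
    by case: (swaps _ _ _ _ _ Ht Ek) => y Hy Hk; exists y; rewrite // !mem_cat Hy.
  case: (commuting_centers Hf Cx lx) => [[k Ek]|[k Ek]|[k [t [Ht Ek]]]].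
  - rewrite Ek in Ec Cx; have k4 := center_scale_root Cw' Cx.
    by case: (swaps _ _ _ _ _ k4 Ec) => y Hy Hk; exists y; rewrite // !mem_cat Hy orbT.
  - rewrite Ek in Ec Cx; have k4 := center_scale_root Cr Cx.
    by case: (swaps _ _ _ _ _ k4 Ec) => y Hy Hk; exists y; rewrite // !mem_cat Hy !orbT.
  rewrite Ek in Cx Gx; case: (swap_not_galois Hf C0 Ht Cx Gx).
case: (frame_third Cv Cw vw) => r Hf.
exists ([:: w; r] ++ [seq w + e *: r | e <- [:: 1; -1; i; - i]]) => // c Cc Gc.
case: (cases c Cc Gc) => [vc|[x Ec [lx Cx Gx]]]; last by case: Hng; exists x.
case: (commuting_centers Hf Cc vc) => [[k Ek]|[k Ek]|[k [t [Ht Ek]]]].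
- by exists w; [rewrite mem_cat inE eqxx | exists k].
- by exists r; [rewrite mem_cat !inE eqxx orbT | exists k].
by case: (swaps _ _ _ _ _ Ht Ek) => y Hy Hk; exists y; rewrite // !mem_cat Hy orbT.
Qed.

(** A second frame, with w + r and w - r in place of [w] and [r]; conditions known for all frames
    give new equations when applied to it. *)
Lemma frame_swap_pair v w r k : frame v w r -> Phi v v w w = Phi v v r r ->
  k ^+ 4 * (2 + 6 * Phi w w r r) = 1 ->
  [/\ frame (k *: (w + r)) v (k *: (w - r)),
      Phi (k *: (w + r)) (k *: (w + r)) v v = 2 * k ^+ 2 * Phi v v w w &
      Phi (k *: (w + r)) (k *: (w + r)) (k *: (w - r)) (k *: (w - r))
        = k ^+ 4 * (2 - 2 * Phi w w r r)].
Proof.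
move=> Hf AB Hk; have [[Cv Cw Cr] [vw vr wr]] := Hf.
have Cf : center (k *: (w + r)).
  rewrite -[X in w + X]scale1r; apply: (swap_center Hf); first exact: expr1n.
    by rewrite expr1n mul1r.
  by rewrite expr1n mulr1.
have Cg : center (k *: (w - r)).
  rewrite -scaleN1r; apply: (swap_center Hf); first by ring.
    by rewrite AB; ring.
  by rewrite -[RHS]Hk; ring.
have Ef : w + r = 0 *: v + 1 *: w + 1 *: r by rewrite scale0r !scale1r add0r.
have Eg : w - r = 0 *: v + 1 *: w + (-1) *: r by rewrite scale0r scale1r scaleN1r add0r.
have fv (x y z : V) : x = 1 *: v + 0 *: w + 0 *: r ->
    Phi (w + r) (w + r) (w + r) x = 0 /\ Phi (w + r) (w + r) x x = 2 * Phi v v w w.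
  by move=> ->; rewrite Ef !frame_tens // /mixed -AB; split; ring.
have [fv1 fv2] : Phi (w + r) (w + r) (w + r) v = 0 /\ Phi (w + r) (w + r) v v = 2 * Phi v v w w.
  by apply: fv => //; rewrite scale1r !scale0r !addr0.
split.
- split; split=> //.
  + by rewrite !linZ fv1 !mulr0.
  + rewrite !linZ Ef Eg frame_tens // /mixed; ring.
  + by rewrite !lin vw vr; ring.
- by rewrite !linZ fv2; ring.
by rewrite !linZ Ef Eg frame_tens // /mixed; ring.
Qed.

Lemma swap_nongalois v w r k eta : frame v w r -> eta ^+ 4 = 1 ->
  Phi v v w w != 0 -> center (k *: (w + eta *: r)) ->
  ~ galois (k *: (w + eta *: r)).
Proof.
move=> Hf He A0 Ck Gk.
have k0 : k != 0.
  by apply/eqP=> k0; have := center_nz Ck; rewrite k0 scale0r eqxx.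
have R := swap_rel Hf He Ck; have [[Cv Cw Cr] [vw vr wr]] := Hf.
have Ev : v = 1 *: v + 0 *: w + 0 *: r by rewrite scale1r !scale0r !addr0.
have Ef : w + eta *: r = 0 *: v + 1 *: w + eta *: r.
  by rewrite scale0r add0r scale1r.
have E1 : Phi (w + eta *: r) (w + eta *: r) (w + eta *: r) (1 *: v + 0 *: w + 0 *: r) = 0.
  by rewrite Ef frame_tens // /mixed; ring.
have E2 : Phi (w + eta *: r) (w + eta *: r) (1 *: v + 0 *: w + 0 *: r) (1 *: v + 0 *: w + 0 *: r)
    = 2 * Phi v v w w.
  by rewrite Ef frame_tens // /mixed; apply: (lincomb1 (c1 := -1) R); ring.
rewrite -Ev in E1 E2.
have := Gk v v; rewrite !linZ E1 E2 !mulr0 => /(_ erefl erefl) /eqP.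
by rewrite !mulf_eq0 (negbTE k0) (negbTE A0) (negbTE (natf_neq0K 1)).
Qed.

(** * The equality case: the Klein quartic and its 21 centers *)

Definition klein_frame v w r b : Prop :=
  [/\ frame v w r, Phi v v w w = b, Phi v v r r = b, Phi w w r r = b &
      (6 * b) ^+ 2 + 3 * (6 * b) + 18 = 0].

Lemma klein_frameP v w r b (x1 x2 x3 : K) : klein_frame v w r b ->
  let p := x1 *: v + x2 *: w + x3 *: r in
  Phi p p p p = x1 ^+ 4 + x2 ^+ 4 + x3 ^+ 4 +
    6 * b * (x1 ^+ 2 * x2 ^+ 2 + x2 ^+ 2 * x3 ^+ 2 + x3 ^+ 2 * x1 ^+ 2).
Proof. by case=> Hf A B C _ p; rewrite /p frame_tens // A B C /mixed; ring. Qed.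

(** Since eta^2 is 1 or -1, the hypothesis makes A, B, C equal up to sign. Multiplying one vector of
    the frame by a square root of -1 changes the sign of two of them, which suffices to make all
    three equal. *)
Lemma equal_frame v w r :
  (forall v w r, frame v w r -> exists eta k, eta ^+ 4 = 1 /\ center (k *: (w + eta *: r))) ->
  frame v w r -> exists v w r b,
    [/\ frame v w r, Phi v v w w = b, Phi v v r r = b & Phi w w r r = b].
Proof.
move=> HE Hf.
have sq eta : eta ^+ 4 = 1 -> eta ^+ 2 = 1 \/ eta ^+ 2 = -1.
  move=> He; have : (eta ^+ 2) ^+ 2 == 1 ^+ 2 by rewrite -exprM He expr1n.
  by rewrite eqf_sqr => /orP[] /eqP; auto.
have [i Hi] := closed_root (-1 : K) (isT : (0 < 2)%N).
have i4 : i ^+ 4 = 1 by rewrite -[4%N]/(2 * 2)%N exprM Hi; ring.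
have pm v' w' r' : frame v' w' r' -> Phi v' v' w' w' = Phi v' v' r' r' \/
    Phi v' v' w' w' = - Phi v' v' r' r'.
  move=> Hf'; case: (HE _ _ _ Hf') => eta [k [He Ck]].
  by rewrite (swap_rel Hf' He Ck); case: (sq _ He) => ->; [left | right]; ring.
have Swv : Phi w w v v = Phi v v w w by rewrite !(srt v w).
case: (pm _ _ _ Hf) => EB; case: (pm _ _ _ (frame_swap12 Hf)) => EC; rewrite Swv in EC.
- by exists v, w, r, (Phi v v w w).
- exists w, r, (i *: v), (Phi w w r r); split=> //.
  + exact: (frame_scale3 (frame_swap23 (frame_swap12 Hf)) i4).
  + by rewrite !linZ Swv mulrA -expr2 Hi EC; ring.
  have -> : Phi r r (i *: v) (i *: v) = i ^+ 2 * Phi v v r r.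
    by rewrite !linZ !(srt v r); ring.
  by rewrite Hi -EB EC; ring.
- exists v, r, (i *: w), (Phi v v r r); split=> //.
  + exact: (frame_scale3 (frame_swap23 Hf) i4).
  + by rewrite !linZ mulrA -expr2 Hi EB; ring.
  have -> : Phi r r (i *: w) (i *: w) = i ^+ 2 * Phi w w r r.
    by rewrite !linZ !(srt w r); ring.
  by rewrite Hi -EC EB; ring.
exists v, w, (i *: r), (Phi v v w w); split=> //.
- exact: (frame_scale3 Hf i4).
- by rewrite !linZ mulrA -expr2 Hi EB; ring.
by rewrite !linZ mulrA -expr2 Hi EC; ring.
Qed.

(** For A = B = C = b the frame on k (w + r), v, k (w - r) has coefficients 2 k^2 b and k^4 (2 - 2
    b), with k^4 = 1 / (2 + 6 b). They agree up to sign, and squaring gives the cubic equation in 6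
    b. *)
Lemma klein_frame_exists v w r :
  (forall c, center c -> ~ galois c) ->
  (forall v w r, frame v w r -> exists eta k, eta ^+ 4 = 1 /\ center (k *: (w + eta *: r))) ->
  frame v w r -> exists v w r b, klein_frame v w r b.
Proof.
move=> Hng HE /(equal_frame HE) [{}v [{}w [r0 {r} [b [Hf0 A B0 C0]]]]].
have b0 : b != 0.
  apply/eqP=> b0; apply: (Hng v); first by case: Hf0 => -[].
  by apply: (galois_frame Hf0); rewrite ?A ?B0 b0.
have [eta [k [He Ck]]] := HE _ _ _ Hf0.
(* As b is nonzero, eta is 1 or -1 and can be absorbed into [r] without changing the
   coefficients. *)
have e2 : eta ^+ 2 = 1.
  by have := swap_rel Hf0 He Ck; rewrite A B0 -{1}[b]mul1r => /(mulIf b0).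
have [r Er] : exists r, r = eta *: r0 by eexists.
have Hf : frame v w r by rewrite Er; apply: frame_scale3.
have B : Phi v v r r = b by rewrite Er !linZ mulrA -expr2 e2 mul1r.
have C : Phi w w r r = b by rewrite Er !linZ mulrA -expr2 e2 mul1r.
exists v, w, r, b; split=> //.
have Hk : k ^+ 4 * (2 + 6 * Phi w w r r) = 1.
  rewrite -Er in Ck; case: Ck => Fk _; rewrite -[RHS]Fk.
  have Ef : w + r = 0 *: v + 1 *: w + 1 *: r by rewrite scale0r !scale1r add0r.
  by rewrite !linZ Ef frame_tens // /mixed; ring.
have AB : Phi v v w w = Phi v v r r by rewrite A B.
have [Hff E1 E2] := frame_swap_pair Hf AB Hk.
have [theta [k' [Ht Ck']]] := HE _ _ _ Hff.
have := swap_rel Hff Ht Ck'; rewrite E1 E2 A => H.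
rewrite C in H Hk.
have k40 : k ^+ 4 != 0.
  by apply/eqP=> k40; move/eqP: Hk; rewrite k40 mul0r eq_sym oner_eq0.
have H2 : 4 * b ^+ 2 - k ^+ 4 * (2 - 2 * b) ^+ 2 = 0.
  apply: (mulfI k40); rewrite mulr0.
  have : (2 * k ^+ 2 * b) ^+ 2 = (theta ^+ 2 * (k ^+ 4 * (2 - 2 * b))) ^+ 2 by rewrite H.
  move=> H3; apply: (lincomb2 (c1 := 1) (c2 := (k ^+ 4 * (2 - 2 * b)) ^+ 2) H3 Ht); ring.
have H4 : (6 * b - 2) * ((6 * b) ^+ 2 + 3 * (6 * b) + 18) = 0.
  apply: (lincomb2 (c1 := 9 * (2 + 6 * b)) (c2 := 9 * (2 - 2 * b) ^+ 2) H2 Hk); ring.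
move/eqP: H4; rewrite mulf_eq0 => /orP[] /eqP // b3.
move/eqP: (frame_coef_neq Hf); rewrite C; case.
by apply: (mulfI (natP_neq0 (isT : (0 < 4)%N))); apply: (lincomb1 (c1 := 6 * b + 2) b3); ring.
Qed.

(** A condition on the projective point of [y], which need not be normalized to F(y) = 1. *)
Definition quasi_center y := exists k, center (k *: y) /\ ~ galois (k *: y).

Lemma quasi_center_scale k y : quasi_center (k *: y) -> quasi_center y.
Proof. by case=> k' [Ck Gk]; exists (k' * k); rewrite -scalerA. Qed.

Lemma klein_frame_swap12 v w r b : klein_frame v w r b -> klein_frame w v r b.
Proof.
case=> Hf A B C E; split=> //; first exact: frame_swap12.
by rewrite -A !(srt v w).
Qed.

Lemma klein_frame_swap23 v w r b : klein_frame v w r b -> klein_frame v r w b.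
Proof.
case=> Hf A B C E; split=> //; first exact: frame_swap23.
by rewrite -C !(srt w r).
Qed.

Lemma klein_frame_opp v w r b : klein_frame v w r b -> klein_frame v w (- r) b.
Proof.
case=> Hf A B C E; split=> //; last 2 first.
- by rewrite !lin opprK.
- by rewrite !lin opprK.
by rewrite -scaleN1r; apply: frame_scale3 => //; ring.
Qed.

(** With a = 6 b, the values a = 0, 6, -2, 3 are excluded because a^2 + 3 a + 18 is 18, 72, 16, 36
    there. For the remaining quadratic factor a Bezout combination equals 36. *)
Lemma klein_coef (b : K) : (6 * b) ^+ 2 + 3 * (6 * b) + 18 = 0 ->
  [/\ b != 0, 1 - b != 0, 2 + 6 * b != 0, 1 - b + 6 * b ^+ 2 != 0 & 2 * b - 1 != 0].
Proof.
move=> E; have nz (n : nat) (P : Prop) : (0 < n)%N -> (n%:R : K) = 0 -> P.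
  by move=> n0 H; have := natP_neq0 n0; rewrite H eqxx.
split; apply/eqP=> H.
- by apply: (nz 18%N) => //; rewrite -E H; ring.
- apply: (nz 72%N) => //.
  by apply: (lincomb2 (c1 := 1) (c2 := 36 * b + 54) E H); ring.
- apply: (nz 16%N) => //.
  by apply: (lincomb2 (c1 := 1) (c2 := - 6 * b - 1) E H); ring.
- apply: (nz 36%N) => //.
  by apply: (lincomb2 (c1 := 2 - 3 * b) (c2 := 18 * b) E H); ring.
apply: (nz 36%N) => //.
by apply: (lincomb2 (c1 := 1) (c2 := - 18 * b - 18) E H); ring.
Qed.

(** Use [swap_center] in the frame f = k (w + r), v, g = k (w - r), with eta = mu / k. The condition
    Phi(f,f,v,v) = eta^2 Phi(f,f,g,g) reads mu^2 (1 - b) = b, and the equation of b then gives eta^4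
    = 1. *)
Lemma klein_diagonal v w r b mu : klein_frame v w r b -> mu ^+ 2 * (1 - b) = b ->
  quasi_center (v + mu *: (w - r)).
Proof.
case=> Hf A B C E Hmu; case: (klein_coef E) => b0 b1 b2 b3 _.
have [k Hk] := closed_root (2 + 6 * b)^-1 (isT : (0 < 4)%N).
have Hk1 : k ^+ 4 * (2 + 6 * b) = 1 by rewrite Hk mulVf.
have k0 : k != 0.
  by apply/eqP=> k0; move/eqP: Hk1; rewrite k0 expr0n /= mul0r eq_sym oner_eq0.
have AB : Phi v v w w = Phi v v r r by rewrite A B.
have Hk2 : k ^+ 4 * (2 + 6 * Phi w w r r) = 1 by rewrite C.
have [Hff E1 E2] := frame_swap_pair Hf AB Hk2.
have AB' : Phi v v (- r) (- r) = Phi v v w w by rewrite !lin opprK A B.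
have Hk3 : k ^+ 4 * (2 + 6 * Phi w w (-r) (-r)) = 1 by rewrite !lin opprK C.
have Hfm : frame v w (- r) by rewrite -scaleN1r; apply: frame_scale3 => //; ring.
have [_ E3 _] := frame_swap_pair Hfm (esym AB') Hk3.
pose eta := mu / k.
have keta : k * eta = mu by rewrite mulrC divfK.
have eta2 : k ^+ 2 * eta ^+ 2 = mu ^+ 2 by rewrite -[in RHS]keta; ring.
have mu4 : mu ^+ 4 * (2 + 6 * b) = 1.
  apply: (mulfI (expf_neq0 2 b1)); rewrite mulr1.
  have H4 : 4 * (mu ^+ 4 * (1 - b) ^+ 2 * (2 + 6 * b)) = 4 * (1 - b) ^+ 2.
    have -> : mu ^+ 4 * (1 - b) ^+ 2 = b ^+ 2 by rewrite -[in RHS]Hmu; ring.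
    apply: (mulfI (natP_neq0 (isT : (0 < 9)%N))).
    by apply: (lincomb1 (c1 := 6 * b - 2) E); ring.
  apply: (mulfI (natP_neq0 (isT : (0 < 4)%N))); rewrite -[RHS]H4; ring.
have eta4 : eta ^+ 4 = 1.
  have -> : eta ^+ 4 = mu ^+ 4 * (2 + 6 * b); last by [].
  rewrite -keta; transitivity ((k ^+ 4 * (2 + 6 * b)) * eta ^+ 4); last by ring.
  by rewrite Hk1 mul1r.
have R : Phi (k *: (w + r)) (k *: (w + r)) v v = eta ^+ 2 *
    Phi (k *: (w + r)) (k *: (w + r)) (k *: (w - r)) (k *: (w - r)).
  rewrite E1 E2 A C; transitivity (2 * k ^+ 2 * (mu ^+ 2 * (1 - b))); first by rewrite Hmu.
  by rewrite -eta2; ring.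
have vg : Phi v v (k *: (w - r)) (k *: (w - r)) = 2 * k ^+ 2 * b.
  by rewrite -A -E3; move: (k *: (w - r)) => g; rewrite !(srt v g).
have c0 : 2 + 6 * eta ^+ 2 * Phi v v (k *: (w - r)) (k *: (w - r)) != 0.
  have -> : 2 + 6 * eta ^+ 2 * Phi v v (k *: (w - r)) (k *: (w - r)) = 2 + 12 * mu ^+ 2 * b.
    by rewrite vg -eta2; ring.
  apply: contraNneq b3 => H; apply/eqP; apply: (mulfI (natP_neq0 (isT : (0 < 2)%N))).
  by apply: (lincomb2 (c1 := 1 - b) (c2 := - 12 * b) H Hmu); ring.
have [k' Hk'] := closed_root
  (2 + 6 * eta ^+ 2 * Phi v v (k *: (w - r)) (k *: (w - r)))^-1 (isT : (0 < 4)%N).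
have Ceta : center (k' *: (v + eta *: (k *: (w - r)))).
  by apply: (swap_center Hff eta4 R); rewrite Hk' mulVf.
have E0 : eta *: (k *: (w - r)) = mu *: (w - r) by rewrite scalerA mulrC keta.
exists k'; rewrite -E0; split=> //.
apply: (swap_nongalois Hff eta4 _ Ceta); rewrite E1 A.
by rewrite !mulf_neq0 ?expf_neq0 ?natP_neq0.
Qed.

Lemma klein_diagonals v w r b mu : klein_frame v w r b -> mu ^+ 2 * (1 - b) = b ->
  [/\ quasi_center (v + mu *: (w + r)), quasi_center (v + mu *: (w - r)),
      quasi_center (v - mu *: (w + r)) & quasi_center (v - mu *: (w - r))].
Proof.
move=> Hk Hmu; have Hk' := klein_frame_opp Hk.
have HmuN : (- mu) ^+ 2 * (1 - b) = b by rewrite sqrrN.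
rewrite -!scaleNr; split; try exact: (klein_diagonal Hk).
  by rewrite -[r in w + r]opprK; apply: (klein_diagonal Hk').
by rewrite -[r in w + r]opprK; apply: (klein_diagonal Hk').
Qed.

Lemma klein_axis v w r b : klein_frame v w r b -> quasi_center v.
Proof.
case=> Hf A B C E; case: (klein_coef E) => b0 _ _ _ _.
have [[Cv Cw Cr] [vw vr wr]] := Hf.
exists 1; rewrite scale1r; split=> // /(_ w w vw vw) /eqP.
by rewrite A (negbTE b0).
Qed.

Lemma klein_edge v w r b : klein_frame v w r b -> quasi_center (w + r).
Proof.
case=> Hf A B C E; case: (klein_coef E) => b0 _ b2 _ _.
have [k Hk] := closed_root (2 + 6 * b)^-1 (isT : (0 < 4)%N).
have o4 : (1 : K) ^+ 4 = 1 by rewrite expr1n.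
have Cf : center (k *: (w + 1 *: r)).
  apply: (swap_center Hf o4); first by rewrite A B expr1n mul1r.
  by rewrite C Hk expr1n mulr1 mulVf.
exists k; rewrite -[r in w + r]scale1r; split=> //.
by apply: (swap_nongalois Hf o4) => //; rewrite A.
Qed.

(** Normalized homogeneous coordinates: the first nonzero one is 1, so proportional triples are
    equal. *)
Definition lead1 (t : K * K * K) : bool :=
  (t.1.1 == 1) || (t.1.1 == 0) && ((t.1.2 == 1) || (t.1.2 == 0) && (t.2 == 1)).

Lemma lead1_prop (s t : K * K * K) k : lead1 s -> lead1 t ->
  s.1.1 = k * t.1.1 -> s.1.2 = k * t.1.2 -> s.2 = k * t.2 -> s = t.
Proof.
case: s t => [[s1 s2] s3] [[t1 t2] t3]; rewrite /lead1 /=.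
case/orP=> [/eqP->|/andP[/eqP-> /orP[/eqP->|/andP[/eqP-> /eqP->]]]];
 case/orP=> [/eqP->|/andP[/eqP-> /orP[/eqP->|/andP[/eqP-> /eqP->]]]];
 rewrite ?mulr0 ?mulr1.
all: move=> H1 H2 H3; try by rewrite ?H2 ?H3 -?H1 -?H2 ?mul1r.
all: by move: (oner_neq0 K); rewrite ?H1 ?H2 ?H3 -?H1 -?H2 ?mul0r ?mulr0 eqxx.
Qed.

(** Coordinates in the frame: 3 vertices, 6 points on the sides, and the 12 images of (1, mu, mu)
    under permutations and sign changes, rescaled to begin with 1. *)
Definition klein_coords (mu : K) (nu := mu^-1) : seq (K * K * K) :=
  [:: (1, 0, 0); (0, 1, 0); (0, 0, 1);
      (0, 1, 1); (0, 1, -1); (1, 0, 1); (1, 0, -1); (1, 1, 0); (1, -1, 0);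
      (1, mu, mu); (1, mu, - mu); (1, - mu, mu); (1, - mu, - mu);
      (1, nu, 1); (1, nu, -1); (1, - nu, 1); (1, - nu, -1);
      (1, 1, nu); (1, 1, - nu); (1, -1, nu); (1, -1, - nu)].

Lemma klein_coords_uniq mu : mu != 0 -> mu ^+ 2 != 1 -> uniq (klein_coords mu).
Proof.
move=> m0 m1.
have n2 : (1 + 1 : K) != 0 by apply: (natf_neq0K 1).
have opp_neq (x : K) : x != 0 -> (x == - x) = false.
  move=> x0; rewrite -subr_eq0 opprK -[x]mulr1 -mulrDr mulf_eq0.
  by rewrite (negbTE x0) (negbTE n2).
have mp : mu != 1 by apply: contraNneq m1 => ->; rewrite expr1n.
have mn : mu != -1 by apply: contraNneq m1 => ->; rewrite sqrrN expr1n.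
have np : mu^-1 != 1 by rewrite invr_eq1.
have nn : mu^-1 != -1 by rewrite -[-1]invrN1 (inj_eq invr_inj).
have n0 : mu^-1 != 0 by rewrite invr_eq0.
have ne (x : K) : x != 0 -> x != 1 -> x != -1 ->
    ((x == 1) = false) * ((x == -1) = false) * ((1 == x) = false) * ((-1 == x) = false)
    * ((- x == 1) = false) * ((1 == - x) = false)
    * ((x == - x) = false) * ((- x == x) = false).
  move=> x0 /negbTE x1 /negbTE xn.
  by rewrite !(eq_sym _ x) !(eq_sym 1 (- x)) eqr_oppLR x1 xn (opp_neq _ x0).
have ne1 : ((1 == -1 :> K) = false) * ((-1 == 1 :> K) = false)
   * ((1 == 0 :> K) = false) * ((0 == 1 :> K) = false).
  by rewrite (eq_sym (-1) 1) (eq_sym 0 1) opp_neq ?oner_neq0 // (negbTE (oner_neq0 K)).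
have z0 (x : K) : x != 0 -> ((0 == x) = false) * ((0 == - x) = false).
  by move=> /negbTE x0; rewrite !(eq_sym 0) oppr_eq0 x0.
rewrite /= !inE !xpair_eqE ?eqr_opp ?oppr_eq0 !eqxx.
by rewrite !(ne _ m0 mp mn, ne _ n0 np nn, ne1, z0 _ m0, z0 _ n0, z0 _ (oner_neq0 K), andbF).
Qed.

Lemma klein_centers v w r b : klein_frame v w r b ->
  exists2 l : seq V, size l = 21%N /\ uniq l &
  (forall y, y \in l -> quasi_center y) /\
  (forall y z k, y \in l -> z \in l -> y = k *: z -> y = z).
Proof.
move=> Hk; have [Hf _ _ _ E] := Hk; case: (klein_coef E) => b0 b1 _ _ b12.
have [mu Hmu'] := closed_root (b / (1 - b)) (isT : (0 < 2)%N).
have Hmu : mu ^+ 2 * (1 - b) = b by rewrite Hmu' divfK.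
have m0 : mu != 0.
  by apply: contraNneq b0 => m0; rewrite -Hmu m0 expr0n /= mul0r.
have m1 : mu ^+ 2 != 1.
  apply: contraNneq b12 => m1; rewrite m1 mul1r in Hmu.
  by apply/eqP; apply: (lincomb1 (c1 := -1) Hmu); ring.
have Hs := frame_spanning Hf.
pose pt (t : K * K * K) := t.1.1 *: v + t.1.2 *: w + t.2 *: r.
have pt_inj (p q : K * K * K) k : pt p = k *: pt q ->
    [/\ p.1.1 = k * q.1.1, p.1.2 = k * q.1.2 & p.2 = k * q.2].
  move=> H.
  have H0 : (p.1.1 - k * q.1.1) *: v + (p.1.2 - k * q.1.2) *: w + (p.2 - k * q.2) *: r = 0.
    apply/eqP; rewrite -(subrr (pt p)) {2}H /pt.
    by apply/eqP/rowP=> j; rewrite !mxE; ring.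
  by case: (spanning_free Hs H0) => /eqP + /eqP + /eqP; rewrite !subr_eq0 => /eqP ? /eqP ? /eqP ?.
have pt_inj1 : injective pt.
  move=> p q H; have := pt_inj p q 1; rewrite scale1r => /(_ H) [].
  by case: p q {H} => [[p1 p2] p3] [[q1 q2] q3] /=; rewrite !mul1r => -> -> ->.
have lead q : q \in klein_coords mu -> lead1 q.
  by move: q; apply/allP; rewrite /klein_coords /lead1 /= !eqxx ?orbT.
exists [seq pt q | q <- klein_coords mu].
  by rewrite size_map map_inj_uniq // klein_coords_uniq.
split; last first.
  move=> y z k /mapP[p Hp ->] /mapP[q Hq ->] /pt_inj [h1 h2 h3]; congr pt.
  by apply: (lead1_prop (lead _ Hp) (lead _ Hq) h1 h2 h3).
(* Permuting the frame and changing the sign of its last vector reduce the 21 points to an axis, an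
   edge and the diagonals. *)
have Hk12 := klein_frame_swap12 Hk; have Hk23 := klein_frame_swap23 Hk.
have Hk3 := klein_frame_swap12 Hk23.
have HkN := klein_frame_opp Hk; have Hk12N := klein_frame_opp Hk12.
have Hk3N := klein_frame_opp (klein_frame_swap23 Hk3).
have Q k y (q : K * K * K) : quasi_center y -> y = k *: pt q -> quasi_center (pt q).
  by move=> + E1; rewrite E1; apply: quasi_center_scale.
have [d1 d2 d3 d4] := klein_diagonals Hk Hmu.
have [d5 d6 d7 d8] := klein_diagonals Hk12 Hmu.
have [d9 d10 d11 d12] := klein_diagonals Hk3 Hmu.
have vec (x y : V) : (forall j, x 0 j = y 0 j) -> x = y by move=> H; apply/rowP.
move=> y /mapP[q + ->]; rewrite !inE; do !case/orP; move/eqP->.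
- by apply: (Q 1 _ _ (klein_axis Hk)); apply: vec => j; rewrite !mxE /=; ring.
- by apply: (Q 1 _ _ (klein_axis Hk12)); apply: vec => j; rewrite !mxE /=; ring.
- by apply: (Q 1 _ _ (klein_axis Hk3)); apply: vec => j; rewrite !mxE /=; ring.
- by apply: (Q 1 _ _ (klein_edge Hk)); apply: vec => j; rewrite !mxE /=; ring.
- by apply: (Q 1 _ _ (klein_edge HkN)); apply: vec => j; rewrite !mxE /=; ring.
- by apply: (Q 1 _ _ (klein_edge Hk12)); apply: vec => j; rewrite !mxE /=; ring.
- by apply: (Q 1 _ _ (klein_edge Hk12N)); apply: vec => j; rewrite !mxE /=; ring.
- by apply: (Q 1 _ _ (klein_edge Hk3)); apply: vec => j; rewrite !mxE /=; ring.
- by apply: (Q (-1) _ _ (klein_edge Hk3N)); apply: vec => j; rewrite !mxE /=; ring.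
- by apply: (Q 1 _ _ d1); apply: vec => j; rewrite !mxE /=; ring.
- by apply: (Q 1 _ _ d2); apply: vec => j; rewrite !mxE /=; ring.
- by apply: (Q 1 _ _ d4); apply: vec => j; rewrite !mxE /=; ring.
- by apply: (Q 1 _ _ d3); apply: vec => j; rewrite !mxE /=; ring.
- by apply: (Q mu _ _ d5); apply: vec => j; rewrite !mxE /=; field.
- by apply: (Q mu _ _ d6); apply: vec => j; rewrite !mxE /=; field.
- by apply: (Q (- mu) _ _ d7); apply: vec => j; rewrite !mxE /=; field.
- by apply: (Q (- mu) _ _ d8); apply: vec => j; rewrite !mxE /=; field.
- by apply: (Q mu _ _ d9); apply: vec => j; rewrite !mxE /=; field.
- by apply: (Q (- mu) _ _ d11); apply: vec => j; rewrite !mxE /=; field.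
- by apply: (Q mu _ _ d10); apply: vec => j; rewrite !mxE /=; field.
- by apply: (Q (- mu) _ _ d12); apply: vec => j; rewrite !mxE /=; field.
Qed.

End PlaneQuartic.

(** * Polarization of a quartic form *)

Section Euler.

Variables (n : nat) (R : comNzRingType).
Implicit Types (G : {mpoly R[n]}).

Lemma dhomog_mderiv d G i : G \is d.+1.-homog -> G^`M(i) \is d.-homog.
Proof.
move=> HG; apply/dhomogP=> m; rewrite mcoeff_msupp mcoeff_mderiv => H.
have H' : (m + U_(i))%MM \in msupp G.
  by rewrite mcoeff_msupp; apply: contraNneq H => ->; rewrite mul0rn.
by have := dhomog_mf HG H'; rewrite /= mdegD mdeg1 addn1 => -[].
Qed.

Lemma euler_homog d G : G \is d.-homog ->
  d%:R *: G = \sum_(i < n) 'X_i * G^`M(i).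
Proof.
move=> HG; rewrite {1 2}(mpolyE G).
rewrite scaler_sumr; under [RHS]eq_bigr => i _.
  rewrite raddf_sum mulr_sumr; over.
rewrite exchange_big /=; apply: eq_big_seq => m Hm.
have <- := dhomog_mf HG Hm.
under [RHS]eq_bigr => i _.
  rewrite mderivZ mderivX scalerA -scalerAr -mpolyXD.
  have -> : (G@_m * (m i)%:R) *: 'X_[R, (U_(i) + (m - U_(i)))] = (G@_m * (m i)%:R) *: 'X_[R, m].
    case: (posnP (m i)) => [->|mi0]; first by rewrite mulr0 !scale0r.
    by rewrite addmC submK // lep1mP -lt0n.
  over.
rewrite -scaler_suml -mulr_sumr -natr_sum scalerA mulrC; congr (_ * _%:R *: _).
by rewrite /= mdegE.
Qed.

Lemma dhomog0_const G : G \is 0.-homog -> G = (G@_0)%:MP.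
Proof.
move=> HG; apply/mpolyP=> m; rewrite mcoeffC.
have [<-|m0] := eqVneq 0%MM m; first by rewrite mulr1.
rewrite mulr0; apply: (dhomog_nemf_coeff HG).
by rewrite /= mdeg_eq0 eq_sym.
Qed.

End Euler.

Section Tensor.

Variables (K : fieldType) (F : {mpoly K[3]}).
Hypothesis charK0 : [pchar K] =i pred0.
Hypothesis homF : F \is 4.-homog.

(* The polarization of F, with 24 = 4! and the fourth derivatives of F. *)
Definition tensor_coef i j k l : K := 24%:R^-1 * (F^`M(i)^`M(j)^`M(k)^`M(l))@_0.

(** The ring [S] is arbitrary because the form is also evaluated on lines, over [{poly K}], and at
    the generic point, over the function field. *)
Definition tensor (S : comNzRingType) (iota : {rmorphism K -> S})
    (a b c d : 'rV[S]_3) : S :=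
  \sum_i \sum_j \sum_k \sum_l
    iota (tensor_coef i j k l) * (a 0 i * b 0 j * c 0 k * d 0 l).

Lemma tensor_coef12 i j k l : tensor_coef i j k l = tensor_coef j i k l.
Proof. by rewrite /tensor_coef (mderiv_comm i j). Qed.
Lemma tensor_coef23 i j k l : tensor_coef i j k l = tensor_coef i k j l.
Proof. by rewrite /tensor_coef (mderiv_comm j k). Qed.
Lemma tensor_coef34 i j k l : tensor_coef i j k l = tensor_coef i j l k.
Proof. by rewrite /tensor_coef (mderiv_comm k l). Qed.

Lemma tensor_quartic S iota : quartic_tensor (@tensor S iota).
Proof.
split.
- move=> u u' a b c; rewrite /tensor -big_split; apply: eq_bigr => i _ /=.
  rewrite -big_split; apply: eq_bigr => j _ /=; rewrite -big_split; apply: eq_bigr => k _ /=.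
  by rewrite -big_split; apply: eq_bigr => l _ /=; rewrite !mxE; ring.
- move=> s u a b c; rewrite /tensor mulr_sumr; apply: eq_bigr => i _ /=.
  rewrite mulr_sumr; apply: eq_bigr => j _ /=; rewrite mulr_sumr; apply: eq_bigr => k _ /=.
  by rewrite mulr_sumr; apply: eq_bigr => l _ /=; rewrite !mxE; ring.
- move=> a b c d; rewrite /tensor exchange_big; apply: eq_bigr => i _ /=.
  apply: eq_bigr => j _; apply: eq_bigr => k _; apply: eq_bigr => l _ /=.
  by rewrite tensor_coef12; ring.
- move=> a b c d; rewrite /tensor; apply: eq_bigr => i _ /=.
  rewrite exchange_big; apply: eq_bigr => j _; apply: eq_bigr => k _; apply: eq_bigr => l _ /=.
  by rewrite tensor_coef23; ring.
move=> a b c d; rewrite /tensor; apply: eq_bigr => i _ /=; apply: eq_bigr => j _ /=.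
rewrite exchange_big; apply: eq_bigr => k _; apply: eq_bigr => l _ /=.
by rewrite tensor_coef34; ring.
Qed.

Lemma natf24 : (24%:R : K) != 0.
Proof. by rewrite (proj1 (pcharf0P K) charK0). Qed.

Lemma cubic_expand (G : {mpoly K[3]}) : G \is 3.-homog ->
  6%:R *: G = \sum_i \sum_j \sum_k (G^`M(i)^`M(j)^`M(k))@_0 *: ('X_i * 'X_j * 'X_k).
Proof.
move=> HG; have -> : 6%:R = (2%:R * 3%:R : K) by rewrite -natrM.
rewrite -scalerA (euler_homog HG) scaler_sumr; apply: eq_bigr => i _.
have Hi := dhomog_mderiv i HG.
rewrite scalerAr (euler_homog Hi) mulr_sumr; apply: eq_bigr => j _.
have Hij := dhomog_mderiv j Hi.
have E2 := euler_homog Hij; rewrite scale1r in E2.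
rewrite [in LHS]E2 mulrA mulr_sumr; apply: eq_bigr => k _.
have E := dhomog0_const (dhomog_mderiv k Hij).
by rewrite [in LHS]E -mul_mpolyC; ring.
Qed.

Lemma mmap_cubic (S : comNzRingType) (iota : {rmorphism K -> S}) (a : 'rV[S]_3)
    (G : {mpoly K[3]}) : G \is 3.-homog ->
  6%:R * mmap iota (a 0) G = \sum_i \sum_j \sum_k
    iota (G^`M(i)^`M(j)^`M(k))@_0 * (a 0 i * a 0 j * a 0 k).
Proof.
move=> HG; rewrite -(rmorph_nat iota) -mmapZ cubic_expand // raddf_sum.
apply: eq_bigr => i _; rewrite raddf_sum; apply: eq_bigr => j _.
rewrite raddf_sum; apply: eq_bigr => k _ /=.
by rewrite mmapZ !rmorphM /= !mmapX !mmap1U.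
Qed.

(** The factor is 24 / 6: [tensor_coef] divides by 24, and Euler's formula applied three times to a
    cubic gives 6. *)
Lemma tensor_deriv (S : comNzRingType) (iota : {rmorphism K -> S}) (a : 'rV[S]_3) l :
  4%:R * tensor iota (delta_mx 0 l) a a a = mmap iota (a 0) F^`M(l).
Proof.
have u6 : iota 6%:R^-1 * 6%:R = 1.
  by rewrite -(rmorph_nat iota 6) -rmorphM mulVf ?rmorph1 // (proj1 (pcharf0P K) charK0).
rewrite -[RHS]mul1r -[X in _ = X * _]u6 -mulrA (mmap_cubic _ _ (dhomog_mderiv l homF)).
rewrite /tensor (bigD1 l) //= [X in _ * (_ + X)]big1 ?addr0; last first.
  move=> i /negbTE il; rewrite big1 // => j _; rewrite big1 // => k _; rewrite big1 // => m _.
  by rewrite mxE il andbF !mul0r mulr0.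
rewrite !mulr_sumr; apply: eq_bigr => i _; rewrite !mulr_sumr; apply: eq_bigr => j _.
rewrite !mulr_sumr; apply: eq_bigr => k _.
have E : 4%:R * iota (tensor_coef l i j k) =
    iota 6%:R^-1 * iota (F^`M(l)^`M(i)^`M(j)^`M(k))@_0.
  rewrite -(rmorph_nat iota 4) -!rmorphM; congr (iota _).
  rewrite /tensor_coef mulrA; congr (_ * _).
  apply: (mulfI natf24); rewrite mulrCA divff ?natf24 // mulr1.
  have -> : (24%:R : K) = 4%:R * 6%:R by rewrite -natrM.
  by rewrite mulfK // (proj1 (pcharf0P K) charK0).
rewrite mxE !eqxx mul1r.
by apply: (lincomb1 (c1 := a 0 i * a 0 j * a 0 k) E); ring.
Qed.

Lemma tensor_eval (S : comNzRingType) (iota : {rmorphism K -> S}) (a : 'rV[S]_3) :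
  tensor iota a a a a = mmap iota (a 0) F.
Proof.
have u4 : iota 4%:R^-1 * 4%:R = 1.
  by rewrite -(rmorph_nat iota 4) -rmorphM mulVf ?rmorph1 // (proj1 (pcharf0P K) charK0).
rewrite -[RHS]mul1r -[X in _ = X * _]u4 -mulrA -(rmorph_nat iota 4) -mmapZ (euler_homog homF) raddf_sum.
have Ea : a = \sum_i a 0 i *: delta_mx 0 i := row_sum_delta a.
have HT := tensor_quartic iota.
rewrite {1}Ea !big_ord_recl !big_ord0 !addr0 !(tensD HT, tensZ HT) !mulrDr !addrA.
have E l : mmap iota (a 0) ('X_l * F^`M(l)) = 4%:R * (a 0 l * tensor iota (delta_mx 0 l) a a a).
  by rewrite rmorphM /= mmapX mmap1U -tensor_deriv; ring.
rewrite /= !E.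
by apply: (lincomb1 (c1 := - (a 0 0 * tensor iota (delta_mx 0 0) a a a
  + a 0 (lift ord0 ord0) * tensor iota (delta_mx 0 (lift ord0 ord0)) a a a
  + a 0 (lift ord0 (lift ord0 ord0)) * tensor iota (delta_mx 0 (lift ord0 (lift ord0 ord0))) a a a)) u4); ring.
Qed.

Lemma tensor_rmorph (S S' : comNzRingType) (iota : {rmorphism K -> S})
    (phi : {rmorphism S -> S'}) (iota' : {rmorphism K -> S'}) a b c d :
  (forall x, iota' x = phi (iota x)) ->
  phi (tensor iota a b c d) =
  tensor iota' (map_mx phi a) (map_mx phi b) (map_mx phi c) (map_mx phi d).
Proof.
move=> H; rewrite /tensor rmorph_sum; apply: eq_bigr => i _.
rewrite rmorph_sum; apply: eq_bigr => j _; rewrite rmorph_sum; apply: eq_bigr => k _.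
rewrite rmorph_sum; apply: eq_bigr => l _; rewrite !mxE [LHS]rmorphM -H.
by congr (_ * _); rewrite !rmorphM.
Qed.

End Tensor.

(** * The quartic over the field of rational functions *)

Lemma fraction_repr (R : idomainType) (u : {fraction R}) :
  exists2 ab : R * R, ab.2 != 0 & u = tofrac ab.1 / tofrac ab.2.
Proof.
exists (\n_(repr u), \d_(repr u)); first exact: denom_ratioP.
rewrite -[LHS]reprK.
apply: (canRL (mulfK _)); first by rewrite tofrac_eq0 denom_ratioP.
rewrite !piE /=.
apply/eqP; rewrite eqquotE /= /FracField.equivf /=.
rewrite /FracField.mulf !numden_Ratio ?mulf_neq0 ?denom_ratioP ?oner_neq0 //.
by rewrite !mulr1 mulrC.
Qed.

Section RationalFunctions.

Variable K : closedFieldType.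
Local Notation R := {poly K}.
Local Notation k := {fraction R}.
Local Notation "x %:F" := (tofrac x).

Lemma fraction_coprime (u : k) :
  exists a b : R, [/\ b != 0, coprimep a b & u = a%:F / b%:F].
Proof.
case: (fraction_repr u) => -[a b] /= b0 ->.
have g0 : gcdp a b != 0 by rewrite gcdp_eq0 (negbTE b0) andbF.
exists (a %/ gcdp a b), (b %/ gcdp a b).
have Ea : a = a %/ gcdp a b * gcdp a b by rewrite divpK // dvdp_gcdl.
have Eb : b = b %/ gcdp a b * gcdp a b by rewrite divpK // dvdp_gcdr.
have b'0 : b %/ gcdp a b != 0 by apply: contraNneq b0 => H; rewrite Eb H mul0r.
split=> //; first by rewrite coprimep_div_gcd // b0 orbT.
have EaF : a%:F = (a %/ gcdp a b)%:F * (gcdp a b)%:F :> k by rewrite -tofracM -Ea.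
have EbF : b%:F = (b %/ gcdp a b)%:F * (gcdp a b)%:F :> k by rewrite -tofracM -Eb.
rewrite EaF EbF invfM mulrACA divff ?mulr1 //.
by rewrite tofrac_eq0.
Qed.

Lemma coprime_unit_frac (a b : R) (u : k) : b != 0 -> size b = 1%N -> u = a%:F / b%:F ->
  exists c : R, u = c%:F.
Proof.
move=> b0 /eqP/size_poly1P [c c0 Eb] ->; exists (c^-1 *: a).
apply: (canLR (mulfK _)); first by rewrite tofrac_eq0.
by rewrite -tofracM Eb mulrC mul_polyC scalerA divff // scale1r.
Qed.

(** The ring [{poly K}] is integrally closed: for u = a / b in lowest terms, the equation makes b
    divide a^(n+1), so b is constant. *)
Lemma fraction_integral n (c : nat -> R) (u : k) :
  u ^+ n.+1 = \sum_(i < n.+1) (c i)%:F * u ^+ i -> exists a : R, u = a%:F.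
Proof.
case: (fraction_coprime u) => a [b [b0 cab Eu]] H.
apply: (@coprime_unit_frac a b) => //.
have bF : b%:F != 0 :> k by rewrite tofrac_eq0.
have E : a ^+ n.+1 = b * \sum_(i < n.+1) c i * a ^+ i * b ^+ (n - i).
  apply/eqP; rewrite -tofrac_eq tofracXn; apply/eqP.
  have -> : a%:F = u * b%:F :> k by rewrite Eu divfK.
  rewrite exprMn H mulr_suml tofracM rmorph_sum mulr_sumr; apply: eq_bigr => i _.
  rewrite !rmorphM !rmorphXn /= -/(tofrac _).
  have -> : a%:F = u * b%:F :> k by rewrite Eu divfK.
  have -> : b%:F ^+ n.+1 = b%:F ^+ i * b%:F ^+ (n - i).+1 :> k.
    by rewrite -exprD; congr (_ ^+ _); have := ltn_ord i; lia.
  by rewrite exprMn exprS; ring.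
have cab' : coprimep b (a ^+ n.+1) by rewrite coprimep_expr // coprimep_sym.
have : coprimep b b.
  by apply: coprimep_dvdl cab'; rewrite E dvdp_mulr.
by rewrite coprimepp => /eqP.
Qed.

End RationalFunctions.

Section BinaryForms.

Variable K : closedFieldType.
Implicit Types p q : {poly K}.

(* The binary form of degree [d] dehomogenizing to [p]. *)
Definition bform (S : comNzRingType) (iota : {rmorphism K -> S}) d p (x y : S) : S :=
  \sum_(i < d.+1) iota p`_i * x ^+ i * y ^+ (d - i).

Section Ring.

Variables (S : comNzRingType) (iota : {rmorphism K -> S}).
Implicit Types x y : S.
Local Notation form := (bform iota).

Lemma formD d p q x y : form d (p + q) x y = form d p x y + form d q x y.
Proof.
by rewrite -big_split; apply: eq_bigr => i _ /=; rewrite coefD rmorphD !mulrDl.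
Qed.

Lemma formZ d c p x y : form d (c *: p) x y = iota c * form d p x y.
Proof.
by rewrite mulr_sumr; apply: eq_bigr => i _ /=; rewrite coefZ rmorphM !mulrA.
Qed.

Lemma form0 d x y : form d 0 x y = 0.
Proof. by rewrite -(scale0r 0) formZ rmorph0 mul0r. Qed.

Lemma formB d p q x y : form d (p - q) x y = form d p x y - form d q x y.
Proof. by rewrite -scaleN1r formD formZ rmorphN1 mulN1r. Qed.

Lemma form_sum (I : Type) (r : seq I) d (f : I -> {poly K}) x y :
  form d (\sum_(i <- r) f i) x y = \sum_(i <- r) form d (f i) x y.
Proof.
elim: r => [|i r IH]; first by rewrite !big_nil form0.
by rewrite !big_cons formD IH.
Qed.

Lemma formXn d i x y : (i <= d)%N -> form d 'X^i x y = x ^+ i * y ^+ (d - i).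
Proof.
move=> id; rewrite /bform (bigD1 (inord i)) //= big1 ?addr0.
  by rewrite coefXn inordK ?ltnS // eqxx rmorph1 mul1r.
move=> j ji; rewrite coefXn; case: eqP => [E|]; last by rewrite rmorph0 !mul0r.
by move/eqP: ji; case; apply/val_inj; rewrite /= inordK ?ltnS // E.
Qed.

Lemma formM d e p q x y : (size p <= d.+1)%N -> (size q <= e.+1)%N ->
  form (d + e) (p * q) x y = form d p x y * form e q x y.
Proof.
move=> sp sq.
have expand n (s : {poly K}) : (size s <= n.+1)%N -> s = \sum_(i < n.+1) s`_i *: 'X^i.
  move=> ss; rewrite -poly_def; apply/polyP=> i; rewrite coef_poly.
  by case: ltnP => // H; rewrite nth_default // (leq_trans ss).
rewrite {1}(expand _ _ sp) {1}(expand _ _ sq) mulr_suml form_sum mulr_suml.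
apply: eq_bigr => i _; rewrite mulr_sumr form_sum mulr_sumr; apply: eq_bigr => j _.
rewrite -scalerAl -scalerAr -exprD !formZ formXn; last by have := ltn_ord i; have := ltn_ord j; lia.
have -> : (d + e - (i + j) = (d - i) + (e - j))%N by have := ltn_ord i; have := ltn_ord j; lia.
by rewrite !exprD; ring.
Qed.

End Ring.

Lemma form_horner d p (x y : {poly K}) s :
  (bform polyC d p x y).[s] = bform idfun d p x.[s] y.[s].
Proof.
rewrite /bform horner_sum; apply: eq_bigr => i _.
by rewrite !hornerM !horner_exp hornerC.
Qed.

Lemma form_zero d p : (0 < d)%N -> (size p <= d.+1)%N ->
  exists x y : K, (x, y) != (0, 0) /\ bform idfun d p x y = 0.
Proof.
move=> d0 sp; have [sp1|sp1] := leqP (size p) 1.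
  (* A constant read as a form of degree d > 0 is a multiple of y^d, which vanishes at infinity. *)
  exists 1, 0; split; first by rewrite xpair_eqE oner_eq0.
  rewrite /bform big1 // => i _.
  have [->|id] := eqVneq (i : nat) d; first by rewrite nth_default ?mul0r // (leq_trans sp1).
  by rewrite expr0n subn_eq0 leqNgt ltn_neqAle id -ltnS ltn_ord /= mulr0.
have /closed_rootP [x Hx] : size p != 1%N by rewrite neq_ltn sp1 orbT.
exists x, 1; split; first by rewrite xpair_eqE oner_eq0 andbF.
move/rootP: Hx => <-; rewrite (horner_coef_wide _ sp) /bform.
by apply: eq_bigr => i _; rewrite expr1n mulr1.
Qed.

Lemma form_linear (e : K) (S : comNzRingType) (iota : {rmorphism K -> S}) (x y : S) :
  bform iota 1 ('X - e%:P) x y = x - iota e * y.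
Proof.
rewrite formB -alg_polyC formZ -['X]expr1 -(expr0 'X) !formXn //.
by rewrite !expr0 !expr1 mulr1 mul1r.
Qed.

End BinaryForms.

Arguments formM {K S iota} d e {p q x y}.

(** * Shapes of z^4 + p z^2 + q z + r that force a singular point *)

Section DepressedQuartic.

Variable K : closedFieldType.
Hypothesis charK0 : [pchar K] =i pred0.
Local Notation R := {poly K}.
Local Notation k := {fraction R}.
Local Notation "x %:F" := (tofrac x : k).

Definition depressed (S : comNzRingType) (iota : {rmorphism K -> S}) (p q r : R) (x y z : S) : S :=
  z ^+ 4 + bform iota 2 p x y * z ^+ 2 + bform iota 3 q x y * z + bform iota 4 r x y.

Definition ray (x a : K) : R := x%:P + a%:P * 'X.

(* Smoothness of [z^4 + p z^2 + q z + r] in the form in which it is used: a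
   nonzero point is singular if, along every line through it, the quartic is a
   sum of two products of functions vanishing there. *)
Definition nonsingular p q r : Prop := forall x y z : K,
  (forall a b c, exists A B C D : R,
     [/\ A.[0] = 0, B.[0] = 0, C.[0] = 0, D.[0] = 0 &
         depressed polyC p q r (ray x a) (ray y b) (ray z c) = A * B + C * D]) ->
  [/\ x = 0, y = 0 & z = 0].

Lemma ray0 x a : (ray x a).[0] = x.
Proof. by rewrite /ray !hornerE; ring. Qed.

Lemma size_scale_le n c (p : R) : (size p <= n)%N -> (size (c *: p)%R <= n)%N.
Proof. by move=> h; apply: leq_trans h; apply: size_scale_leq. Qed.

Lemma size_add_leq n (p q : R) : (size p <= n)%N -> (size q <= n)%N -> (size (p + q)%R <= n)%N.
Proof. by move=> hp hq; rewrite (leq_trans (size_polyD _ _)) // geq_max hp. Qed.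

Lemma size_sub_leq n (p q : R) : (size p <= n)%N -> (size q <= n)%N -> (size (p - q)%R <= n)%N.
Proof. by move=> hp hq; apply: size_add_leq; rewrite ?size_polyN. Qed.

Lemma size_mul_leq_nat a b n (p q : R) : (size p <= a.+1)%N -> (size q <= b.+1)%N ->
  (a + b < n)%N -> (size (p * q)%R <= n)%N.
Proof. by move=> hp hq hn; rewrite (leq_trans (size_polyMleq _ _)) //; lia. Qed.

Definition eval0E := (hornerE, horner_exp, form_horner, ray0).

Lemma form_sqr (S : comNzRingType) (iota : {rmorphism K -> S}) d (p : R) (x y : S) :
  (size p <= d.+1)%N -> bform iota (d + d) (p ^+ 2) x y = bform iota d p x y ^+ 2.
Proof. by move=> sp; rewrite !expr2 formM. Qed.

Arguments form_sqr {S iota} d {p x y}.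

Lemma closed_sqrt (a : K) : exists b : K, b ^+ 2 = a.
Proof. exact: closed_root. Qed.

(** The quartic is (z^2 + c)^2 - m (z - b)^2, singular where z = b and z^2 + c = 0, that is, over
    the zeros of b^2 + c. *)
Lemma singular_conic (c m b : R) : (size c <= 3)%N -> (size m <= 3)%N -> (size b <= 2)%N ->
  ~ nonsingular (2 *: c - m) (2 *: (m * b)) (c ^+ 2 - m * b ^+ 2).
Proof.
move=> sc sm sb Hns.
have sb2 : (size (b ^+ 2) <= 3)%N by rewrite expr2; apply: (size_mul_leq_nat sb sb).
have [x [y [xy0 Hxy]]] : exists x y : K, (x, y) != (0, 0) /\ bform idfun 2 (b ^+ 2 + c) x y = 0.
  by apply: form_zero => //; apply: size_add_leq.
rewrite formD (form_sqr 1) // in Hxy.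
pose z := bform idfun 1 b x y.
case: (Hns x y z) => [a a' a''|x0 y0 z0]; last by rewrite x0 y0 eqxx in xy0.
set X := ray x a; set Y := ray y a'; set Z := ray z a''.
pose Q := Z ^+ 2 + bform polyC 2 c X Y.
pose M := Z - bform polyC 1 b X Y.
exists Q, Q, (- (bform polyC 2 m X Y * M)), M; split.
- by rewrite /Q !eval0E.
- by rewrite /Q !eval0E.
- by rewrite /M !eval0E subrr mulr0 oppr0.
- by rewrite /M !eval0E subrr.
rewrite /depressed !formB !formZ (form_sqr 2) // (formM 2 1) //.
by rewrite (formM 2 2) // (form_sqr 1) // /Q /M rmorph_nat; ring.
Qed.

(** The quartic is (z^2 + c)^2 - (a z - b)^2, a product of two conics, singular where they meet,
    over the zeros of b^2 + a^2 c. *)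
Lemma singular_split (c a b : R) : (size c <= 3)%N -> (size a <= 2)%N -> (size b <= 3)%N ->
  ~ nonsingular (2 *: c - a ^+ 2) (2 *: (a * b)) (c ^+ 2 - b ^+ 2).
Proof.
move=> sc sa sb Hns.
have sa2 : (size (a ^+ 2) <= 3)%N by rewrite expr2; apply: (size_mul_leq_nat sa sa).
have sb2 : (size (b ^+ 2) <= 5)%N by rewrite expr2; apply: (size_mul_leq_nat sb sb).
have [x [y [xy0 Hxy]]] : exists x y : K, (x, y) != (0, 0) /\
    bform idfun 4 (b ^+ 2 + a ^+ 2 * c) x y = 0.
  by apply: form_zero => //; apply: size_add_leq => //; apply: (size_mul_leq_nat sa2 sc).
rewrite formD (form_sqr 2) // (formM 2 2) // (form_sqr 1) // in Hxy.
have [z [Qz Mz]] : exists z : K, z ^+ 2 + bform idfun 2 c x y = 0 /\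
    bform idfun 1 a x y * z - bform idfun 2 b x y = 0.
  (* Where [a] vanishes so does [b], and any square root of - c serves as z. *)
  have [a0|a0] := eqVneq (bform idfun 1 a x y) 0.
    have [z Hz] := closed_sqrt (- bform idfun 2 c x y); exists z.
    rewrite Hz addNr a0 mul0r sub0r; split=> //.
    by move/eqP: Hxy; rewrite a0 expr0n mul0r addr0 expf_eq0 /= => /eqP ->; rewrite oppr0.
  exists (bform idfun 2 b x y / bform idfun 1 a x y); split.
    apply: (mulfI (expf_neq0 2 a0)); rewrite mulr0 -[RHS]Hxy; by field.
  by field.
case: (Hns x y z) => [u u' u''|x0 y0 z0]; last by rewrite x0 y0 eqxx in xy0.
set X := ray x u; set Y := ray y u'; set Z := ray z u''.
pose Q := Z ^+ 2 + bform polyC 2 c X Y.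
pose M := bform polyC 1 a X Y * Z - bform polyC 2 b X Y.
exists Q, Q, (- M), M; split.
- by rewrite /Q !eval0E.
- by rewrite /Q !eval0E.
- by rewrite /M !eval0E Mz oppr0.
- by rewrite /M !eval0E Mz.
rewrite /depressed !formB !formZ (form_sqr 2) // (formM 1 2) //.
by rewrite (form_sqr 2) // (form_sqr 1) // /Q /M rmorph_nat; ring.
Qed.

(** The line z = t is a component, and it meets the residual cubic [N] over the zeros of 4 t^3 + 2 p
    t + q. *)
Lemma singular_root (p q t : R) : (size p <= 3)%N -> (size q <= 4)%N -> (size t <= 2)%N ->
  ~ nonsingular p q (- (t ^+ 4 + p * t ^+ 2 + q * t)).
Proof.
move=> sp sq st Hns.
have st2 : (size (t ^+ 2) <= 3)%N by rewrite expr2; apply: (size_mul_leq_nat st st).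
have st3 : (size (t ^+ 3) <= 4)%N by rewrite exprS; apply: (size_mul_leq_nat st st2).
have spt : (size (p * t)%R <= 4)%N by apply: (size_mul_leq_nat sp st).
have [x [y [xy0 Hxy]]] : exists x y : K, (x, y) != (0, 0) /\
    bform idfun 3 (4 *: t ^+ 3 + 2 *: (p * t) + q) x y = 0.
  by apply: form_zero => //; rewrite !size_add_leq ?size_scale_le.
have e2 (S : comNzRingType) (iota : {rmorphism K -> S}) (X Y : S) : bform iota 2 (t ^+ 2) X Y = bform iota 1 t X Y ^+ 2.
  by rewrite (form_sqr 1).
have e3 (S : comNzRingType) (iota : {rmorphism K -> S}) (X Y : S) : bform iota 3 (t ^+ 3) X Y = bform iota 1 t X Y ^+ 3.
  by rewrite exprS (formM 1 2) // e2 -exprS.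
have e4 (S : comNzRingType) (iota : {rmorphism K -> S}) (X Y : S) : bform iota 4 (t ^+ 4) X Y = bform iota 1 t X Y ^+ 4.
  by rewrite exprS (formM 1 3) // e3 -exprS.
rewrite !formD !formZ e3 (formM 2 1) // in Hxy.
case: (Hns x y (bform idfun 1 t x y)) => [u u' u''|x0 y0 z0]; last by rewrite x0 y0 eqxx in xy0.
set X := ray x u; set Y := ray y u'; set Z := ray _ u''.
pose M := Z - bform polyC 1 t X Y.
pose N := Z ^+ 3 + bform polyC 1 t X Y * Z ^+ 2 + (bform polyC 1 t X Y ^+ 2 + bform polyC 2 p X Y) * Z
  + bform polyC 1 t X Y ^+ 3 + bform polyC 2 p X Y * bform polyC 1 t X Y + bform polyC 3 q X Y.
exists M, N, 0, 0; split; rewrite ?horner0 //.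
- by rewrite /M !eval0E subrr.
- by rewrite /N !eval0E -[RHS]Hxy /=; ring.
rewrite /depressed -scaleN1r formZ !formD e4 (formM 2 2) // e2.
by rewrite (formM 3 1) // /M /N rmorphN1; ring.
Qed.

Lemma singular_square (p a : R) : (size p <= 3)%N -> (size a <= 3)%N ->
  ~ nonsingular p 0 (a ^+ 2).
Proof.
move=> sp sa Hns.
have [x [y [xy0 Hxy]]] := form_zero (isT : (0 < 2)%N) sa.
case: (Hns x y 0) => [u u' u''|x0 y0 z0]; last by rewrite x0 y0 eqxx in xy0.
set X := ray x u; set Y := ray y u'; set Z := ray _ u''.
exists Z, (Z * (Z ^+ 2 + bform polyC 2 p X Y)), (bform polyC 2 a X Y), (bform polyC 2 a X Y).
split; [by rewrite !eval0E | by rewrite !eval0E | by rewrite !eval0E | by rewrite !eval0E |].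
by rewrite /depressed form0 (form_sqr 2) //; ring.
Qed.

Lemma singular_factor (p r' : R) e : (size r' <= 3)%N ->
  ~ nonsingular p 0 (('X - e%:P) ^+ 2 * r').
Proof.
move=> sr Hns; case: (Hns e 1 0) => [u u' u''|_ /eqP]; last by rewrite oner_eq0.
set X := ray e u; set Y := ray 1 u'; set Z := ray _ u''.
pose M := X - e%:P * Y.
exists Z, (Z * (Z ^+ 2 + bform polyC 2 p X Y)), (bform polyC 2 r' X Y * M), M.
have M0 : M.[0] = 0 by rewrite /M !eval0E subrr.
split; rewrite ?M0 ?hornerM ?M0 ?ray0 ?mul0r ?mulr0 //.
have s1 : (size ('X - e%:P : R)%R <= 2)%N by rewrite size_XsubC.
have s2 : (size (('X - e%:P : R) ^+ 2)%R <= 3)%N by rewrite expr2; apply: (size_mul_leq_nat s1 s1).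
rewrite /depressed form0 (formM 2 2) // (form_sqr 1) // form_linear.
by rewrite /M; ring.
Qed.

(** The quartic is (z^2 + c)^2 - (x - e y)^2 d', singular at (e : 1 : z) when z^2 = - c(e). *)
Lemma singular_discr (c d' : R) e : (size c <= 3)%N -> (size d' <= 3)%N ->
  ~ nonsingular (2 *: c) 0 (c ^+ 2 - ('X - e%:P) ^+ 2 * d').
Proof.
move=> sc sd Hns; have [z Hz] := closed_sqrt (- bform idfun 2 c e 1).
case: (Hns e 1 z) => [u u' u''|_ /eqP]; last by rewrite oner_eq0.
set X := ray e u; set Y := ray 1 u'; set Z := ray _ u''.
pose M := X - e%:P * Y; pose Q := Z ^+ 2 + bform polyC 2 c X Y.
exists Q, Q, (- (bform polyC 2 d' X Y * M)), M.
have M0 : M.[0] = 0 by rewrite /M !eval0E subrr.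
have Q0 : Q.[0] = 0 by rewrite /Q !eval0E Hz addNr.
split; rewrite ?M0 ?hornerN ?hornerM ?M0 ?mulr0 ?oppr0 //.
have s1 : (size ('X - e%:P : R)%R <= 2)%N by rewrite size_XsubC.
have s2 : (size (('X - e%:P : R) ^+ 2)%R <= 3)%N by rewrite expr2; apply: (size_mul_leq_nat s1 s1).
rewrite /depressed form0 formB formZ (form_sqr 2) // (formM 2 2) //.
by rewrite (form_sqr 1) // form_linear /M /Q rmorph_nat; ring.
Qed.

End DepressedQuartic.

(** * Rational roots of the quartic and of its cubic resolvent *)

Section Resolvent.

Variable K : closedFieldType.
Hypothesis charK0 : [pchar K] =i pred0.
Local Notation R := {poly K}.
Local Notation k := {fraction R}.
Local Notation "x %:F" := (tofrac x : k).

Variables p q r : R.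
Hypotheses (sp : (size p <= 3)%N) (sq : (size q <= 4)%N) (sr : (size r <= 5)%N).
Hypothesis Hns : nonsingular p q r.

Lemma tofrac_nat n : (n%:R : R)%:F = n%:R.
Proof. exact: rmorph_nat. Qed.

Let fracE := (tofrac_nat, @tofracXn R, @tofracN R, @tofracB R, @tofracD R, @tofracM R, @tofrac0 R).

Let natK_unit := char0_nat_neq0 charK0.

Lemma size_exp_nat (a : R) n : a != 0 -> size (a ^+ n) = ((size a).-1 * n).+1.
Proof. by move=> a0; rewrite -size_exp prednK // size_poly_gt0 expf_neq0. Qed.

Lemma size_opp_le n (a : R) : (size a <= n)%N -> (size (- a) <= n)%N.
Proof. by rewrite size_polyN. Qed.

Lemma size_mul_le (a b : R) m n l : (size a <= m)%N -> (size b <= n)%N -> (m + n <= l.+1)%N ->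
  (size (a * b)%R <= l)%N.
Proof. by move=> ha hb hl; rewrite (leq_trans (size_polyMleq _ _)) //; lia. Qed.

(** A rational root is a polynomial by integrality and of degree at most 1 by comparison with z^4;
    it would be a line contained in the curve. *)
Lemma quartic_no_root (t : k) : t ^+ 4 + p%:F * t ^+ 2 + q%:F * t + r%:F <> 0.
Proof.
move=> H.
have [a Ea] : exists a : R, t = a%:F.
  apply: (@fraction_integral _ 3 (nth 0 [:: - r; - q; - p; 0])).
  rewrite !big_ord_recl big_ord0 /= !tofracN tofrac0.
  by apply: (lincomb1 (c1 := 1) H); ring.
have Er : r = - (a ^+ 4 + p * a ^+ 2 + q * a).
  apply/eqP; rewrite -tofrac_eq; apply/eqP.
  rewrite !fracE -Ea.
  by apply: (lincomb1 (c1 := 1) H); ring.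
have sa : (size a <= 2)%N.
  rewrite leqNgt; apply/negP => sa.
  have a0 : a != 0 by rewrite -size_poly_gt0 (leq_trans _ sa).
  have E : a ^+ 4 = - (p * a ^+ 2 + q * a + r) by rewrite Er; ring.
  have : (size (a ^+ 4) <= (2 * size a).+1)%N.
    rewrite E; apply: size_opp_le; rewrite !size_add_leq //.
    - by apply: (size_mul_le sp (leqnn _)); rewrite size_exp_nat //; lia.
    - by apply: (size_mul_le sq (leqnn _)); lia.
    by rewrite (leq_trans sr) //; lia.
  by rewrite size_exp_nat //; lia.
by apply: (singular_root sp sq sa); rewrite -Er.
Qed.

Lemma half_scale (a : R) : 2 *: (2^-1 *: a) = a.
Proof. by rewrite scalerA divff ?natK_unit // scale1r. Qed.

Lemma half_p_size : (size (2^-1 *: p) <= 3)%N.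
Proof. exact: size_scale_le. Qed.

Lemma quarter_sqr (a b : R) : a ^+ 2 - b = 4%:R * r ->
  r = (2^-1 *: a) ^+ 2 - 4^-1 *: b.
Proof.
move=> H; have -> : r = 4^-1 *: (4%:R * r).
  by rewrite mulr_natl -scaler_nat scalerA mulVf ?scale1r ?natK_unit.
rewrite -H scalerBr exprZn; congr (_ *: _ - _).
by rewrite exprVn; congr (_^-1); ring.
Qed.

Lemma discr_not_square (d : k) : q = 0 -> d ^+ 2 <> p%:F ^+ 2 - 4 * r%:F.
Proof.
move=> q0 H.
have [a Ea] : exists a : R, d = a%:F.
  apply: (@fraction_integral _ 1 (nth 0 [:: p ^+ 2 - 4 * r; 0])).
  rewrite !big_ord_recl big_ord0 /= !fracE H.
  by ring.
have Er : p ^+ 2 - a ^+ 2 = 4 * r.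
  apply/eqP; rewrite -tofrac_eq; apply/eqP.
  rewrite !fracE -Ea H; ring.
have sa : (size a <= 3)%N.
  rewrite leqNgt; apply/negP => sa.
  have a0 : a != 0 by rewrite -size_poly_gt0 (leq_trans _ sa).
  have : (size (a ^+ 2) <= 5)%N.
    have -> : a ^+ 2 = p ^+ 2 - 4 *: r by rewrite scaler_nat -mulr_natl -Er; ring.
    by rewrite size_sub_leq ?size_scale_le //; apply: (size_mul_le sp sp).
  by rewrite size_exp_nat //; lia.
have sa2 : (size (2^-1 *: a) <= 3)%N := size_scale_le _ sa.
apply: (@singular_split _ (2^-1 *: p) 0 (2^-1 *: a)) => //.
- exact: half_p_size.
- by rewrite size_poly0.
have -> : (2^-1 *: p) ^+ 2 - (2^-1 *: a) ^+ 2 = r.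
  rewrite [RHS](quarter_sqr Er) exprZn; congr (_ - _).
  by rewrite exprZn exprVn; congr (_^-1 *: _); ring.
by rewrite half_scale expr0n /= subr0 mul0r scaler0 -q0.
Qed.

Lemma const_not_square (d : k) : q = 0 -> d ^+ 2 <> r%:F.
Proof.
move=> q0 H.
have [a Ea] : exists a : R, d = a%:F.
  apply: (@fraction_integral _ 1 (nth 0 [:: r; 0])).
  by rewrite !big_ord_recl big_ord0 /= tofrac0 H; ring.
have Er : r = a ^+ 2.
  by apply/eqP; rewrite -tofrac_eq tofracXn -Ea H.
have sa : (size a <= 3)%N.
  rewrite leqNgt; apply/negP => sa.
  have a0 : a != 0 by rewrite -size_poly_gt0 (leq_trans _ sa).
  by move: sr; rewrite Er size_exp_nat //; lia.
by apply: (singular_square sp sa); rewrite -Er -q0.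
Qed.

Lemma const_neq0 : q = 0 -> r != 0.
Proof.
move=> q0; apply/eqP => r0; apply: (@quartic_no_root 0).
by rewrite r0 tofrac0; ring.
Qed.

Lemma root_factor (b : R) : b != 0 -> size b != 1%N -> exists e, 'X - e%:P %| b.
Proof.
by move=> b0 sb; have /closed_rootP [e He] := sb; exists e; rewrite dvdp_XsubCl.
Qed.

(** This excludes that r (p^2 - 4 r) is a square, the case of a cyclic biquadratic. For c = a / b in
    lowest terms, a^2 divides r and b^2 divides p^2 - 4 r, so a nonconstant a or b yields a double
    factor and a singular point. If both are constant, r is a scalar multiple of p^2, hence a
    square. *)
Lemma const_discr (c : k) : q = 0 -> p != 0 -> c ^+ 2 * (p%:F ^+ 2 - 4 * r%:F) <> 4 * r%:F.
Proof.
move=> q0 p0 H; have r0 := const_neq0 q0.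
case: (fraction_coprime c) => a [b [b0 cab Ec]].
have bF : b%:F != 0 by rewrite tofrac_eq0.
have E : a ^+ 2 * (p ^+ 2 - 4 * r) = 4 * r * b ^+ 2.
  apply/eqP; rewrite -tofrac_eq; apply/eqP.
  rewrite !fracE.
  have -> : a%:F = c * b%:F by rewrite Ec divfK.
  by apply: (lincomb1 (c1 := b%:F ^+ 2) H); ring.
have fourK : (4%:R : R) != 0 by rewrite -[4](rmorph_nat (@polyC K)) polyC_eq0 natK_unit.
have a0 : a != 0.
  apply/eqP=> a0; move/eqP: E; rewrite a0 expr0n mul0r eq_sym.
  by rewrite !mulf_eq0 (negbTE r0) (negbTE b0) (negbTE fourK).
have D5 : (size (p ^+ 2 - 4 * r)%R <= 5)%N.
  by rewrite mulr_natl -scaler_nat size_sub_leq ?size_scale_le //; apply: (size_mul_le sp sp).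
have quot_size (u v w : R) e : u = v ^+ 2 * w -> 'X - e%:P %| v -> u != 0 -> (size u <= 5)%N ->
    exists2 w' : R, (size w' <= 3)%N & u = ('X - e%:P) ^+ 2 * w'.
  move=> Eu /dvdpP [v' Ev] u0 su; exists (v' ^+ 2 * w); last by rewrite Eu Ev; ring.
  have Eu' : u = ('X - e%:P) ^+ 2 * (v' ^+ 2 * w) by rewrite Eu Ev; ring.
  have w0 : v' ^+ 2 * w != 0 by apply: contraNneq u0 => H0; rewrite Eu' H0 mulr0.
  have s3 : size (('X - e%:P : R) ^+ 2)%R = 3 by rewrite size_exp_nat ?polyXsubC_eq0 // size_XsubC.
  move: su; rewrite Eu' size_mul ?s3 ?expf_neq0 ?polyXsubC_eq0 //.
have cab2 : coprimep (a ^+ 2) (b ^+ 2) by rewrite coprimep_expl // coprimep_expr.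
have D0 : p ^+ 2 - 4 * r != 0.
  apply/eqP=> D0; move/eqP: E; rewrite D0 mulr0 eq_sym.
  by rewrite !mulf_eq0 (negbTE fourK) (negbTE r0) (negbTE b0).
have sa : size a = 1%N.
  apply/eqP/negPn/negP => /(root_factor a0) [e He].
  have : a ^+ 2 %| r.
    have : a ^+ 2 %| 4 * r * b ^+ 2 by rewrite -E dvdp_mulr.
    rewrite (Gauss_dvdpl _ cab2) mulr_natl -scaler_nat dvdpZr // natK_unit //.
  case/dvdpP=> w Er; rewrite mulrC in Er.
  case: (quot_size _ _ _ _ Er He r0 sr) => w' sw' Er'.
  by apply: (@singular_factor _ p w' e sw'); rewrite -Er' -q0.
have sb : size b = 1%N.
  apply/eqP/negPn/negP => /(root_factor b0) [e He].
  have : b ^+ 2 %| p ^+ 2 - 4 * r.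
    have : b ^+ 2 %| a ^+ 2 * (p ^+ 2 - 4 * r) by rewrite E dvdp_mull.
    by rewrite (Gauss_dvdpr _) // coprimep_sym.
  case/dvdpP=> w; rewrite [w * _]mulrC => ED.
  case: (quot_size _ _ _ _ ED He D0 D5) => w' sw' ED'.
  have sw4 : (size (4^-1 *: w') <= 3)%N := size_scale_le _ sw'.
  apply: (singular_discr (e := e) half_p_size sw4).
  have -> : (2^-1 *: p) ^+ 2 - ('X - e%:P) ^+ 2 * (4^-1 *: w') = r.
    by rewrite -scalerAr -ED'; apply/esym/quarter_sqr; ring.
  by rewrite half_scale -q0.
have /size_poly1P [a1 a10 Ea] : size a == 1%N by rewrite sa.
have /size_poly1P [b1 b10 Eb] : size b == 1%N by rewrite sb.
have E2 : a1 ^+ 2 *: p ^+ 2 = (4 * (b1 ^+ 2 + a1 ^+ 2)) *: r.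
  apply: (lincomb1 (c1 := 1) E); rewrite Ea Eb -!mul_polyC.
  by rewrite !(polyC_natr, polyC_exp, polyCM, polyCD); ring.
have [s0|s0] := eqVneq (4 * (b1 ^+ 2 + a1 ^+ 2)) 0.
  move/eqP: E2; rewrite s0 scale0r scaler_eq0 !expf_eq0 (negbTE a10) (negbTE p0).
  by [].
have [u Hu] := closed_sqrt (a1 ^+ 2 / (4 * (b1 ^+ 2 + a1 ^+ 2))).
apply: (@const_not_square ((u *: p)%:F) q0).
rewrite -tofracXn exprZn Hu mulrC -scalerA E2 scalerA mulVf // scale1r //.
Qed.

(** With n = (p + m)^2 - 4 r the quartic is (z^2 + (p + m) / 2)^2 - (m z^2 - q z + n / 4), and q^2 =
    m n says that the subtracted quadratic has discriminant zero. It is m (z - b)^2 if m is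
    squarefree, since then m divides q, and (a z - b)^2 if m = a^2. Both shapes are singular. *)
Lemma resolvent_poly (m : R) : m != 0 -> (size m <= 3)%N ->
  q ^+ 2 <> m * ((p + m) ^+ 2 - 4 * r).
Proof.
move=> m0 sm H.
set n := (p + m) ^+ 2 - 4 * r in H.
have sn : (size n <= 5)%N.
  rewrite /n mulr_natl -scaler_nat size_sub_leq ?size_scale_le //.
  by apply: (@size_mul_le _ _ 3 3) => //; apply: size_add_leq.
have [rs Ers] := closed_field_poly_normal m.
have lm : lead_coef m != 0 by rewrite lead_coef_eq0.
have srs : size m = (size rs).+1 by rewrite {1}Ers size_scale // size_prod_XsubC.
have Hc : (size (2^-1 *: (p + m)) <= 3)%N by apply/size_scale_le/size_add_leq.
have Ep : 2 *: (2^-1 *: (p + m)) - m = p by rewrite half_scale addrK.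
have En : (p + m) ^+ 2 - n = 4%:R * r by rewrite /n; ring.
have conic b : q = 2 *: (m * b) -> (size b <= 2)%N -> False.
  move=> Eq sb.
  have E4 : n = 4 *: (m * b ^+ 2).
    apply: (mulfI m0); rewrite -H Eq -!mul_polyC !polyC_natr; ring.
  apply: (singular_conic Hc sm sb).
  have -> : (2^-1 *: (p + m)) ^+ 2 - m * b ^+ 2 = r.
    by rewrite [RHS](quarter_sqr En) E4 scalerA mulVf ?natK_unit // scale1r.
  by rewrite Ep -Eq.
have split_ a b : m = a ^+ 2 -> (size a <= 2)%N -> q = 2 *: (a * b) -> (size b <= 3)%N -> False.
  move=> Em sa Eq sb.
  have E4 : n = 4 *: b ^+ 2.
    by apply: (mulfI m0); rewrite -H Eq Em -!mul_polyC !polyC_natr; ring.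
  apply: (singular_split Hc sa sb).
  have -> : (2^-1 *: (p + m)) ^+ 2 - b ^+ 2 = r.
    by rewrite [RHS](quarter_sqr En) E4 scalerA mulVf ?natK_unit // scale1r.
  by rewrite -Em Ep -Eq.
have half_quot d : d != 0 -> d %| q -> exists2 b, q = 2 *: (d * b) & (q = 0 /\ b = 0) \/ size q = (size d + size b).-1.
  move=> d0 /dvdpP [b Eq]; exists (2^-1 *: b).
    by rewrite -scalerAr half_scale Eq mulrC.
  have [q0|q0] := eqVneq q 0.
    left; split=> //; move/eqP: Eq; rewrite q0 eq_sym mulf_eq0 (negbTE d0) orbF => /eqP ->.
    by rewrite scaler0.
  right; rewrite Eq size_mul 1?addnC //.
    by rewrite size_scale // invr_eq0 natK_unit.
  by apply: contraNneq q0 => b0; rewrite Eq b0 mul0r.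
have q_size l : (size m + size n <= l.+1)%N -> (2 * size q <= l.+1)%N.
  move=> hl; have [->|q0] := eqVneq q 0; first by rewrite size_poly0; lia.
  have := size_polyMleq m n; rewrite -H size_exp_nat //.
  have := q0; rewrite -size_poly_gt0; lia.
(* Roots missing from [rs] lie at infinity: as a binary quadratic form a constant m is a square and
   a linear m is squarefree. In these cases [q_size] gives the divisibility of q at infinity. *)
case: rs srs Ers => [|e [|e' [|? ?]]] srs Ers; last by move: sm; rewrite srs.
- rewrite big_nil in Ers.
  have [u Hu] := closed_sqrt (lead_coef m).
  have Em : m = u%:P ^+ 2 by rewrite Ers -polyC_exp Hu alg_polyC.
  have u0 : u%:P != 0 :> R by apply: contraNneq m0 => u0; rewrite Em u0 expr0n.
  have uq : u%:P %| q.
    by rewrite polyC_eq0 in u0; rewrite -[u%:P]alg_polyC dvdpZl // dvd1p.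
  have [b Eq sb] := half_quot _ u0 uq.
  apply: (split_ _ _ Em _ Eq); first by rewrite (leq_trans (size_polyC_leq1 _)).
  case: sb => [[_ ->]|sb]; first by rewrite size_poly0.
  have := q_size 5%N; rewrite srs /=; rewrite polyC_eq0 in u0.
  move: sb; rewrite size_polyC u0 /= => -> /(_ sn); rewrite add0n => h.
  by rewrite -(@leq_pmul2l 2).
- rewrite big_seq1 in Ers.
  have mq : m %| q.
    have : m %| q ^+ 2 by rewrite H dvdp_mulr.
    rewrite {1 2}Ers !dvdpZl // !dvdp_XsubCl /root horner_exp expf_eq0 //.
  have [b Eq sb] := half_quot m m0 mq.
  apply: (conic _ Eq); case: sb => [[_ ->]|sb]; first by rewrite size_poly0.
  have := q_size 6%N; move: sb; rewrite srs /= => -> /(_ sn); rewrite add1n => h.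
  by rewrite -ltnS -(@ltn_pmul2l 2) //; rewrite mulnS in h; exact: h.
rewrite big_cons big_seq1 in Ers.
have [Ee|ne] := eqVneq e e'.
  have [u Hu] := closed_sqrt (lead_coef m).
  have Em : m = (u *: ('X - e%:P)) ^+ 2.
    by rewrite Ers exprZn Hu -Ee expr2.
  have a0 : u *: ('X - e%:P) != 0 by apply: contraNneq m0 => a0; rewrite Em a0 expr0n.
  have aq : u *: ('X - e%:P) %| q.
    by rewrite -(@dvdp_pexp2r _ _ _ 2) // -Em H dvdp_mulr.
  have sa : size (u *: ('X - e%:P)) = 2.
    by move: srs; rewrite Em size_exp_nat //=; have := a0; rewrite -size_poly_gt0; lia.
  have [b Eq sb] := half_quot _ a0 aq.
  apply: (split_ _ _ Em _ Eq); first by rewrite sa.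
  case: sb => [[_ ->]|sb]; first by rewrite size_poly0.
  by move: sq; rewrite sb sa.
have mq : m %| q.
  have : m %| q ^+ 2 by rewrite H dvdp_mulr.
  rewrite {1 2}Ers !dvdpZl // !Gauss_dvdp; last 2 first.
  - by rewrite coprimep_XsubC root_XsubC eq_sym.
  - by rewrite coprimep_XsubC root_XsubC eq_sym.
  by rewrite !dvdp_XsubCl /root !horner_exp !expf_eq0.
have [b Eq sb] := half_quot m m0 mq.
apply: (conic _ Eq); case: sb => [[_ ->]|sb]; first by rewrite size_poly0.
by move: sq; rewrite sb srs.
Qed.

(** A rational root is a polynomial, of degree at most 2 because otherwise its cube would dominate
    the other terms; [resolvent_poly] then leaves only zero. *)
Lemma resolvent_root (m : k) :
  m ^+ 3 + 2 * p%:F * m ^+ 2 + (p%:F ^+ 2 - 4 * r%:F) * m - q%:F ^+ 2 = 0 ->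
  m = 0 /\ q = 0.
Proof.
move=> H.
have [a Ea] : exists a : R, m = a%:F.
  apply: (@fraction_integral _ 2 (nth 0 [:: q ^+ 2; - (p ^+ 2 - 4 * r); - (2 * p)])).
  rewrite !big_ord_recl big_ord0 /= !fracE.
  by apply: (lincomb1 (c1 := 1) H); ring.
have E : q ^+ 2 = a * ((p + a) ^+ 2 - 4 * r).
  apply/eqP; rewrite -tofrac_eq; apply/eqP; rewrite !fracE -Ea.
  by apply: (lincomb1 (c1 := -1) H); ring.
have [a0|a0] := eqVneq a 0.
  split; first by rewrite Ea a0 fracE.
  by move/eqP: E; rewrite a0 mul0r expf_eq0 => /eqP.
have [sa|sa] := leqP (size a) 3; first by case: (resolvent_poly a0 sa).
exfalso.
have E3 : a ^+ 3 = q ^+ 2 - (2 *: p) * a ^+ 2 - (p ^+ 2 - 4 *: r) * a.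
  by rewrite E -!mul_polyC !polyC_natr; ring.
have : (size (a ^+ 3) <= (2 * size a).+1)%N.
  rewrite E3 !size_sub_leq //.
  - by rewrite (leq_trans (size_mul_le sq sq (leqnn _))) //; lia.
  - by apply: (size_mul_le (size_scale_le _ sp) (leqnn _)); rewrite size_exp_nat //; lia.
  apply: (@size_mul_le _ _ 5 _ _ _ (leqnn _)); last by lia.
  by rewrite size_sub_leq ?size_scale_le //; apply: (size_mul_le sp sp).
by rewrite size_exp_nat //; lia.
Qed.

End Resolvent.

(** * Roots of the quartic in the extension of degree four *)

Section QuarticField.

Variable K : closedFieldType.
Hypothesis charK0 : [pchar K] =i pred0.
Local Notation R := {poly K}.
Local Notation k := {fraction R}.
Local Notation "x %:F" := (tofrac x : k).

Variables p q r : R.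
Hypotheses (sp : (size p <= 3)%N) (sq : (size q <= 4)%N) (sr : (size r <= 5)%N).
Hypothesis Hns : nonsingular p q r.

Lemma natk_unit n : (0 < n)%N -> (n%:R : k) != 0.
Proof.
move=> n0; rewrite -(rmorph_nat (@tofrac R)) tofrac_eq0 -(rmorph_nat (@polyC K)).
by rewrite polyC_eq0 char0_nat_neq0.
Qed.

Definition dquartic (S : nzRingType) (a b c : S) : {poly S} :=
  'X^4 + (a *: 'X^2 + b *: 'X + c%:P).

Lemma size_dquartic_tail (S : nzRingType) (a b c : S) :
  (size (a *: 'X^2 + b *: 'X + c%:P)%R <= 3)%N.
Proof.
rewrite (leq_trans (size_polyD _ _)) // geq_max (leq_trans (size_polyC_leq1 _)) // andbT.
rewrite (leq_trans (size_polyD _ _)) // geq_max !(leq_trans (size_scale_leq _ _)) ?size_polyXn //.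
by rewrite size_polyX.
Qed.

Lemma size_dquartic (S : nzRingType) (a b c : S) : size (dquartic a b c) = 5%N.
Proof. by rewrite size_polyDl size_polyXn // ltnS (leq_trans (size_dquartic_tail _ _ _)). Qed.

Lemma monic_dquartic (S : nzRingType) (a b c : S) : dquartic a b c \is monic.
Proof.
by rewrite monicE lead_coefDl ?lead_coefXn // size_polyXn ltnS (leq_trans (size_dquartic_tail _ _ _)).
Qed.

Lemma horner_dquartic (S : comNzRingType) (a b c x : S) :
  (dquartic a b c).[x] = x ^+ 4 + a * x ^+ 2 + b * x + c.
Proof. by rewrite /dquartic !(hornerD, hornerZ, hornerC, hornerXn, hornerX) !addrA. Qed.

Lemma map_dquartic (S S' : nzRingType) (phi : {rmorphism S -> S'}) (a b c : S) :
  map_poly phi (dquartic a b c) = dquartic (phi a) (phi b) (phi c).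
Proof.
by rewrite /dquartic !rmorphD /= !map_polyZ !map_polyXn map_polyX map_polyC.
Qed.

Definition generic_quartic : {poly k} := dquartic p%:F q%:F r%:F.

Lemma generic_quartic_no_root (t : k) : ~~ root generic_quartic t.
Proof.
apply/negP => /rootP; rewrite horner_dquartic => H.
exact: (quartic_no_root sp sq sr Hns H).
Qed.

(** The missing cubic term gives u' = - u. Then u^2 is a root of the resolvent, and for u = 0 the
    discriminant a^2 - 4 c is the square of v - v'. *)
Lemma quadratic_factors (S : comNzRingType) (a b c u v u' v' : S) :
  dquartic a b c = ('X^2 + u *: 'X + v%:P) * ('X^2 + u' *: 'X + v'%:P) ->
  (u ^+ 2) ^+ 3 + 2 * a * (u ^+ 2) ^+ 2 + (a ^+ 2 - 4 * c) * u ^+ 2 - b ^+ 2 = 0 /\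
  (v - v') ^+ 2 = a ^+ 2 - 4 * c + u ^+ 2 * (2 * a + u ^+ 2).
Proof.
move=> H.
have C i : (dquartic a b c)`_i = (('X^2 + u *: 'X + v%:P) * ('X^2 + u' *: 'X + v'%:P))`_i.
  by rewrite H.
have E : ('X^2 + u *: 'X + v%:P) * ('X^2 + u' *: 'X + v'%:P) =
  Poly [:: v * v'; u * v' + u' * v; v + v' + u * u'; u + u'; 1].
  rewrite /= !cons_poly_def mul0r add0r -!mul_polyC.
  rewrite !(polyCD, polyCM) polyC1; ring.
have D : dquartic a b c = Poly [:: c; b; a; 0; 1].
  by rewrite /dquartic /= !cons_poly_def mul0r add0r -!mul_polyC polyC1 polyC0; ring.
rewrite D E in C.
have := (C 0%N, C 1%N, C 2%N, C 3%N); rewrite !coef_Poly /= => -[[[-> ->] ->] C3].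
have -> : u' = - u by apply: (lincomb1 (c1 := -1) C3); ring.
by split; ring.
Qed.

Lemma generic_quartic_no_quadratic (u v u' v' : k) :
  dquartic p%:F q%:F r%:F <> ('X^2 + u *: 'X + v%:P) * ('X^2 + u' *: 'X + v'%:P).
Proof.
case/quadratic_factors=> /(resolvent_root charK0 sp sq sr Hns) [u2 q0].
rewrite u2 mul0r addr0; exact: (discr_not_square charK0 sp sq sr Hns q0).
Qed.

Lemma monic_quadratic (S : nzRingType) (g : {poly S}) : g \is monic -> size g = 3%N ->
  g = 'X^2 + g`_1 *: 'X + (g`_0)%:P.
Proof.
move=> /monicP mg sg; apply/polyP => i.
rewrite !coefD coefXn coefZ coefX coefC.
move: mg; rewrite /lead_coef sg /= => mg.
case: i => [|[|[|i]]] /=; rewrite ?mulr0 ?mulr1 ?add0r ?addr0 //.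
by rewrite nth_default // sg.
Qed.

Lemma root_dvd (S : fieldType) (a b : {poly S}) x : a %| b -> root a x -> root b x.
Proof. by move=> ab; rewrite -!dvdp_XsubCl => /dvdp_trans; apply. Qed.

Lemma generic_quartic_irreducible : irreducible_poly generic_quartic.
Proof.
have sf : size generic_quartic = 5%N := size_dquartic _ _ _.
have f0 : generic_quartic != 0 by rewrite -size_poly_gt0 sf.
split; first by rewrite sf.
move=> g sg1 gf.
have g0 : g != 0 by apply: contraNneq f0 => g0; move: gf; rewrite g0 dvd0p.
have sg : (size g <= 5)%N by rewrite -[X in (_ <= X)%N]sf dvdp_leq.
have no_linear (h : {poly k}) : size h = 2%N -> h %| generic_quartic -> False.
  move=> sh hf.
  have [x Hx] : exists x, root h x.
    by case: (@poly2_root _ h sh) => x Hx; exists x.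
  by apply: (negP (generic_quartic_no_root x)); apply: root_dvd hf Hx.
case/dvdpP: (gf) => h Eh.
have h0 : h != 0 by apply: contraNneq f0 => h0; rewrite Eh h0 mul0r.
have sgh : (size h + size g = 6)%N.
  by have := size_mul h0 g0; rewrite -Eh sf; case: (size h + size g)%N => //= n <-.
have hf : h %| generic_quartic by rewrite Eh dvdp_mulr.
have gt0 : (0 < size g)%N by rewrite size_poly_gt0.
have : (size g == 2%N) || (size g == 3%N) || (size g == 4%N) || (size g == 5%N).
  by move: sg1 sg gt0; case: (size g) => [|[|[|[|[|[|]]]]]].
case/orP=> [/orP[/orP[]|]|] /eqP s.
- by case: (no_linear g s gf).
- have sh : size h = 3%N by apply: (@addIn 3); rewrite -[X in (_ + X)%N]s.
  exfalso.
  pose g1 := (lead_coef g)^-1 *: g; pose h1 := lead_coef g *: h.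
  have lg : lead_coef g != 0 by rewrite lead_coef_eq0.
  have E1 : generic_quartic = h1 * g1.
    by rewrite /h1 /g1 -scalerAl -scalerAr scalerA divff // scale1r -Eh.
  have mg1 : g1 \is monic by rewrite monicE lead_coefZ mulVf.
  have mh1 : h1 \is monic.
    have := monic_dquartic p%:F q%:F r%:F; rewrite -/generic_quartic E1 !monicE lead_coefM.
    by rewrite (monicP mg1) mulr1.
  have sg1' : size g1 = 3%N by rewrite size_scale ?invr_eq0.
  have sh1' : size h1 = 3%N by rewrite size_scale.
  apply: (@generic_quartic_no_quadratic h1`_1 h1`_0 g1`_1 g1`_0).
  by rewrite -(monic_quadratic mg1 sg1') -(monic_quadratic mh1 sh1').
- by case: (no_linear h) => //; apply: (@addIn 4); rewrite -[X in (_ + X)%N]s.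
by rewrite -dvdp_size_eqp // s sf.
Qed.

Lemma two_root_resolvent (S : idomainType) (a b c x y : S) : y != x ->
  x ^+ 4 + a * x ^+ 2 + b * x + c = 0 -> y ^+ 4 + a * y ^+ 2 + b * y + c = 0 ->
  ((x + y) ^+ 2) ^+ 3 + 2 * a * ((x + y) ^+ 2) ^+ 2 + (a ^+ 2 - 4 * c) * (x + y) ^+ 2
    + - b ^+ 2 = 0.
Proof.
move=> yx Hx Hy.
have Eb : b = - ((x + y) * (x ^+ 2 + y ^+ 2) + a * (x + y)).
  apply: (mulfI (_ : y - x != 0)); first by rewrite subr_eq0.
  by apply: (lincomb2 (c1 := -1) (c2 := 1) Hx Hy); ring.
have Ec : c = - (x ^+ 4 + a * x ^+ 2 + b * x).
  by apply: (lincomb1 (c1 := 1) Hx); ring.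
by rewrite Ec Eb; ring.
Qed.

Variables (L : fieldExtType k) (z : L).
Local Notation iota := (in_alg L).
Hypothesis dimL : \dim {:L} = 4%N.
Hypothesis rootz : root (map_poly iota generic_quartic) z.
Hypothesis genz : <<1; z>>%VS = fullv.

Lemma map_generic_quartic : map_poly iota generic_quartic = dquartic (iota p%:F) (iota q%:F) (iota r%:F).
Proof. exact: map_dquartic. Qed.

Lemma rootz_eq : z ^+ 4 + iota p%:F * z ^+ 2 + iota q%:F * z + iota r%:F = 0.
Proof. by move/rootP: rootz; rewrite map_generic_quartic horner_dquartic. Qed.

Lemma small_root (g : {poly k}) : (size g <= 4)%N -> root (map_poly iota g) z -> g = 0.
Proof.
move=> sg Hg; apply/eqP; rewrite -(map_poly_eq0 iota).
have Hd : adjoin_degree 1 z = 4%N.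
  have := dim_Fadjoin 1 z; rewrite genz dimL dimv1 muln1.
  by [].
have : map_poly iota g \is a polyOver 1%VS by apply: alg_polyOver.
move=> Hover; have := minPoly_dvdp Hover Hg.
have [//|g0] := eqVneq (map_poly iota g) 0.
move=> /(dvdp_leq g0); by rewrite size_minPoly Hd size_map_poly ltnNge sg.
Qed.

(** The degree of [m] divides 4 and is at most 3, so it is 1 or 2; in the latter case the cofactor
    of the minimal polynomial is linear. *)
Lemma cubic_root_base (a b c : k) (m : L) :
  m ^+ 3 + iota a * m ^+ 2 + iota b * m + iota c = 0 ->
  exists x : k, x ^+ 3 + a * x ^+ 2 + b * x + c = 0.
Proof.
move=> H; pose g : {poly k} := 'X^3 + (a *: 'X^2 + b *: 'X + c%:P).
have Eg (S : comNzRingType) (phi : {rmorphism k -> S}) x : (map_poly phi g).[x] =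
    x ^+ 3 + phi a * x ^+ 2 + phi b * x + phi c.
  by rewrite /g !rmorphD /= !map_polyZ !map_polyXn map_polyX map_polyC !(hornerD, hornerZ, hornerC, hornerXn, hornerX) !addrA.
have sg : size g = 4%N.
  by rewrite size_polyDl size_polyXn // ltnS size_dquartic_tail.
have rg : root (map_poly iota g) m by apply/rootP; rewrite Eg.
have : minPoly 1 m \is a polyOver 1%VS := minPolyOver 1 m.
case/polyOver1P=> h Eh.
have hg : h %| g.
  by rewrite -(dvdp_map iota) -Eh; apply: minPoly_dvdp => //; apply: alg_polyOver.
have sh : size h = (adjoin_degree 1 m).+1.
  by rewrite -(size_minPoly 1 m) Eh size_map_poly.
have d4 : (adjoin_degree 1 m %| 4)%N.
  have := field_dimS (subvf <<1; m>>%AS); rewrite dimL /= dim_Fadjoin dimv1 muln1.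
  by [].
have Ek x : g.[x] = x ^+ 3 + a * x ^+ 2 + b * x + c.
  by rewrite /g !(hornerD, hornerZ, hornerC, hornerXn, hornerX) !addrA.
have g0 : g != 0 by rewrite -size_poly_gt0 sg.
have h0 : h != 0 by rewrite -size_poly_gt0 sh.
have root2 (s : {poly k}) : s %| g -> size s = 2%N -> exists x : k, x ^+ 3 + a * x ^+ 2 + b * x + c = 0.
  move=> sdg s2; case: (poly2_root s2) => x Hx; exists x.
  by rewrite -Ek; apply/rootP; apply: root_dvd sdg Hx.
have := dvdp_leq g0 hg; rewrite sg sh => hd.
have : (adjoin_degree 1 m == 1%N) || (adjoin_degree 1 m == 2%N).
  by move: d4 hd; case: (adjoin_degree 1 m) => [|[|[|[|]]]].
case/orP=> /eqP d; first by apply: (root2 h); rewrite // sh d.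
case/dvdpP: hg => s Es.
have s0 : s != 0 by apply: contraNneq g0 => s0; rewrite Es s0 mul0r.
apply: (root2 s); first by rewrite Es dvdp_mulr.
by have := size_mul s0 h0; rewrite -Es sg sh d addnC; case: (size s) => [|[|[|?]]].
Qed.

Lemma second_root (t : L) : t != z ->
  t ^+ 4 + iota p%:F * t ^+ 2 + iota q%:F * t + iota r%:F = 0 -> q = 0.
Proof.
move=> tz Ht; have Hres := two_root_resolvent tz rootz_eq Ht.
have i1 : iota (2 * p%:F) = 2 * iota p%:F by rewrite rmorphM rmorph_nat.
have i2 : iota (p%:F ^+ 2 - 4 * r%:F) = iota p%:F ^+ 2 - 4 * iota r%:F.
  by rewrite rmorphB rmorphXn rmorphM rmorph_nat.
have i3 : iota (- q%:F ^+ 2) = - iota q%:F ^+ 2 by rewrite rmorphN rmorphXn.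
rewrite -i1 -i2 -i3 in Hres.
by have [x /(resolvent_root charK0 sp sq sr Hns) []] := cubic_root_base Hres.
Qed.

(** The setting is y = a + b x + c x^2 + d x^3 with y^2 = Q and x^4 + P x^2 + Q = 0. The alternative
    says that y is odd or even in x, and the two equations are the coefficients of 1 and x^2. *)
Lemma biquadratic_sqrt (S : fieldType) (a b c d P Q : S) : (2 : S) != 0 -> Q != 0 ->
  (a = 0 /\ c = 0) \/ (b = 0 /\ d = 0) ->
  a * a - c * c * Q - (b * d + b * d) * Q + d * d * P * Q - Q = 0 ->
  (a * c + a * c) - c * c * P + b * b - (b * d + b * d) * P + d * d * (P * P - Q) = 0 ->
  (exists s, s ^+ 2 = Q) \/ (exists s, s ^+ 2 * (P ^+ 2 - 4 * Q) = 4 * Q).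
Proof.
move=> n2 Q0 [[-> ->]|[-> ->]] E0 E2.
  left; have E1 : d * d * P - (b * d + b * d) = 1.
    by apply: (mulIf Q0); apply: (lincomb1 (c1 := 1) E0); ring.
  have d0 : d != 0.
    by apply/eqP=> d0; move/eqP: E1; rewrite d0 !mulr0 mul0r addr0 subr0 eq_sym oner_eq0.
  (* [E2] reads d^2 Q = (b - d P)^2 and [E1] gives b = (d^2 P - 1) / (2 d); the witness is P - b /
     d. *)
  exists ((d ^+ 2 * P + 1) / (2 * d ^+ 2)).
  have nz : 4 * d ^+ 4 != 0.
    have -> : (4 : S) = 2 * 2 by ring.
    by rewrite !mulf_neq0 ?expf_neq0.
  apply: (mulfI nz).
  have -> : 4 * d ^+ 4 * ((d ^+ 2 * P + 1) / (2 * d ^+ 2)) ^+ 2 = (d ^+ 2 * P + 1) ^+ 2.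
    by field; rewrite d0 n2.
  by apply: (lincomb2 (c1 := - (3 * d ^+ 2 * P + 1 - 2 * b * d)) (c2 := 4 * d ^+ 2) E1 E2); ring.
have [c0|c0] := eqVneq c 0.
  by left; exists a; apply: (lincomb1 (c1 := 1) E0); rewrite c0; ring.
right; exists c.
have E3 : 2 * a = c * P.
  by apply: (mulfI c0); apply: (lincomb1 (c1 := 1) E2); ring.
by apply: (lincomb2 (c1 := - (2 * a + c * P)) (c2 := 4) E3 E0); ring.
Qed.

Lemma biquadratic_expand (S : comNzRingType) (a b c d P Q x : S) :
  (a + b * x + c * x ^+ 2 + d * x ^+ 3) ^+ 2 = Q -> x ^+ 4 + P * x ^+ 2 + Q = 0 ->
  a * a - c * c * Q - (b * d + b * d) * Q + d * d * P * Q - Q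
  + (a * b - c * d * Q + (a * b - c * d * Q)) * x
  + (a * c + a * c - c * c * P + b * b - (b * d + b * d) * P + d * d * (P * P - Q)) * x ^+ 2
  + (a * d + b * c - c * d * P + (a * d + b * c - c * d * P)) * x ^+ 3 = 0.
Proof.
move=> Ey Hx; apply: (lincomb2 (c1 := 1) (c2 := - (c ^+ 2 + 2 * b * d
  + d ^+ 2 * (x ^+ 2 - P) + 2 * c * d * x)) Ey Hx); ring.
Qed.

(** If t^2 differs from z^2, then t^2 + z^2 = - p and z t is a square root of r in L. Its square has
    no odd part in the basis 1, z, z^2, z^3, so the product of its even and odd parts vanishes and z
    t is even or odd in z. Either way r or r (p^2 - 4 r) becomes a square. *)
Lemma second_root_biquadratic (t : L) : q = 0 -> p != 0 ->
  t ^+ 4 + iota p%:F * t ^+ 2 + iota q%:F * t + iota r%:F = 0 -> t = z \/ t = - z.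
Proof.
move=> q0 p0; have := rootz_eq; rewrite q0 tofrac0 rmorph0 !mul0r !addr0 => Hz Ht.
have [/eqP|tz] := eqVneq (t ^+ 2) (z ^+ 2).
  by rewrite eqf_sqr => /orP[] /eqP; auto.
exfalso.
have r0 : r%:F != 0 by rewrite tofrac_eq0 (const_neq0 sp sq sr Hns q0).
have n2 : (2 : k) != 0 by apply: natk_unit.
have Et : t ^+ 2 + z ^+ 2 + iota p%:F = 0.
  apply: (mulfI (_ : t ^+ 2 - z ^+ 2 != 0)); first by rewrite subr_eq0.
  by apply: (lincomb2 (c1 := 1) (c2 := -1) Ht Hz); ring.
have Ey : (z * t) ^+ 2 = iota r%:F.
  by apply: (lincomb2 (c1 := z ^+ 2) (c2 := -1) Et Hz); ring.
have f0 : generic_quartic != 0 by rewrite -size_poly_gt0 size_dquartic.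
have [h sh Eh] : exists2 h : {poly k}, (size h <= 4)%N & z * t = (map_poly iota h).[z].
  have /Fadjoin1_polyP [h Eh] : z * t \in <<1; z>>%VS by rewrite genz memvf.
  exists (h %% generic_quartic); first by rewrite -ltnS -(size_dquartic p%:F q%:F r%:F) ltn_modp.
  rewrite Eh {1}(divp_eq h generic_quartic) rmorphD rmorphM hornerD hornerM.
  by rewrite (rootP rootz) mulr0 add0r.
have no_sqrt : ~ ((exists s, s ^+ 2 = r%:F) \/
    (exists s, s ^+ 2 * (p%:F ^+ 2 - 4 * r%:F) = 4 * r%:F)).
  case=> -[s Hs]; first exact: (const_not_square sp sq sr Hns q0 Hs).
  exact: (const_discr charK0 sp sq sr Hns q0 p0 Hs).
move: (p%:F) (r%:F) r0 no_sqrt Hz Ey => P Q Q0 no_sqrt Hz Ey.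
pose a := h`_0; pose b := h`_1; pose c := h`_2; pose d := h`_3.
have Ehz : z * t = iota a + iota b * z + iota c * z ^+ 2 + iota d * z ^+ 3.
  have smh : (size (map_poly iota h) <= 4)%N by rewrite size_map_poly.
  rewrite Eh (horner_coef_wide _ smh) !big_ord_recl big_ord0 !coef_map /=; ring.
have four0 (e0 e1 e2 e3 : k) :
    iota e0 + iota e1 * z + iota e2 * z ^+ 2 + iota e3 * z ^+ 3 = 0 ->
    [/\ e0 = 0, e1 = 0, e2 = 0 & e3 = 0].
  move=> H; pose g := Poly [:: e0; e1; e2; e3].
  have g0 : g = 0.
    apply: small_root; first exact: leq_trans (size_Poly _) _.
    apply/rootP; have smg : (size (map_poly iota g) <= 4)%N.
      by rewrite size_map_poly; apply: leq_trans (size_Poly _) _.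
    rewrite (horner_coef_wide _ smg) !big_ord_recl big_ord0 !coef_map !coef_Poly -[RHS]H /=.
    by ring.
  have C i : g`_i = 0 by rewrite g0 coef0.
  by have := (C 0%N, C 1%N, C 2%N, C 3%N); rewrite !coef_Poly /= => -[[[]]].
have iE := (rmorphB iota, rmorphD iota, rmorphM iota).
pose e0 := a * a - c * c * Q - (b * d + b * d) * Q + d * d * P * Q - Q.
pose e1 := a * b - c * d * Q.
pose e2 := (a * c + a * c) - c * c * P + b * b - (b * d + b * d) * P + d * d * (P * P - Q).
pose e3 := a * d + b * c - c * d * P.
have He : iota e0 + iota (e1 + e1) * z + iota e2 * z ^+ 2 + iota (e3 + e3) * z ^+ 3 = 0.
  by rewrite /e0 /e1 /e2 /e3 !iE; apply: biquadratic_expand Hz; rewrite -Ehz.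
case: (four0 _ _ _ _ He) => E0 E1 E2 E3.
have half0 x : x + x = 0 -> x = 0 :> k.
  by move=> H; apply: (mulfI n2); rewrite mulr0 -[RHS]H; ring.
have {}E1 := half0 _ E1; have {}E3 := half0 _ E3.
apply: no_sqrt; apply: (biquadratic_sqrt n2 Q0 _ E0 E2).
have Hprod : (iota a + iota c * z ^+ 2) * (iota b + iota d * z ^+ 2) == 0.
  have I1 : iota a * iota b - iota c * iota d * iota Q = 0.
    by rewrite -!iE -/e1 E1 rmorph0.
  have I3 : iota a * iota d + iota b * iota c - iota c * iota d * iota P = 0.
    by rewrite -!iE -/e3 E3 rmorph0.
  apply/eqP; apply: (lincomb3 (c1 := 1) (c2 := z ^+ 2) (c3 := iota c * iota d) I1 I3 Hz); ring.
move: Hprod; rewrite mulf_eq0 => /orP[] /eqP H.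
  left; have /four0 [-> _ -> _] : iota a + iota 0 * z + iota c * z ^+ 2 + iota 0 * z ^+ 3 = 0.
    by rewrite rmorph0 !mul0r !addr0.
  by [].
right; have /four0 [-> _ -> _] : iota b + iota 0 * z + iota d * z ^+ 2 + iota 0 * z ^+ 3 = 0.
  by rewrite rmorph0 !mul0r !addr0.
by [].
Qed.

End QuarticField.

(** * Polynomials vanishing on an affine chart of the curve *)

Section Chart.

Variable K : closedFieldType.
Hypothesis charK0 : [pchar K] =i pred0.
Local Notation R := {poly K}.
Local Notation k := {fraction R}.

Variables p q r : R.
Hypotheses (sp : (size p <= 3)%N) (sq : (size q <= 4)%N) (sr : (size r <= 5)%N).
Hypothesis Hns : nonsingular p q r.

Definition chart_quartic : {poly R} := dquartic p q r.

Definition at_pt (g : {poly R}) (x z : K) : K := g.[z%:P].[x].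

Lemma deriv_chart_quartic_neq0 : chart_quartic^`() != 0.
Proof.
apply/eqP => /(congr1 (fun g : {poly R} => g`_3)).
rewrite coef_deriv coef0 /chart_quartic /dquartic !coefD !coefZ coefXn coefX coefC /=.
rewrite coefXn /= !mulr0 !addr0 => /eqP.
by rewrite -(rmorph_nat (@polyC K)) polyC_eq0 (negbTE (char0_nat_neq0 charK0 _)).
Qed.

(** A common factor with the derivative would be, over K(x), a proper nonconstant factor of an
    irreducible quartic. *)
Lemma discr_neq0 : resultant chart_quartic chart_quartic^`() != 0.
Proof.
rewrite resultant_eq0 -leqNgt.
have sf : size chart_quartic = 5%N by apply: size_dquartic.
have d0 := deriv_chart_quartic_neq0.
set g := gcdp chart_quartic chart_quartic^`().
have gf' : (size g <= 4)%N.
  apply: leq_trans (leq_gcdpr _ d0) _.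
  by rewrite -ltnS -[X in (_ < X)%N]sf; apply: lt_size_deriv; rewrite -size_poly_gt0 sf.
have /Pdiv.Idomain.dvdpP [[c h] /= c0 E] : g %| chart_quartic by rewrite dvdp_gcdl.
rewrite leqNgt; apply/negP => g1.
have tofrac_inj0 (x : R) : x != 0 -> tofrac x != 0 :> k by rewrite tofrac_eq0.
have sg : size (map_poly (@tofrac R) g) = size g.
  apply: size_map_inj_poly; last exact: tofrac0.
  by move=> x y /eqP; rewrite tofrac_eq => /eqP.
have Ek : tofrac c *: generic_quartic p q r = map_poly (@tofrac R) h * map_poly (@tofrac R) g.
  rewrite -rmorphM -E.
  have -> : generic_quartic p q r = map_poly (@tofrac R) chart_quartic by rewrite map_dquartic.
  by rewrite -map_polyZ.
have gd : map_poly (@tofrac R) g %| generic_quartic p q r.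
  by rewrite -(dvdpZr _ _ (tofrac_inj0 _ c0)) Ek dvdp_mull.
have [_ irr] := generic_quartic_irreducible charK0 sp sq sr Hns.
have := irr _ _ gd; rewrite sg => /(_ _) H.
have : map_poly (@tofrac R) g %= generic_quartic p q r by apply: H; rewrite neq_ltn g1 orbT.
move/eqp_size; rewrite sg (size_dquartic (tofrac p : k)) => sg5.
by rewrite sg5 in gf'.
Qed.

(** The remainder [s] has degree at most 3 in z. Over each x off the zeros of the resultant the
    fibre has four distinct points, all zeros of [s], so every coefficient of [s] vanishes at almost
    all x. *)
Lemma chart_dvd (g : {poly R}) :
  (forall x z, at_pt chart_quartic x z = 0 -> at_pt g x z = 0) -> exists h, g = h * chart_quartic.
Proof.
move=> Hg.
have mf : chart_quartic \is monic := monic_dquartic _ _ _.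
have sf : size chart_quartic = 5%N by apply: size_dquartic.
exists (Pdiv.Ring.rdivp g chart_quartic).
rewrite {1}(Pdiv.RingMonic.rdivp_eq mf g).
set h := Pdiv.Ring.rdivp g chart_quartic; set s := Pdiv.Ring.rmodp g chart_quartic.
suff -> : s = 0 by rewrite addr0.
have ss : (size s < 5)%N by rewrite -sf Pdiv.Ring.ltn_rmodp monic_neq0.
have Hs x z : at_pt chart_quartic x z = 0 -> at_pt s x z = 0.
  move=> Hf; have := Hg x z Hf; rewrite {1}(Pdiv.RingMonic.rdivp_eq mf g) -/h -/s.
  by rewrite /at_pt hornerD hornerM hornerD hornerM -/(at_pt chart_quartic x z) Hf mulr0 add0r.
have sf' : (1 < size chart_quartic^`())%N.
  rewrite ltnNge; apply/negP => H.
  have : (chart_quartic^`())`_3 = 0 by rewrite nth_default // (leq_trans H).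
  rewrite coef_deriv /chart_quartic /dquartic !coefD !coefZ coefXn coefX coefC /=.
  rewrite coefXn /= !mulr0 !addr0 => /eqP.
  by rewrite -(rmorph_nat (@polyC K)) polyC_eq0 (negbTE (char0_nat_neq0 charK0 _)).
have sf1 : (1 < size chart_quartic)%N by rewrite sf.
have [[u v] _ E] := resultant_in_ideal sf1 sf'.
set c := resultant chart_quartic chart_quartic^`() in E.
have c0 : c != 0 := discr_neq0.
have root_s (x : K) : ~~ root c x -> forall i, root s`_i x.
  move=> cx i; pose sx := map_poly (horner_eval x) s; pose fx := map_poly (horner_eval x) chart_quartic.
  have sx0 : sx = 0.
    have [rs Ers] := closed_field_poly_normal fx.
    have mfx : fx \is monic by apply: monic_map.
    rewrite (monicP mfx) scale1r in Ers.
    have Ebez : map_poly (horner_eval x) u * fx + map_poly (horner_eval x) v * fx^`() = (c.[x])%:P.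
      by rewrite deriv_map -!rmorphM -rmorphD -E /= map_polyC.
    have urs : uniq rs.
      rewrite -separable_prod_XsubC -Ers unlock.
      apply/Bezout_coprimepP; exists (map_poly (horner_eval x) u, map_poly (horner_eval x) v).
      by rewrite /= Ebez -alg_polyC eqp_scale.
    have srs : size rs = 4%N.
      have : size fx = 5%N.
        by rewrite /fx size_map_poly_id0 ?sf // (monicP mf) rmorph1 oner_neq0.
      by rewrite Ers size_prod_XsubC => -[].
    apply/eqP; apply: contraTT (ss) => sx0.
    have Hrs : all (root sx) rs.
      apply/allP => z Hz.
      have fz : root fx z by rewrite Ers root_prod_XsubC.
      have ev (g' : {poly R}) : (map_poly (horner_eval x) g').[z] = at_pt g' x z.
        by rewrite /at_pt -[z in LHS](hornerC z x) horner_map.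
      by rewrite /root ev Hs // -ev; apply/eqP.
    have := max_poly_roots sx0 Hrs urs; rewrite srs -leqNgt => H.
    by apply: leq_trans H (size_poly _ _).
  by have := congr1 (fun s' : {poly K} => s'`_i) sx0; rewrite coef_map coef0 => /eqP.
apply/polyP => i; rewrite coef0; apply/eqP; apply: contraT => si0.
have sic0 : s`_i * c != 0 by rewrite mulf_neq0.
have [x Hx] : exists x : K, ~~ root (s`_i * c) x.
  have := max_poly_roots sic0.
  (* In characteristic zero these integers are distinct, and there are more of them than the
     polynomial can have roots. *)
  pose rs := [seq (j%:R : K) | j <- iota 0 (size (s`_i * c)%R)].
  have urs : uniq rs.
    rewrite map_inj_uniq ?iota_uniq // => i1 i2 /eqP.
    wlog le : i1 i2 / (i1 <= i2)%N => [H|].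
      by case/orP: (leq_total i1 i2) => le; [exact: H | rewrite eq_sym => /(H _ _ le)].
    rewrite eq_sym -subr_eq0 -natrB // => H0; apply/eqP; rewrite eqn_leq le -subn_eq0.
    by apply: contraLR H0 => H0; rewrite char0_nat_neq0 // lt0n.
  move=> /(_ rs); case: (boolP (all (root (s`_i * c)) rs)) => [_ /(_ isT urs)|].
    by rewrite size_map size_iota ltnn.
  by move=> /allPn [x _ Hx] _; exists x.
move: Hx; rewrite rootM negb_or => /andP[six cx].
by rewrite root_s in six.
Qed.

End Chart.

(** * The generic point and the Galois group at an outer point *)

Section ChartPolynomials.

Variables (K : closedFieldType) (F : {mpoly K[3]}).
Hypothesis charK0 : [pchar K] =i pred0.
Hypothesis smoothF : smooth_plane_curve 4 F.

Local Notation V := 'rV[K]_3.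
Local Notation Phi := (tensor F idfun).

Lemma smooth_homog : F \is 4.-homog. Proof. by case: smoothF. Qed.

Lemma Phi_quartic : quartic_tensor Phi.
Proof. exact: tensor_quartic. Qed.

Lemma Phi_eval (x : V) : Phi x x x x = F.@[x 0].
Proof. exact: (tensor_eval charK0 smooth_homog). Qed.

Lemma Phi_smooth (x : V) : x != 0 -> exists y, Phi x x x y != 0.
Proof.
move=> x0; have [Fx|Fx] := eqVneq (F.@[x 0]) 0; last first.
  by exists x; rewrite Phi_eval.
have [_ _ /(_ x x0 Fx) [i Hi]] := smoothF.
exists (delta_mx 0 i); apply: contraNneq Hi => H.
have := tensor_deriv charK0 smooth_homog idfun x i.
rewrite !(tens_sort Phi_quartic x (delta_mx 0 i)) in H *.
by rewrite -!(tens_sort Phi_quartic x (delta_mx 0 i)) in H *; rewrite /meval => <-; rewrite H mulr0.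
Qed.

Section Polynomials.

Variables v e0 e1 : V.

(* If [Phi v v v e0 = Phi v v v e1 = 0] and F(v) = 1, then
   F(x e0 + y e1 + z v) = z^4 + p z^2 + q z + r, where p, q, r are forms in x, y;
   they are represented by their dehomogenizations at y = 1. *)
Definition chart_p : {poly K} :=
  Poly [:: 6 * Phi v v e1 e1; 12 * Phi v v e0 e1; 6 * Phi v v e0 e0].
Definition chart_q : {poly K} :=
  Poly [:: 4 * Phi v e1 e1 e1; 12 * Phi v e0 e1 e1; 12 * Phi v e0 e0 e1; 4 * Phi v e0 e0 e0].
Definition chart_r : {poly K} :=
  Poly [:: Phi e1 e1 e1 e1; 4 * Phi e0 e1 e1 e1; 6 * Phi e0 e0 e1 e1; 4 * Phi e0 e0 e0 e1;
    Phi e0 e0 e0 e0].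

Hypotheses (Fv : Phi v v v v = 1) (l0 : Phi v v v e0 = 0) (l1 : Phi v v v e1 = 0).

Lemma size_chart_p : (size chart_p <= 3)%N. Proof. exact: leq_trans (size_Poly _) _. Qed.
Lemma size_chart_q : (size chart_q <= 4)%N. Proof. exact: leq_trans (size_Poly _) _. Qed.
Lemma size_chart_r : (size chart_r <= 5)%N. Proof. exact: leq_trans (size_Poly _) _. Qed.

Definition chart_point (S : comNzRingType) (iota : {rmorphism K -> S}) (x y z : S) : 'rV[S]_3 :=
  x *: map_mx iota e0 + y *: map_mx iota e1 + z *: map_mx iota v.

Lemma tensor_map (S : comNzRingType) (iota : {rmorphism K -> S}) (a b c d : V) :
  tensor F iota (map_mx iota a) (map_mx iota b) (map_mx iota c) (map_mx iota d) = iota (Phi a b c d).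
Proof. by rewrite (@tensor_rmorph _ _ _ _ idfun iota iota). Qed.

Lemma chart_tensor (S : comNzRingType) (iota : {rmorphism K -> S}) (x y z : S)
    (u := chart_point iota x y z) :
  tensor F iota u u u u = depressed iota chart_p chart_q chart_r x y z.
Proof.
have H := tensor_quartic F iota.
have Fv' := congr1 iota Fv; have l0' := congr1 iota l0; have l1' := congr1 iota l1.
rewrite -tensor_map rmorph1 in Fv'; rewrite -tensor_map rmorph0 in l0'; rewrite -tensor_map rmorph0 in l1'.
rewrite /u /chart_point /depressed /bform !big_ord_recl !big_ord0 !coef_Poly /=.
rewrite !(rmorphM iota) !rmorph_nat -!tensor_map.
move: (map_mx iota e0) (map_mx iota e1) (map_mx iota v) Fv' l0' l1' => a b c Fc la lb.
rewrite !(tens_lin H) !(tens_sort H c a, tens_sort H c b, tens_sort H a b) Fc la lb.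
ring.
Qed.

Lemma chart_eval (S : comNzRingType) (iota : {rmorphism K -> S}) (x y z : S) :
  mmap iota (chart_point iota x y z 0) F = depressed iota chart_p chart_q chart_r x y z.
Proof. by rewrite -chart_tensor (tensor_eval charK0 smooth_homog). Qed.

Hypothesis Hs : spanning v e0 e1.

(** A sum of two products of functions vanishing at 0 has zero derivative there, and along w + X w'
    this derivative is 4 Phi(w,w,w,w'). *)
Lemma chart_nonsingular : nonsingular chart_p chart_q chart_r.
Proof.
move=> x y z Hxyz.
have [x0|x0] := eqVneq (z *: v + x *: e0 + y *: e1) 0.
  by case: (spanning_free Hs x0).
exfalso; case: (Phi_smooth x0) => u; case: (Hs u) => c [a [b ->]].
set w := z *: v + _ + _; set w' := c *: v + _ + _ => Hw.
case: (Hxyz a b c) => A [B [C [D [A0 B0 C0 D0 E]]]].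
move/eqP: Hw; apply.
pose W : 'rV[{poly K}]_3 := map_mx polyC w + 'X *: map_mx polyC w'.
have EW : chart_point polyC (ray x a) (ray y b) (ray z c) = W.
  rewrite /chart_point /W /w /w' /ray; apply/rowP=> j; rewrite !mxE.
  by rewrite !(polyCD, polyCM); ring.
have H := tensor_quartic F polyC.
have : (tensor F polyC W W W W)^`().[0] = 0.
  rewrite -EW chart_tensor E derivD !derivM !hornerD !hornerM A0 B0 C0 D0; ring.
have -> : tensor F polyC W W W W = (Phi w w w w)%:P + (4 * Phi w w w w')%:P * 'X +
    'X^2 * ((6 * Phi w w w' w')%:P + (4 * Phi w w' w' w')%:P * 'X + (Phi w' w' w' w')%:P * 'X^2).
  rewrite !(polyCM, polyC_natr) -!tensor_map /W.
  move: (map_mx polyC w) (map_mx polyC w') => m m'.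
  by rewrite !(tens_lin H) !(tens_sort H m m'); ring.
rewrite expr2 !(derivD, derivM, derivX, derivC) !(hornerD, hornerM, hornerC, hornerX) => H0.
by apply: (mulfI (char0_succ_neq0 charK0 3)); rewrite mulr0 -[RHS]H0; ring.
Qed.

End Polynomials.

End ChartPolynomials.

Lemma mmap_rmorph n (A B C : comNzRingType) (iota : {rmorphism A -> B}) (phi : {rmorphism B -> C})
    (iota' : {rmorphism A -> C}) (h : 'I_n -> B) (h' : 'I_n -> C) (G : {mpoly A[n]}) :
  (forall a, iota' a = phi (iota a)) -> (forall i, h' i = phi (h i)) ->
  phi (mmap iota h G) = mmap iota' h' G.
Proof.
move=> Hi Hh; rewrite /mmap rmorph_sum; apply: eq_bigr => m _.
rewrite rmorphM -Hi; congr (_ * _); rewrite /mmap1 rmorph_prod.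
by apply: eq_bigr => i _; rewrite rmorphXn Hh.
Qed.

Lemma mmap_homog n (A B : comNzRingType) (iota : {rmorphism A -> B}) (h : 'I_n -> B)
    (G : {mpoly A[n]}) d s : G \is d.-homog ->
  mmap iota (fun i => s * h i) G = s ^+ d * mmap iota h G.
Proof.
move=> HG; rewrite /mmap mulr_sumr; apply: eq_big_seq => m Hm.
have <- := dhomog_mf HG Hm; rewrite mulrCA; congr (_ * _).
rewrite /mmap1 /= mdegE -prodrXr -big_split /=; apply: eq_bigr => i _.
by rewrite exprMn.
Qed.

Section GenericPoint.

Variables (K : closedFieldType) (F : {mpoly K[3]}).
Hypothesis charK0 : [pchar K] =i pred0.
Hypothesis smoothF : smooth_plane_curve 4 F.

Local Notation V := 'rV[K]_3.
Local Notation Phi := (tensor F idfun).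
Local Notation R := {poly K}.
Local Notation k := {fraction R}.

Section Chart.

Variables v e0 e1 : V.
Hypotheses (Fv : Phi v v v v = 1) (l0 : Phi v v v e0 = 0) (l1 : Phi v v v e1 = 0).
Hypothesis Hs : spanning v e0 e1.

Local Notation p := (chart_p F v e0 e1).
Local Notation q := (chart_q F v e0 e1).
Local Notation r := (chart_r F e0 e1).
Let sp := size_chart_p F v e0 e1.
Let sq := size_chart_q F v e0 e1.
Let sr := size_chart_r F e0 e1.
Let Hns := chart_nonsingular charK0 smoothF Fv l0 l1 Hs.

Definition iota1 : {rmorphism K -> {poly R}} := polyC \o polyC.
(** Dehomogenization at the point x e0 + e1 + z v, as a polynomial in z over K[x]. *)
Definition chart_form (G : {mpoly K[3]}) : {poly R} :=
  mmap iota1 (chart_point v e0 e1 iota1 'X%:P 1 'X 0) G.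
Definition eval_at (x z : K) : {rmorphism {poly R} -> K} := horner_eval x \o horner_eval z%:P.

Lemma at_pt_form (G : {mpoly K[3]}) x z :
  at_pt (chart_form G) x z = G.@[(x *: e0 + e1 + z *: v) 0].
Proof.
rewrite -[LHS]/(eval_at x z (chart_form G)) /chart_form /meval.
apply: mmap_rmorph => [a|i]; first by rewrite /= /horner_eval !hornerC.
rewrite /chart_point !mxE /= /horner_eval.
by rewrite !(hornerD, hornerM, hornerC, hornerX) mul1r.
Qed.

Lemma at_pt_chart_quartic x z : at_pt (chart_quartic p q r) x z = F.@[(x *: e0 + e1 + z *: v) 0].
Proof.
rewrite -(Phi_eval charK0 smoothF).
have := chart_tensor Fv l0 l1 idfun x 1 z.
have -> : chart_point v e0 e1 idfun x 1 z = x *: e0 + e1 + z *: v.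
  by rewrite /chart_point scale1r; congr (_ *: _ + _ + _ *: _); apply/rowP=> j; rewrite mxE.
move=> ->; rewrite /at_pt /chart_quartic /dquartic /depressed.
rewrite !(hornerD, hornerZ, hornerM, hornerC, hornerXn, hornerX, horner_exp) -!addrA.
have e (d : nat) (g : R) : (size g <= d.+1)%N -> bform idfun d g x 1 = g.[x].
  move=> sg; rewrite (horner_coef_wide _ sg) /bform; apply: eq_bigr => i _.
  by rewrite expr1n mulr1.
by rewrite !e.
Qed.

Lemma pt_neq0 x z : x *: e0 + e1 + z *: v != 0.
Proof.
apply/eqP=> H; case: (@spanning_free _ _ _ _ z x 1 Hs).
  by rewrite scale1r addrAC addrC [z *: v + _]addrC addrA.
by move=> _ _ /eqP; rewrite oner_eq0.
Qed.

Variables (L : fieldExtType k) (z0 : L).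
Hypothesis dimL : \dim {:L} = 4%N.
Hypothesis rootz : root (map_poly (in_alg L) (generic_quartic p q r)) z0.
Hypothesis genz : <<1; z0>>%VS = fullv.

Definition iotaL : {rmorphism K -> L} := in_alg L \o (@tofrac R \o polyC).
Definition XL : L := in_alg L (tofrac 'X).
(* The generic point of the curve: its first two coordinates are X and 1 and the
   third one generates the function field [L] over K(X). *)
Definition generic_point (t : L) : 'rV[L]_3 := chart_point v e0 e1 iotaL XL 1 t.
Definition generic_value (G : {mpoly K[3]}) : L := mmap iotaL (generic_point z0 0) G.
Definition phiL : {rmorphism {poly R} -> L} := horner_eval z0 \o map_poly (in_alg L \o @tofrac R).

Lemma phiLC a : phiL a%:P = in_alg L (tofrac a).
Proof. by rewrite /phiL /= /horner_eval map_polyC hornerC. Qed.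

Lemma phiLX : phiL 'X = z0.
Proof. by rewrite /phiL /= /horner_eval map_polyX hornerX. Qed.

Lemma phiL_form G : phiL (chart_form G) = generic_value G.
Proof.
rewrite /chart_form /generic_value; apply: mmap_rmorph => [a|i].
  by rewrite [RHS]phiLC.
rewrite /generic_point /chart_point !mxE !(rmorphD phiL) !(rmorphM phiL) phiLX (rmorph1 phiL).
by rewrite !phiLC.
Qed.

Lemma phiL_chart_quartic : phiL (chart_quartic p q r) = 0.
Proof.
rewrite /phiL /= /horner_eval map_poly_comp /chart_quartic map_dquartic.
exact: (rootP rootz).
Qed.

Lemma generic_of_vanish G : vanishes_on F G -> generic_value G = 0.
Proof.
move=> HG; rewrite -phiL_form.
have [x z|h ->] := chart_dvd charK0 sp sq sr Hns (g := chart_form G).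
  by rewrite at_pt_chart_quartic at_pt_form => Hx; apply: HG => //; apply: pt_neq0.
by rewrite rmorphM phiL_chart_quartic mulr0.
Qed.

(** Modulo the quartic, the form leaves a remainder of degree at most 3 in z that vanishes at [z0],
    an element of degree 4; so the remainder is zero. *)
Lemma chart_of_generic G x z : generic_value G = 0 ->
  F.@[(x *: e0 + e1 + z *: v) 0] = 0 -> G.@[(x *: e0 + e1 + z *: v) 0] = 0.
Proof.
move=> HG; rewrite -at_pt_chart_quartic -at_pt_form => Hf.
have mf : chart_quartic p q r \is monic := monic_dquartic _ _ _.
have sf : size (chart_quartic p q r) = 5%N := size_dquartic _ _ _.
move: HG; rewrite -phiL_form (Pdiv.RingMonic.rdivp_eq mf (chart_form G)).
set h := Pdiv.Ring.rdivp _ _; set s := Pdiv.Ring.rmodp _ _ => Hsum.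
have ss : (size s < 5)%N by rewrite -sf Pdiv.Ring.ltn_rmodp monic_neq0.
have Hs0 : phiL s = 0.
  by move: Hsum; rewrite (rmorphD phiL) (rmorphM phiL) phiL_chart_quartic mulr0 add0r.
have s0 : map_poly (@tofrac R) s = 0.
  apply: (small_root dimL genz); first exact: leq_trans (size_poly _ _) _.
  by apply/rootP; rewrite -map_poly_comp.
have -> : s = 0.
  apply/polyP=> i; have := congr1 (fun g : {poly k} => g`_i) s0.
  by rewrite coef_map !coef0 => /eqP; rewrite tofrac_eq0 => /eqP.
by rewrite addr0 /at_pt hornerM hornerM -/(at_pt (chart_quartic p q r) x z) Hf mulr0.
Qed.

End Chart.

(** Points with y nonzero are in the first chart. A curve point with y = 0 has x nonzero, as [v] is
    off the curve, and lies in the chart with [e0] and [e1] exchanged. There X times the form of G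
    vanishes on the curve and is divisible by the quartic, which is monic in z and therefore divides
    the form itself. *)
Lemma vanish_of_generic v e0 e1 (L : fieldExtType k) (z0 : L) d (G : {mpoly K[3]}) :
  Phi v v v v = 1 -> Phi v v v e0 = 0 -> Phi v v v e1 = 0 -> spanning v e0 e1 ->
  \dim {:L} = 4%N -> 
  root (map_poly (in_alg L) (generic_quartic (chart_p F v e0 e1) (chart_q F v e0 e1) (chart_r F e0 e1))) z0 ->
  <<1; z0>>%VS = fullv -> G \is d.-homog ->
  generic_value v e0 e1 z0 G = 0 -> vanishes_on F G.
Proof.
move=> Fv l0 l1 Hs dimL rootz genz HG Hgen.
have Hs' : spanning v e1 e0.
  by move=> y; case: (Hs y) => a [b [c ->]]; exists a, c, b; rewrite addrAC.
have homF := smooth_homog smoothF.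
have scale n (H : {mpoly K[3]}) s (u : V) : H \is n.-homog -> H.@[(s *: u) 0] = s ^+ n * H.@[u 0].
  move=> hH; rewrite -(mmap_homog idfun (u 0) s hH) /meval.
  by apply: mmap_rmorph (idfun : {rmorphism K -> K}) _ _ _ _ _ _ => // i; rewrite mxE.
have part1 a x y : y != 0 -> F.@[(a *: v + x *: e0 + y *: e1) 0] = 0 ->
    G.@[(a *: v + x *: e0 + y *: e1) 0] = 0.
  move=> y0.
  have -> : a *: v + x *: e0 + y *: e1 = y *: ((x / y) *: e0 + e1 + (a / y) *: v).
    by apply/rowP=> j; rewrite !mxE; field.
  rewrite !(scale _ _ _ _ homF) !(scale _ _ _ _ HG) => /eqP.
  rewrite mulf_eq0 expf_eq0 (negbTE y0) /= => /eqP /(chart_of_generic Fv l0 l1 dimL rootz genz Hgen) ->.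
  by rewrite mulr0.
move=> u u0 Fu; case: (Hs u) => a [x [y Eu]].
have [y0|y0] := eqVneq y 0; last by rewrite Eu part1 // -Eu.
have x0 : x != 0.
  apply: contraNneq u0 => x0; move: Fu; rewrite Eu x0 y0 !scale0r !addr0.
  rewrite (scale _ _ _ _ homF) -(Phi_eval charK0 smoothF) Fv mulr1 => /eqP.
  by rewrite expf_eq0 /= => /eqP ->; rewrite scale0r.
have Hns' := chart_nonsingular charK0 smoothF Fv l1 l0 Hs'.
have [x' z'|h Eh] := chart_dvd charK0 (size_chart_p F v e1 e0) (size_chart_q F v e1 e0)
    (size_chart_r F e1 e0) Hns' (g := ('X%:P) * chart_form v e1 e0 G).
  rewrite (at_pt_chart_quartic Fv l1 l0) => Hf.
  rewrite /at_pt hornerM hornerC hornerM hornerX -/(at_pt (chart_form v e1 e0 G) x' z') at_pt_form.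
  have [->|x'0] := eqVneq x' 0; first by rewrite mul0r.
  have E : x' *: e1 + e0 + z' *: v = z' *: v + 1 *: e0 + x' *: e1.
    by apply/rowP=> j; rewrite !mxE; ring.
  by rewrite E part1 ?mulr0 // -E.
set f' := chart_quartic _ _ _ in Eh.
have mf : f' \is monic := monic_dquartic _ _ _.
have sf : size f' = 5%N := size_dquartic _ _ _.
have E := Pdiv.RingMonic.rdivp_eq mf (chart_form v e1 e0 G).
set h' := Pdiv.Ring.rdivp _ _ in E; set s := Pdiv.Ring.rmodp _ _ in E.
have ss : (size s < 5)%N by rewrite -sf Pdiv.Ring.ltn_rmodp monic_neq0.
have Es : (h - 'X%:P * h') * f' = 'X%:P * s.
  by rewrite mulrBl -Eh E; ring.
have X0 : ('X%:P : {poly R}) != 0 by rewrite polyC_eq0 polyX_eq0.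
have s0 : s = 0.
  apply/eqP; apply: contraTT (ss) => s0; rewrite -leqNgt.
  have h0 : h - 'X%:P * h' != 0.
    by apply: contraNneq s0 => h0; move/eqP: Es; rewrite h0 mul0r eq_sym mulf_eq0 (negbTE X0).
  have := congr1 (fun g : {poly R} => size g) Es.
  rewrite size_Mmonic // sf size_mul // size_polyC polyX_eq0 add1n.
  have := size_poly_gt0 (h - 'X%:P * h'); rewrite h0.
  by case: (size _) => // m _; rewrite addSn -!pred_Sn => <-; rewrite leq_addl.
have Eu' : u = x *: (0 *: e1 + e0 + (a / x) *: v).
  by rewrite Eu y0; apply/rowP=> j; rewrite !mxE; field.
move: Fu; rewrite Eu' (scale _ _ _ _ homF) (scale _ _ _ _ HG) => /eqP.
rewrite mulf_eq0 expf_eq0 (negbTE x0) /= => /eqP.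
rewrite -(at_pt_chart_quartic Fv l1 l0) -at_pt_form => Hf.
by rewrite E s0 addr0 /at_pt hornerM hornerM -/(at_pt f' 0 (a / x)) Hf !mulr0.
Qed.

End GenericPoint.

Section LinearForms.

Variable A : comNzRingType.

Definition lform (c : 'I_3 -> A) : {mpoly A[3]} := \sum_i c i *: 'X_i.

Lemma lform_homog c : lform c \is 1.-homog.
Proof.
rewrite rpred_sum // => i _; rewrite rpredZ //.
by rewrite dhomogX /= mdeg1.
Qed.

Lemma mmap_lform (B : comNzRingType) (iota : {rmorphism A -> B}) h c :
  mmap iota h (lform c) = \sum_i iota (c i) * h i.
Proof.
rewrite raddf_sum; apply: eq_bigr => i _ /=.
by rewrite mmapZ mmapX mmap1U.
Qed.

Lemma mmap_comp n (B : comNzRingType) (iota : {rmorphism A -> B}) (h : 'I_3 -> B)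
    (tau : n.-tuple {mpoly A[3]}) (G : {mpoly A[n]}) :
  mmap iota h (G \mPo tau) = mmap iota (fun i => mmap iota h (tnth tau i)) G.
Proof.
rewrite /comp_mpoly.
apply: (@mmap_rmorph n A {mpoly A[3]} B (mpolyC 3 (R := A)) (mmap iota h) iota) => // a.
by rewrite /= mmapC.
Qed.

Lemma mmap_ext n (B : comNzRingType) (f : {rmorphism A -> B}) (h h' : 'I_n -> B) (G : {mpoly A[n]}) :
  h =1 h' -> mmap f h G = mmap f h' G.
Proof.
move=> E; apply: (mmap_rmorph (phi := idfun : {rmorphism B -> B})) => // i.
by rewrite E.
Qed.

Lemma mmap_minor n (B : comNzRingType) (f : {rmorphism A -> B}) (h : 'I_n -> B) (a b c d : {mpoly A[n]}) :
  mmap f h (a * b - c * d) = mmap f h a * mmap f h b - mmap f h c * mmap f h d.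
Proof. by rewrite raddfB /= !rmorphM. Qed.

End LinearForms.

Section GaloisSet.

Variables (K : closedFieldType) (F : {mpoly K[3]}).
Hypothesis charK0 : [pchar K] =i pred0.
Hypothesis smoothF : smooth_plane_curve 4 F.

Local Notation V := 'rV[K]_3.
Local Notation Phi := (tensor F idfun).
Local Notation R := {poly K}.
Local Notation k := {fraction R}.

Variables v e0 e1 : V.
Hypotheses (Fv : Phi v v v v = 1) (l0 : Phi v v v e0 = 0) (l1 : Phi v v v e1 = 0).
Hypothesis Hs : spanning v e0 e1.

Local Notation p := (chart_p F v e0 e1).
Local Notation q := (chart_q F v e0 e1).
Local Notation r := (chart_r F e0 e1).

Variables (L : fieldExtType k) (z0 : L).
Hypothesis dimL : \dim {:L} = 4%N.
Hypothesis rootz : root (map_poly (in_alg L) (generic_quartic p q r)) z0.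
Hypothesis genz : <<1; z0>>%VS = fullv.

Local Notation iotaL := (@iotaL K L).
Local Notation XL := (@XL K L).
Local Notation gpt := (@generic_point K v e0 e1 L).
Local Notation gval := (@generic_value K v e0 e1 L z0).
Local Notation iota := (in_alg L).

(** Column j holds the coefficients of the j-th coordinate form for the basis e0, e1, v; columns 0
    and 1 define the projection from [v]. *)
Definition coords : 'M[K]_3 := invmx (rows3 e0 e1 v).

Lemma rows_unit : rows3 e0 e1 v \in unitmx.
Proof.
apply: spanning_unit => y; case: (Hs y) => a [b [c ->]]; exists b, c, a.
by rewrite -addrA addrC.
Qed.

Lemma coords_decomp (w : V) (x := w *m coords) :
  w = x 0 0 *: e0 + x 0 1 *: e1 + x 0 (2 : 'I_3) *: v.
Proof. by rewrite -mul_rows3 /x mulmxKV // rows_unit. Qed.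

Lemma coords_rows (a b c : K) :
  (a *: e0 + b *: e1 + c *: v) *m coords = row3 a b c.
Proof. by rewrite -mul_row3 mulmxK // rows_unit. Qed.

Definition coordL (T : 'rV[L]_3) j : L := (T *m map_mx iotaL coords) 0 j.

Lemma map_rows3 :
  map_mx iotaL (rows3 e0 e1 v) = rows3 (map_mx iotaL e0) (map_mx iotaL e1) (map_mx iotaL v).
Proof. by apply/matrixP=> i j; rewrite !mxE; case: ifP => // _; case: ifP. Qed.

Lemma coordL_decomp (T : 'rV[L]_3) :
  T = chart_point v e0 e1 iotaL (coordL T 0) (coordL T 1) (coordL T (2 : 'I_3)).
Proof.
rewrite /chart_point /coordL -mul_rows3 -map_rows3 -mulmxA -map_mxM mulVmx ?rows_unit //.
by rewrite map_mx1 mulmx1.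
Qed.

Lemma coordL_point (a b c : L) (T := chart_point v e0 e1 iotaL a b c) :
  [/\ coordL T 0 = a, coordL T 1 = b & coordL T (2 : 'I_3) = c].
Proof.
rewrite /coordL /T /chart_point -mul_row3 -map_rows3 -mulmxA -map_mxM mulmxV ?rows_unit //.
by rewrite map_mx1 mulmx1 !mxE.
Qed.

Definition proj_forms : 2.-tuple {mpoly K[3]} :=
  [tuple lform (fun i => coords i 0); lform (fun i => coords i 1)].

Lemma lform_coord (T : 'rV[L]_3) j :
  mmap iotaL (T 0) (lform (fun i => coords i j)) = coordL T j.
Proof.
rewrite mmap_lform /coordL !mxE; apply: eq_bigr => i _.
by rewrite !mxE mulrC.
Qed.

Lemma proj_formsP : projection_from <[v]>%VS proj_forms.
Proof.
split=> [[[|[|//]] Hi]|w]; [exact: lform_homog|exact: lform_homog|].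
have E j : (lform (fun i => coords i j)).@[w 0] = (w *m coords) 0 j.
  by rewrite /meval mmap_lform !mxE; apply: eq_bigr => i _; rewrite mulrC.
split=> [/vlineP [c Ew]|H].
  have Ec : w *m coords = row3 0 0 c by rewrite -coords_rows !scale0r !add0r Ew.
  by move=> [[|[|//]] Hi]; rewrite (tnth_nth 0) /= E Ec !mxE.
have := H 0; have := H 1; rewrite !(tnth_nth 0) /= !E => H1 H0.
by rewrite [w]coords_decomp H0 H1 !scale0r !add0r memvZ ?memv_line.
Qed.

Definition generic_root (t : L) : Prop :=
  t ^+ 4 + iota (tofrac p) * t ^+ 2 + iota (tofrac q) * t + iota (tofrac r) = 0.

Lemma bform_generic d (g : R) : (size g <= d.+1)%N -> bform iotaL d g XL 1 = iota (tofrac g).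
Proof.
move=> sg; rewrite /bform.
have {2}-> : g = \sum_(i < d.+1) (g`_i)%:P * 'X^i.
  rewrite -{1}[g]coefK (poly_def (size g)).
  rewrite (big_ord_widen d.+1 (fun i : nat => g`_i *: 'X^i) sg) big_mkcond /=.
  apply: eq_bigr => i _; case: ltnP => [_|hi]; first by rewrite mul_polyC.
  by rewrite nth_default // mul0r.
rewrite !rmorph_sum; apply: eq_bigr => i _.
by rewrite expr1n mulr1 (rmorphM (@tofrac R)) (rmorphM iota) !rmorphXn.
Qed.

Lemma bform00 d (g : R) : (0 < d)%N -> bform iotaL d g 0 0 = 0.
Proof.
move=> d0; rewrite /bform big1 // => i _; rewrite -mulrA -exprD subnKC -1?ltnS //.
by rewrite expr0n (gtn_eqF d0) mulr0.
Qed.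

Lemma generic_eval (t : L) : mmap iotaL (gpt t 0) F =
  t ^+ 4 + iota (tofrac p) * t ^+ 2 + iota (tofrac q) * t + iota (tofrac r).
Proof.
rewrite /generic_point chart_eval // /depressed !bform_generic //.
- exact: size_chart_r.
- exact: size_chart_q.
- exact: size_chart_p.
Qed.

(* A birational map commuting with the projection from [v] moves the generic
   point within its fibre, i.e. replaces the coordinate [z0] by another root [t]
   of the generic quartic. *)
Definition generic_image (tau : 3.-tuple {mpoly K[3]}) (t : L) : Prop :=
  exists2 mu : L, mu != 0 & forall i, gval (tnth tau i) = mu * gpt t 0 i.

(** The image of the generic point is on the curve and its first two coordinates are again in the
    ratio X : 1. The factor mu is nonzero: otherwise the image is c v with c^4 = 0, and all forms of
    [tau] vanish on the curve. *)
Lemma galois_generic_image tau : galois_set F <[v]> tau ->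
  exists2 t, generic_image tau t & generic_root t.
Proof.
case=> [[[[[d homt] [i0 Hi0]] HF] _] /(_ _ proj_formsP) [_ Hproj]].
pose T : 'rV[L]_3 := \row_i gval (tnth tau i).
have ET i : gval (tnth tau i) = T 0 i by rewrite mxE.
have Fgen : mmap iotaL (T 0) F = 0.
  have := generic_of_vanish charK0 smoothF Fv l0 l1 Hs rootz HF.
  rewrite /generic_value mmap_comp => H; rewrite -[RHS]H.
  by apply: mmap_ext => i; rewrite -ET.
have := generic_of_vanish charK0 smoothF Fv l0 l1 Hs rootz (Hproj 0 1).
rewrite /generic_value mmap_minor !tnth_mktuple !(tnth_nth 0) /= !mmap_comp.
have lT j : mmap iotaL (fun i => gval (tnth tau i)) (lform (fun i => coords i j)) = coordL T j.
  by rewrite -lform_coord; apply: mmap_ext => i; rewrite -ET.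
rewrite !lT !lform_coord; case: (coordL_point XL 1 z0) => -> -> _.
rewrite mulr1 => /eqP; rewrite subr_eq0 => /eqP T01.
have Tdec := coordL_decomp T; move: Fgen; rewrite Tdec T01.
rewrite T01 in Tdec; set mu := coordL T 1 in Tdec *; set c2 := coordL T 2 in Tdec *.
move=> Fgen; have [mu0|mu0] := eqVneq mu 0.
  case: Hi0; apply: (vanish_of_generic charK0 smoothF Fv l0 l1 Hs dimL rootz genz (homt i0)).
  move: Fgen; rewrite chart_eval // mu0 mul0r /depressed !bform00 // !mul0r !addr0.
  move/eqP; rewrite expf_eq0 /= => /eqP c20.
  by rewrite ET Tdec mu0 c20 /chart_point !mul0r !scale0r !addr0 mxE.
exists (c2 / mu).
  exists mu => // i; rewrite ET Tdec /generic_point /chart_point !mxE; field.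
  by [].
rewrite /generic_root -generic_eval; apply: (mulfI (expf_neq0 4 mu0)).
rewrite mulr0 -[RHS]Fgen -(mmap_homog iotaL _ mu (smooth_homog smoothF)).
by apply: mmap_ext => i; rewrite /generic_point /chart_point !mxE /=; field.
Qed.

(** Maps agree on the curve exactly when their images of the generic point are proportional; as both
    have second coordinate 1, one minor compares the third coordinates. *)
Lemma eq_generic_image d d' tau tau' t t' :
  (forall i, tnth tau i \is d.-homog) -> (forall i, tnth tau' i \is d'.-homog) ->
  generic_image tau t -> generic_image tau' t' -> eq_ratmap F tau tau' <-> t = t'.
Proof.
move=> h h' [mu mu0 E] [mu' mu0' E']; split=> [H|tt' i j].
  have out : (gpt t)^T *m gpt t' = (gpt t')^T *m gpt t.
    apply/matrixP=> i j; rewrite !mxE !big_ord1 ![_^T _ _]mxE.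
    have := generic_of_vanish charK0 smoothF Fv l0 l1 Hs rootz (H i j).
    rewrite /generic_value mmap_minor -!/(gval _) !E !E' => /eqP.
    rewrite subr_eq0 => /eqP Hm; apply: (mulfI (mulf_neq0 mu0 mu0')).
    by move: Hm; move: (gpt t 0 i) (gpt t 0 j) (gpt t' 0 i) (gpt t' 0 j) => a b c e Hm; rewrite mulrACA Hm; ring.
  have := congr1 (fun M => ((map_mx iotaL coords)^T *m M *m map_mx iotaL coords) 1 (2 : 'I_3)) out.
  rewrite !mulmxA -!trmx_mul -!mulmxA ![((_ *m _)^T *m _) _ _]mxE !big_ord1 ![_^T _ _]mxE.
  rewrite -!/(coordL _ _); case: (coordL_point XL 1 t) => _ -> ->; case: (coordL_point XL 1 t') => _ -> ->.
  by rewrite !mul1r => ->.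
apply: (vanish_of_generic charK0 smoothF Fv l0 l1 Hs dimL rootz genz (d := d + d')).
  by rewrite rpredB // ?dhomogM // addnC dhomogM.
rewrite /generic_value mmap_minor -!/(gval _) !E !E' tt'; ring.
Qed.

End GaloisSet.

(** * Linear maps as birational self-maps of the curve *)

Section LinearMaps.

Variable K : fieldType.

Lemma meval_lform (c : 'I_3 -> K) (w : 'I_3 -> K) : (lform c).@[w] = \sum_i c i * w i.
Proof. exact: mmap_lform. Qed.

Lemma homog1_lform (G : {mpoly K[3]}) : G \is 1.-homog -> exists c, G = lform c.
Proof.
move=> hG; exists (fun i => G@_U_(i)); apply/mpolyP=> m.
rewrite /lform raddf_sum /=; under eq_bigr => i _ do rewrite mcoeffZ mcoeffX.
have [/mdeg1P [j /eqP ->]|m1] := boolP (mdeg m == 1%N).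
  rewrite (bigD1 j) //= eqxx mulr1 big1 ?addr0 // => i ij.
  by rewrite eq_mnm1 (negbTE ij) mulr0.
rewrite (dhomog_nemf_coeff hG m1) big1 // => i _.
by case: eqP => [E|]; rewrite ?mulr0 //; move: m1; rewrite -E /= mdeg1.
Qed.

Definition lin_forms (M : 'M[K]_3) : 3.-tuple {mpoly K[3]} :=
  [tuple lform (fun j => M j i) | i < 3].

Lemma lin_forms_homog M i : tnth (lin_forms M) i \is 1.-homog.
Proof. by rewrite tnth_mktuple lform_homog. Qed.

Lemma lin_forms_eval M (w : 'rV[K]_3) i : (tnth (lin_forms M) i).@[w 0] = (w *m M) 0 i.
Proof.
rewrite tnth_mktuple meval_lform !mxE.
by apply: eq_bigr => j _; rewrite mulrC.
Qed.

Lemma comp_homog1 (G : {mpoly K[3]}) (tau : 3.-tuple {mpoly K[3]}) :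
  G \is 1.-homog -> (forall i, tnth tau i \is 1.-homog) -> G \mPo tau \is 1.-homog.
Proof.
move=> /homog1_lform [c ->] ht; rewrite /lform raddf_sum rpred_sum //= => i _.
by rewrite linearZ /= comp_mpolyXU rpredZ // -tnth_nth.
Qed.

Lemma comp_lin_eval (G : {mpoly K[3]}) M (w : 'rV[K]_3) :
  (G \mPo lin_forms M).@[w 0] = G.@[(w *m M) 0].
Proof.
rewrite comp_mpoly_meval; apply: mmap_ext => i; exact: lin_forms_eval.
Qed.

Variable F : {mpoly K[3]}.
Hypothesis curve_pt : exists2 u : 'rV[K]_3, u != 0 & F.@[u 0] = 0.

Lemma lin_self_ratmap M : M \in unitmx -> (forall w : 'rV[K]_3, F.@[(w *m M) 0] = F.@[w 0]) ->
  self_ratmap F (lin_forms M).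
Proof.
move=> Mu HM; split; last by move=> w w0; rewrite comp_lin_eval HM.
split; first by exists 1%N; apply: lin_forms_homog.
case: curve_pt => u u0 Fu; have uM0 : u *m M != 0.
  by apply: contraNneq u0 => uM; rewrite -[u](mulmxK Mu) uM mul0mx.
case/rV0Pn: uM0 => i ui; exists i => /(_ u u0 Fu).
by rewrite lin_forms_eval => ui0; rewrite ui0 eqxx in ui.
Qed.

Lemma comp_lin_fixed n (phi psi : n.+1.-tuple {mpoly K[3]}) M :
  (forall i, tnth phi i \is 1.-homog) ->
  (forall i (w : 'rV[K]_3), (tnth phi i).@[(w *m M) 0] = (tnth psi i).@[w 0]) ->
  (exists i, ~ vanishes_on F (tnth psi i)) ->
  comp_ratmap_eq F phi (lin_forms M) psi.
Proof.
move=> hphi E [i0 Hi0].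
have Ec i (w : 'rV[K]_3) : (tnth (comp_forms phi (lin_forms M)) i).@[w 0] = (tnth psi i).@[w 0].
  by rewrite tnth_mktuple comp_lin_eval E.
split; last by move=> i j w w0 Fw; rewrite mevalB !mevalM !Ec mulrC subrr.
split; last by exists i0 => H; apply: Hi0 => w w0 Fw; rewrite -Ec H.
by exists 1%N => i; rewrite tnth_mktuple comp_homog1 //; apply: lin_forms_homog.
Qed.

(** A linear form vanishing at [v] is unchanged by M, because w M - w is a multiple of [v]. The
    projection is defined on the curve since [v] is not on it. *)
Lemma lin_galois_set (v : 'rV[K]_3) M : F.@[v 0] != 0 -> M \in unitmx ->
  (forall w : 'rV[K]_3, F.@[(w *m M) 0] = F.@[w 0]) ->
  (forall w : 'rV[K]_3, w *m M - w \in <[v]>%VS) -> F \is 4.-homog ->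
  galois_set F <[v]>%VS (lin_forms M).
Proof.
move=> Fv Mu HM Hv homF.
have HMV (w : 'rV[K]_3) : F.@[(w *m invmx M) 0] = F.@[w 0] by rewrite -[LHS]HM mulmxKV.
have MVu : invmx M \in unitmx by rewrite unitmx_inv.
have idE i (w : 'rV[K]_3) : (tnth (@id_forms K) i).@[w 0] = w 0 i.
  by rewrite tnth_mktuple mevalXU.
have idN : exists i, ~ vanishes_on F (tnth (@id_forms K) i).
  case: curve_pt => u u0 Fu; case/rV0Pn: (u0) => i ui; exists i => /(_ u u0 Fu).
  by rewrite idE => ui0; rewrite ui0 eqxx in ui.
split.
  split; first exact: lin_self_ratmap.
  exists (lin_forms (invmx M)); split; first exact: lin_self_ratmap.
    apply: comp_lin_fixed => // [i|i w]; first exact: lin_forms_homog.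
    by rewrite lin_forms_eval idE mulmxKV.
  apply: comp_lin_fixed => // [i|i w]; first exact: lin_forms_homog.
  by rewrite lin_forms_eval idE mulmxK.
move=> pi [hpi Hpi]; apply: comp_lin_fixed => // [i w|].
  case: (homog1_lform (hpi i)) => c Ec; have /vlineP [k Ek] := Hv w.
  have /Hpi /(_ i) : v \in <[v]>%VS by apply: memv_line.
  rewrite Ec !meval_lform => Hc.
  have -> : w *m M = w + k *: v by rewrite -Ek addrC subrK.
  under eq_bigr => j _ do rewrite !mxE mulrDr mulrCA.
  by rewrite big_split /= -mulr_sumr Hc mulr0 addr0.
case: curve_pt => u u0 Fu.
have [/eqP|/eqP /eqP Hu] := eqVneq (tnth pi 0).@[u 0] 0; last first.
  by exists 0 => /(_ u u0 Fu) H; rewrite H eqxx in Hu.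
have [/eqP|/eqP /eqP Hu] := eqVneq (tnth pi 1).@[u 0] 0; last first.
  by exists 1 => /(_ u u0 Fu) H; rewrite H eqxx in Hu.
move=> /eqP H1 /eqP H0; exfalso.
have /vlineP [k Ek] : u \in <[v]>%VS.
  by apply/Hpi => -[[|[|//]] Hi]; [rewrite -[RHS]H0|rewrite -[RHS]H1]; congr (tnth _ _).@[_]; apply/val_inj.
have k0 : k != 0 by apply: contraNneq u0 => k0; rewrite Ek k0 scale0r.
move: Fu; rewrite Ek.
have -> : F.@[(k *: v) 0] = k ^+ 4 * F.@[v 0].
  by rewrite /meval -(mmap_homog idfun (v 0) k homF); apply: mmap_ext => i; rewrite mxE.
by apply/eqP; rewrite mulf_neq0 ?expf_neq0.
Qed.

End LinearMaps.

Section GaloisOrder.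

Variables (K : closedFieldType) (F : {mpoly K[3]}).
Hypothesis charK0 : [pchar K] =i pred0.
Hypothesis smoothF : smooth_plane_curve 4 F.

Local Notation V := 'rV[K]_3.
Local Notation Phi := (tensor F idfun).

Let HPhi := Phi_quartic F.
Let lin := tens_lin HPhi.
Let srt := tens_sort HPhi.

Section Chart.

Variables v e0 e1 : V.
Hypotheses (Fv : Phi v v v v = 1) (l0 : Phi v v v e0 = 0) (l1 : Phi v v v e1 = 0).
Hypothesis Hs : spanning v e0 e1.

Local Notation p := (chart_p F v e0 e1).
Local Notation q := (chart_q F v e0 e1).
Local Notation r := (chart_r F e0 e1).

Lemma nat_mul_eq0 n (a : K) : n.+1%:R * a = 0 -> a = 0.
Proof. by move/eqP; rewrite mulf_eq0 (negbTE (char0_succ_neq0 charK0 _)) => /eqP. Qed.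

(** On the polar line of [v] the center condition reduces to Phi(v,x,y,z) = 0, and the coefficients
    of q are multiples of these values. *)
Lemma chart_q_center : q = 0 <-> center Phi v.
Proof.
split=> [q0|[_ H]]; last first.
  apply/polyP=> i; rewrite coef_Poly coef0.
  by case: i => [|[|[|[|i]]]] /=; rewrite ?nth_nil // H ?l0 ?l1; ring.
have c i : q`_i = 0 by rewrite q0 coef0.
have := c 0%N; have := c 1%N; have := c 2%N; have := c 3%N.
rewrite !coef_Poly /= => /nat_mul_eq0 A0 /nat_mul_eq0 A1 /nat_mul_eq0 A2 /nat_mul_eq0 A3.
split=> // x y z; case: (Hs x) => a [b [d ->]]; case: (Hs y) => a' [b' [d' ->]].
case: (Hs z) => a'' [b'' [d'' ->]].
rewrite !lin !(srt e0 e1, srt v e0, srt v e1) !(Fv, l0, l1, A0, A1, A2, A3); ring.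
Qed.

Lemma chart_p_galois : p = 0 <-> galois Phi v.
Proof.
split=> [p0|H]; last first.
  apply/polyP=> i; rewrite coef_Poly coef0.
  by case: i => [|[|[|i]]] /=; rewrite ?nth_nil // H // mulr0.
have c i : p`_i = 0 by rewrite p0 coef0.
have := c 0%N; have := c 1%N; have := c 2%N.
rewrite !coef_Poly /= => /nat_mul_eq0 A0 /nat_mul_eq0 A1 /nat_mul_eq0 A2.
move=> x y; case: (Hs x) => a [b [d ->]]; case: (Hs y) => a' [b' [d' ->]].
rewrite !lin !Fv !l0 !l1 !mulr0 !addr0 !mulr1 => -> ->.
rewrite !(srt e0 e1, srt v e0, srt v e1) !(Fv, l0, l1, A0, A1, A2); ring.
Qed.

Lemma curve_point : exists2 u : V, u != 0 & F.@[u 0] = 0.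
Proof.
pose P (i : nat) : K := if i == 0%N then - r.[0] else if i == 1%N then - q.[0] else
  if i == 2%N then - p.[0] else 0.
case: (@solve_monicpoly K 4 P isT) => z.
rewrite !big_ord_recl big_ord0 /P /= => Hz.
exists (0 *: e0 + e1 + z *: v); first exact: pt_neq0.
rewrite -(at_pt_chart_quartic charK0 smoothF Fv l0 l1) /at_pt /chart_quartic horner_dquartic !(hornerD, horner_exp, hornerM).
by rewrite hornerC Hz; ring.
Qed.

(** The matrix diag(1, 1, c) in the basis e0, e1, v, acting on row vectors. *)
Definition homology (c : K) : 'M[K]_3 := coords v e0 e1 *m rows3 e0 e1 (c *: v).

Lemma homology_rows c : rows3 e0 e1 v *m homology c = rows3 e0 e1 (c *: v).
Proof. by rewrite /homology mulmxA mulmxV ?mul1mx // rows_unit. Qed.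

Lemma homology_chart c (x y z : K) :
  (x *: e0 + y *: e1 + z *: v) *m homology c = x *: e0 + y *: e1 + (c * z) *: v.
Proof.
by rewrite -mul_row3 -mulmxA homology_rows mul_row3 scalerA mulrC.
Qed.

Lemma chart_coord (w : V) : exists x y z : K, w = x *: e0 + y *: e1 + z *: v.
Proof. by rewrite [w](coords_decomp Hs); do 3!eexists. Qed.

Lemma homology_unit c : c != 0 -> homology c \in unitmx.
Proof.
move=> c0; have : homology c *m homology c^-1 = 1%:M.
  apply/row_matrixP=> i; rewrite !rowE mulmxA.
  case: (chart_coord (delta_mx 0 i)) => x [y [z ->]].
  by rewrite !homology_chart mulrA mulVf // mul1r mulmx1.
by case/mulmx1_unit.
Qed.

Lemma eval_chart (x y z : K) : F.@[(x *: e0 + y *: e1 + z *: v) 0] =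
  z ^+ 4 + bform idfun 2 p x y * z ^+ 2 + bform idfun 3 q x y * z + bform idfun 4 r x y.
Proof.
rewrite -/(depressed idfun p q r x y z) -(chart_eval charK0 smoothF Fv l0 l1) /meval.
apply: mmap_ext => i; rewrite /chart_point.
by have e (u : V) : map_mx idfun u = u; [apply/rowP=> j; rewrite mxE|rewrite !e].
Qed.

Lemma homology_galois_set c : c ^+ 4 = 1 -> c ^+ 2 *: p = p -> c *: q = q ->
  galois_set F <[v]>%VS (lin_forms (homology c)).
Proof.
move=> c4 cp cq.
have c0 : c != 0 by apply: contra_eq_neq c4 => ->; rewrite expr0n eq_sym oner_eq0.
apply: lin_galois_set; [exact: curve_point| | exact: homology_unit | | | exact: (smooth_homog smoothF)].
- by rewrite -(Phi_eval charK0 smoothF) Fv oner_eq0.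
- move=> w; case: (chart_coord w) => x [y [z ->]].
  rewrite homology_chart !eval_chart -{2}cp -{2}cq !formZ exprMn c4 /=; ring.
move=> w; case: (chart_coord w) => x [y [z ->]].
have -> : (x *: e0 + y *: e1 + z *: v) *m homology c - (x *: e0 + y *: e1 + z *: v) = (c * z - z) *: v.
  by rewrite homology_chart; apply/rowP=> j; rewrite !mxE; ring.
by rewrite memvZ ?memv_line.
Qed.

Local Notation k := {fraction {poly K}}.
Variables (L : fieldExtType k) (z0 : L).
Hypothesis dimL : \dim {:L} = 4%N.
Hypothesis rootz : root (map_poly (in_alg L) (generic_quartic p q r)) z0.
Hypothesis genz : <<1; z0>>%VS = fullv.

Lemma homology_image c : generic_image v e0 e1 z0 (lin_forms (homology c)) (iotaL L c * z0).
Proof.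
exists 1; rewrite ?oner_eq0 // => i; rewrite mul1r /generic_value tnth_mktuple mmap_lform.
set T := generic_point v e0 e1 z0.
have E : T *m map_mx (iotaL L) (homology c) = generic_point v e0 e1 (iotaL L c * z0).
  rewrite /T /generic_point /chart_point -mul_row3 -map_rows3 -mulmxA -map_mxM homology_rows map_rows3 mul_row3.
  by rewrite map_mxZ scalerA [z0 * _]mulrC.
by rewrite -E mxE; apply: eq_bigr => j _; rewrite [map_mx _ _ _ _]mxE mulrC.
Qed.

Lemma gen_neq0 : z0 != 0.
Proof.
apply/eqP=> z00; have := small_root dimL genz (g := 'X); rewrite size_polyX => /(_ isT).
rewrite map_polyX rootX z00 eqxx => /(_ isT) /eqP.
by rewrite polyX_eq0.
Qed.

Lemma iotaL_inj : injective (iotaL L).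
Proof. exact: fmorph_inj. Qed.

Lemma galois_eqE tau tau' t t' : galois_set F <[v]>%VS tau -> galois_set F <[v]>%VS tau' ->
  generic_image v e0 e1 z0 tau t -> generic_image v e0 e1 z0 tau' t' ->
  eq_ratmap F tau tau' <-> t = t'.
Proof.
case=> [[[[[d hd] _] _] _] _] [[[[[d' hd'] _] _] _] _].
exact: (eq_generic_image charK0 smoothF Fv l0 l1 Hs dimL rootz genz hd hd').
Qed.

Let sp := size_chart_p F v e0 e1.
Let sq := size_chart_q F v e0 e1.
Let sr := size_chart_r F e0 e1.
Let Hns := chart_nonsingular charK0 smoothF Fv l0 l1 Hs.

(** Two classes give two roots in L, one of them different from [z0], whence q = 0. If also p = 0,
    the homologies with factors 1, -1 and a square root of -1 would be three distinct classes. *)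
Lemma galois_order2_q : galois_order F <[v]>%VS 2 -> q = 0 /\ p <> 0.
Proof.
case=> x [Hx Hinj Hsurj].
have im i := galois_generic_image charK0 smoothF Fv l0 l1 Hs dimL rootz genz (Hx i).
case: (im 0) => t0 E0 G0; case: (im 1) => t1 E1 G1.
have t01 : t0 <> t1.
  by move=> t01; have /(galois_eqE (Hx 0) (Hx 1) E0 E1) /Hinj := t01.
have q0 : q = 0.
  have [tz|tz] := eqVneq t0 z0.
    by apply: (second_root charK0 sp sq sr Hns dimL rootz _ G1); apply/eqP=> tz1; apply: t01; rewrite tz.
  exact: (second_root charK0 sp sq sr Hns dimL rootz tz G0).
split=> // p0.
have im2 c : c ^+ 4 = 1 -> iotaL L c * z0 = t0 \/ iotaL L c * z0 = t1.
  move=> c4; have Hc : galois_set F <[v]>%VS (lin_forms (homology c)).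
    by apply: homology_galois_set; rewrite // ?p0 ?q0 scaler0.
  case: (Hsurj _ Hc) => -[[|[|//]] Hi] Heq; [left|right].
    have : eq_ratmap F (x 0) (lin_forms (homology c)) by congr (eq_ratmap F (x _) _): Heq; apply/val_inj.
    by move/(galois_eqE (Hx 0) Hc E0 (homology_image c)).
  have : eq_ratmap F (x 1) (lin_forms (homology c)) by congr (eq_ratmap F (x _) _): Heq; apply/val_inj.
  by move/(galois_eqE (Hx 1) Hc E1 (homology_image c)).
have scl a b : iotaL L a * z0 = iotaL L b * z0 -> a = b.
  by move/(mulIf gen_neq0)/iotaL_inj.
case: (@closed_root K 2 (-1) isT) => i i2.
have i4 : i ^+ 4 = 1 by rewrite (exprM i 2 2) i2; ring.
have n4 : (-1) ^+ 4 = 1 :> K by ring.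
have d1 : i <> 1 by move=> E; move: i2; rewrite E expr1n => /eqP; rewrite -addr_eq0 (negbTE (char0_succ_neq0 charK0 1)).
have d2 : i <> -1 by move=> E; move: i2; rewrite E sqrrN expr1n => /eqP; rewrite -addr_eq0 (negbTE (char0_succ_neq0 charK0 1)).
have d3 : 1 <> -1 :> K by move/eqP; rewrite -addr_eq0 (negbTE (char0_succ_neq0 charK0 1)).
have := im2 _ (expr1n K 4); have := im2 _ i4; have := im2 _ n4.
by move=> [] A [] B [] C; first [case: d1; apply: scl; rewrite B C; done | case: d2; apply: scl; rewrite B A; done | case: d3; apply: scl; rewrite C A; done].
Qed.

Lemma galois_order2_of : q = 0 -> p <> 0 -> galois_order F <[v]>%VS 2.
Proof.
move=> q0 p0.
have Hc c : c ^+ 2 = 1 -> galois_set F <[v]>%VS (lin_forms (homology c)).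
  move=> c2; apply: homology_galois_set; rewrite ?c2 ?scale1r ?q0 ?scaler0 //.
  by rewrite (exprM c 2 2) c2 expr1n.
have n2 : (-1) ^+ 2 = 1 :> K by ring.
have d3 : 1 <> -1 :> K by move/eqP; rewrite -addr_eq0 (negbTE (char0_succ_neq0 charK0 1)).
have scl a b : iotaL L a * z0 = iotaL L b * z0 -> a = b.
  by move/(mulIf gen_neq0)/iotaL_inj.
pose c (i : 'I_2) : K := if (i : nat) == 0%N then 1 else -1.
have c2 i : c i ^+ 2 = 1 by rewrite /c; case: ifP => _ //; rewrite expr1n.
exists (fun i => lin_forms (homology (c i))); split=> [i|i j|y Hy]; first exact: Hc.
  move/(galois_eqE (Hc _ (c2 i)) (Hc _ (c2 j)) (homology_image _) (homology_image _))/scl.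
  case: i j => [[|[|//]] Hi] [[|[|//]] Hj]; rewrite /c /= => E; apply/val_inj => //=.
  by case: d3.
case: (galois_generic_image charK0 smoothF Fv l0 l1 Hs dimL rootz genz Hy) => t Ey Gt.
have p0' : p != 0 by apply/eqP.
have Ht i : iotaL L (c i) * z0 = t -> exists i : 'I_2, eq_ratmap F (lin_forms (homology (c i))) y.
  by exists i; apply/(galois_eqE (Hc _ (c2 i)) Hy (homology_image _) Ey).
case: (second_root_biquadratic charK0 sp sq sr Hns dimL rootz genz q0 p0' Gt) => E.
  by apply: (Ht 0); rewrite (_ : c 0 = 1) // rmorph1 mul1r E.
by apply: (Ht 1); rewrite (_ : c 1 = -1) // rmorphN1 mulN1r E.
Qed.

End Chart.

End GaloisOrder.

(** * Counting the outer quasi-Galois points *)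

Section Counting.

Variables (T : eqType) (A : T -> Prop).

(** The predicate [A] is not decidable, so [l] is filtered by excluded middle. *)
Lemma enumerate_covered (l : seq T) : (forall x, A x -> x \in l) ->
  exists2 s, uniq s & forall x, x \in s <-> A x.
Proof.
move=> Hl; have [s us Hs] : exists2 s, uniq s & forall x, x \in s <-> A x /\ x \in l.
  elim: l {Hl} => [|a l [s us Hs]]; first by exists [::] => // x; split=> // -[].
  case: (classic (A a /\ a \notin s)) => [[Aa as0]|Ha].
    exists (a :: s) => /= [|x]; first by rewrite as0.
    rewrite !inE; split=> [/orP[/eqP ->|/Hs [Ax ->]]|[Ax /orP[-> //|xl]]].
    - by rewrite eqxx.
    - by rewrite orbT.
    - by rewrite (proj2 (Hs x)) ?orbT.
  exists s => // x; rewrite inE; split=> [/Hs [Ax ->]|[Ax /orP[/eqP xa|xl]]]; first by rewrite orbT.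
    by apply/negP=> /negP xs; apply: Ha; rewrite -xa.
  exact/Hs.
by exists s => // x; split=> [/Hs []|Ax] //; apply/Hs; split=> //; apply: Hl.
Qed.

Lemma card_mod_uniq (s : seq T) : uniq s -> (forall x, x \in s <-> A x) -> card_mod eq A (size s).
Proof.
move=> us Hs; exists (tnth (in_tuple s)); split=> [i|i j|x /Hs xs].
- by apply/Hs; rewrite mem_tnth.
- by move: i j; apply/tuple_uniqP.
- by case/tnthP: (xs : x \in in_tuple s) => i ->; exists i.
Qed.

Lemma card_mod_ge (s : seq T) n : uniq s -> (forall x, x \in s -> A x) ->
  card_mod eq A n -> (size s <= n)%N.
Proof.
move=> us Hs [f [_ _ Hf]]; rewrite -[n]card_ord -(size_codom f).
apply: uniq_leq_size => // x /Hs /Hf [i <-]; exact: codom_f.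
Qed.

Lemma card_mod_le (s : seq T) n : (forall x, A x -> x \in s) -> card_mod eq A n -> (n <= size s)%N.
Proof.
move=> Hs [f [Af If _]]; rewrite -[n]card_ord -(size_codom f).
apply: uniq_leq_size => [|x /codomP [i ->]]; last exact/Hs.
by apply/injectiveP=> i j /If.
Qed.

End Counting.

Section SameZeros.

Variable K : fieldType.

(** Projective equivalence yields equality of zero sets only. Outer points and their groups depend
    on nothing else, so the two forms need not be shown proportional. *)
Definition same_zeros (F G : {mpoly K[3]}) : Prop :=
  forall v : 'rV[K]_3, F.@[v 0] = 0 <-> G.@[v 0] = 0.

Variables F G : {mpoly K[3]}.
Hypothesis FG : same_zeros F G.

Lemma same_vanishes_on H : vanishes_on F H <-> vanishes_on G H.
Proof. by split=> HH v v0 /FG /HH; apply. Qed.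

Lemma same_ratmap n (phi : n.+1.-tuple {mpoly K[3]}) : ratmap F phi <-> ratmap G phi.
Proof.
by split=> -[hd [i Hi]]; split=> //; exists i => H; apply: Hi; apply/same_vanishes_on.
Qed.

Lemma same_eq_ratmap n (phi psi : n.+1.-tuple {mpoly K[3]}) : eq_ratmap F phi psi <-> eq_ratmap G phi psi.
Proof. by split=> H i j; apply/same_vanishes_on. Qed.

Lemma same_self_ratmap tau : self_ratmap F tau <-> self_ratmap G tau.
Proof.
have E H (v : 'rV[K]_3) : (H \mPo tau).@[v 0] = H.@[(\row_i (tnth tau i).@[v 0]) 0].
  by rewrite comp_mpoly_meval; apply: mmap_ext => i; rewrite mxE.
split=> -[Hr Hv]; split; first exact/same_ratmap.
- by move=> v v0 /FG /Hv; rewrite !E => /(_ v0) /FG.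
- exact/same_ratmap.
- by move=> v v0 /FG /Hv; rewrite !E => /(_ v0) /FG.
Qed.

Lemma same_comp_ratmap n (phi : n.+1.-tuple {mpoly K[3]}) tau psi :
  comp_ratmap_eq F phi tau psi <-> comp_ratmap_eq G phi tau psi.
Proof.
by split=> -[Hr Hv]; split; first [exact/same_ratmap|exact/same_eq_ratmap].
Qed.

Lemma same_galois_set P tau : galois_set F P tau <-> galois_set G P tau.
Proof.
split=> -[[Hs [sigma [H1 H2 H3]]] Hp]; (split; [split; [exact/same_self_ratmap|exists sigma; split]|]);
  try (by apply/same_self_ratmap); try (by apply/same_comp_ratmap);
  by move=> pi /Hp /same_comp_ratmap.
Qed.

Lemma same_galois_order P m : galois_order F P m <-> galois_order G P m.
Proof.
split=> -[x [H1 H2 H3]]; exists x; split=> [i|i j|y].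
- exact/same_galois_set.
- by move/same_eq_ratmap/H2.
- by move/same_galois_set/H3 => [i Hi]; exists i; apply/same_eq_ratmap.
- exact/same_galois_set.
- by move/same_eq_ratmap/H2.
- by move/same_galois_set/H3 => [i Hi]; exists i; apply/same_eq_ratmap.
Qed.

Lemma same_on_curve P : on_curve F P <-> on_curve G P.
Proof. by split=> H v /H /FG. Qed.

End SameZeros.

Section OuterPoints.

Variables (K : closedFieldType) (F : {mpoly K[3]}).
Hypothesis charK0 : [pchar K] =i pred0.
Hypothesis smoothF : smooth_plane_curve 4 F.

Local Notation V := 'rV[K]_3.
Local Notation Phi := (tensor F idfun).

Let HPhi := Phi_quartic F.
Let Psm := Phi_smooth charK0 smoothF.
Let PhiE := Phi_eval charK0 smoothF.

Lemma galois_order2E (v : V) : Phi v v v v = 1 ->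
  galois_order F <[v]>%VS 2 <-> center Phi v /\ ~ galois Phi v.
Proof.
move=> Fv; case: (polar_basis HPhi Fv) => e0 [e1 [l0 l1 Hs]].
have Hns := chart_nonsingular charK0 smoothF Fv l0 l1 Hs.
case: (irredp_FAdjoin (generic_quartic_irreducible charK0 (size_chart_p F v e0 e1)
  (size_chart_q F v e0 e1) (size_chart_r F e0 e1) Hns)) => L dimL [z rootz genz].
have {}dimL : \dim {:L} = 4%N by rewrite dimL /generic_quartic size_dquartic.
rewrite -(chart_q_center charK0 Fv l0 l1 Hs) -(chart_p_galois charK0 Fv l0 l1 Hs).
split=> [|[q0 p0]].
  exact: (galois_order2_q charK0 smoothF Fv l0 l1 Hs dimL rootz genz).
exact: (galois_order2_of charK0 smoothF Fv l0 l1 Hs dimL rootz genz).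
Qed.

Definition outer_point (P : {vspace V}) : Prop :=
  [/\ is_point P, ~ on_curve F P, (2 <= 2)%N & galois_order F P 2].

Lemma outer_pointP P :
  outer_point P <-> exists v, [/\ P = <[v]>%VS, center Phi v & ~ galois Phi v].
Proof.
split=> [[dP /not_all_ex_not [w Hw] _ HG]|[v [-> Cv Gv]]].
  have [wP Fw] := imply_to_and _ _ Hw.
  have w0 : w != 0.
    by apply/eqP=> w0; apply: Fw; rewrite w0 -PhiE (tens0 HPhi).
  (* A fourth root scales the representative to F = 1, as [center] demands. *)
  have [k Hk] := @closed_root K 4 (F.@[w 0])^-1 isT.
  have k0 : k != 0.
    by apply: contra_eq_neq Hk => ->; rewrite expr0n eq_sym invr_eq0; apply/eqP.
  have EP : P = <[k *: w]>%VS.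
    apply/esym/eqP; rewrite eqEdim dP dim_vline scaler_eq0 negb_or k0 w0 andbT.
    by rewrite -memvE memvZ.
  have Fkw : Phi (k *: w) (k *: w) (k *: w) (k *: w) = 1.
    have Fw0 : F.@[w 0] != 0 by apply/eqP.
    by rewrite !(tens_lin HPhi) PhiE -[RHS](mulVf Fw0) -Hk; ring.
  exists (k *: w); rewrite -EP; split=> //; move: HG; rewrite EP => /(galois_order2E Fkw) [] //.
have v0 := center_nz HPhi Cv; have Fv := proj1 Cv; split=> //.
- by rewrite /is_point dim_vline v0.
- by move=> /(_ v (memv_line v)); rewrite -PhiE Fv => /eqP; rewrite oner_eq0.
- exact/galois_order2E.
Qed.

Lemma outer_quasi_center y : quasi_center Phi y <-> y != 0 /\ outer_point <[y]>%VS.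
Proof.
split=> [[k [Ck Gk]]|[y0 /outer_pointP [v [Ev Cv Gv]]]].
  have := center_nz HPhi Ck; rewrite scaler_eq0 negb_or => /andP [k0 y0]; split=> //.
  apply/outer_pointP; exists (k *: y); split=> //.
  by apply/esym/eqP; rewrite eqEdim !dim_vline scaler_eq0 negb_or k0 y0 leqnn andbT -memvE memvZ ?memv_line.
have /vlineP [k Ek] : v \in <[y]>%VS by rewrite Ev memv_line.
by exists k; rewrite -Ek.
Qed.

End OuterPoints.

Section OuterCount.

Variables (K : closedFieldType) (F : {mpoly K[3]}).
Hypothesis charK0 : [pchar K] =i pred0.
Hypothesis smoothF : smooth_plane_curve 4 F.

Local Notation V := 'rV[K]_3.
Local Notation Phi := (tensor F idfun).

Let HPhi := Phi_quartic F.
Let Psm := Phi_smooth charK0 smoothF.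
Let PhiE := Phi_eval charK0 smoothF.

Lemma outer_cover (l : seq V) :
  (forall c, center Phi c -> ~ galois Phi c -> exists2 y, y \in l & exists k, c = k *: y) ->
  forall P, outer_point F P -> P \in [seq <[y]>%VS | y <- l].
Proof.
move=> Hl P /(outer_pointP charK0 smoothF) [v [-> Cv Gv]].
case: (Hl v Cv Gv) => y yl [k Ek]; apply/mapP; exists y => //.
apply/eqP; rewrite eqEdim !dim_vline (center_nz HPhi Cv) leq_b1 andbT.
by rewrite -memvE Ek memvZ ?memv_line.
Qed.

(** With exactly 21 outer points, the 21 candidates of any frame all occur, in particular the head w
    + eta r of the list. This is the hypothesis on all frames under which [klein_frame_exists]
    works. *)
Lemma outer_count : exists n, [/\ card_mod eq (outer_point F) n, (n <= 21)%N
  & n = 21%N -> exists v w r b, klein_frame Phi v w r b].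
Proof.
have small (l : seq V) : (size l < 21)%N ->
    (forall c, center Phi c -> ~ galois Phi c -> exists2 y, y \in l & exists k, c = k *: y) ->
    exists n, [/\ card_mod eq (outer_point F) n, (n <= 21)%N
      & n = 21%N -> exists v w r b, klein_frame Phi v w r b].
  move=> sl /outer_cover Hl; case: (enumerate_covered Hl) => s us Hs.
  have Hn := card_mod_uniq us Hs; exists (size s).
  have := leq_ltn_trans (card_mod_le Hl Hn); rewrite size_map => /(_ _ sl) s21.
  by split=> // [|E]; [exact: ltnW|rewrite E in s21].
case: (classic (exists v, center Phi v /\ galois Phi v)) => [[v [Cv Gv]]|NG].
  case: (cover_galois charK0 HPhi Psm Cv Gv) => l sl; apply: small.
  exact: leq_ltn_trans sl _.
have ng c : center Phi c -> ~ galois Phi c by move=> Cc Gc; apply: NG; exists c.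
case: (classic (exists v w r, frame Phi v w r)) => [[v [w [r Hfr]]]|NF]; last first.
  case: (classic (exists v, center Phi v)) => [[v Cv]|NC]; last first.
    by apply: (small [::]) => // c Cc; case: NC; exists c.
  have [|l sl Hl] := cover_isolated charK0 HPhi Psm Cv.
    move=> w Cw; apply/eqP=> vw; apply: NF.
    by case: (frame_third HPhi Psm Cv Cw vw) => r Hr; exists v, w, r.
  by apply: (small l) => [|c Cc _]; [rewrite sl|apply: Hl].
have cov v' w' r' : frame Phi v' w' r' -> exists2 eta : K, eta ^+ 4 = 1 & exists2 l : seq V,
    size l = 20%N & forall P, outer_point F P -> P \in [seq <[y]>%VS | y <- w' + eta *: r' :: l].
  move=> Hf; case: (cover_frame charK0 HPhi Psm ng Hf) => eta e4 [l sl Hl].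
  by exists eta => //; exists l => //; apply: outer_cover => c Cc _; apply: Hl.
case: (cov _ _ _ Hfr) => eta e4 [l sl Hl]; case: (enumerate_covered Hl) => s us Hs.
have Hn := card_mod_uniq us Hs; exists (size s); split=> //.
  by have := card_mod_le Hl Hn; rewrite /= size_map sl.
move=> s21; apply: (klein_frame_exists charK0 HPhi Psm ng _ Hfr) => v' w' r' Hfr'.
case: (cov _ _ _ Hfr') => eta' e4' [l' sl' Hl'].
have sub : {subset s <= [seq <[y]>%VS | y <- w' + eta' *: r' :: l']} by move=> P /Hs /Hl'.
have := (uniq_min_size us sub); rewrite /= size_map sl' s21 => /(_ isT) [_ Es].
have /Hs /(outer_pointP charK0 smoothF) [c [Ec Cc _]] : <[w' + eta' *: r']>%VS \in s by rewrite Es inE eqxx.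
have /vlineP [k Ek] : c \in <[w' + eta' *: r']>%VS by rewrite Ec memv_line.
by exists eta', k; rewrite -Ek.
Qed.

End OuterCount.

(** * Curves projectively equivalent to the given quartics *)

Section KleinQuartic.

Variable K : closedFieldType.
Hypothesis charK0 : [pchar K] =i pred0.

Local Notation V := 'rV[K]_3.

(** The ring [S] is K for values and the polynomial ring for [klein_model]. *)
Definition klein_form (S : comNzRingType) (iota : K -> S) (a : K) (x y z : S) : S :=
  x ^+ 4 + y ^+ 4 + z ^+ 4 + iota a * (x ^+ 2 * y ^+ 2 + y ^+ 2 * z ^+ 2 + z ^+ 2 * x ^+ 2).

Lemma quartic_form_eval (a : K) (x : V) :
  (quartic_form a).@[x 0] = klein_form idfun a (x 0 0) (x 0 1) (x 0 (2 : 'I_3)).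
Proof.
rewrite /quartic_form /klein_form.
by rewrite !(rmorphXn, mevalD, mevalZ, mevalM) /= !mevalXU.
Qed.

Lemma klein_equivalent (F : {mpoly K[3]}) v w r b : smooth_plane_curve 4 F ->
  klein_frame (tensor F idfun) v w r b ->
  exists2 a, a ^+ 2 + 3 * a + 18 = 0 & projectively_equivalent F (quartic_form a).
Proof.
move=> smoothF Hk; have Hf : frame (tensor F idfun) v w r by case: Hk.
have HPhi := Phi_quartic F.
have Mu := spanning_unit (frame_spanning HPhi Hf).
exists (6 * b); first by case: Hk.
exists (invmx (rows3 v w r)); first by rewrite unitmx_inv.
move=> x _; rewrite quartic_form_eval; set y := x *m _.
have -> : x = y 0 0 *: v + y 0 1 *: w + y 0 (2 : 'I_3) *: r.
  by rewrite -mul_rows3 /y mulmxKV.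
by rewrite -(Phi_eval charK0 smoothF) (klein_frameP HPhi _ _ _ Hk).
Qed.

Variables (a : K) (A : 'M[K]_3).
Hypotheses (Ha : a ^+ 2 + 3 * a + 18 = 0) (Au : A \in unitmx).

Lemma klein_coef_neq0 : [/\ 2 - a != 0, 2 + a != 0 & 1 + a != 0].
Proof.
have n0 n : (n.+1%:R : K) != 0 := char0_succ_neq0 charK0 n.
split; apply/eqP=> E.
- by case/eqP: (n0 27%N); apply: (lincomb2 (c1 := a + 5) (c2 := 1) E Ha); ring.
- by case/eqP: (n0 15%N); apply: (lincomb2 (c1 := - (a + 1)) (c2 := 1) E Ha); ring.
- by case/eqP: (n0 15%N); apply: (lincomb2 (c1 := - (a + 2)) (c2 := 1) E Ha); ring.
Qed.

(** If no coordinate vanishes, adding the equations gives (1 + a)(x^2 + y^2 + z^2) = 0 and then (2 -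
    a) x^2 = 0. If one vanishes, a linear system of determinant 4 - a^2 in the other two squares
    remains. *)
Lemma klein_critical (x y z : K) :
  x * (2 * x ^+ 2 + a * (y ^+ 2 + z ^+ 2)) = 0 ->
  y * (2 * y ^+ 2 + a * (z ^+ 2 + x ^+ 2)) = 0 ->
  z * (2 * z ^+ 2 + a * (x ^+ 2 + y ^+ 2)) = 0 -> [/\ x = 0, y = 0 & z = 0].
Proof.
case: klein_coef_neq0 => am ap a1.
have n2 : (2 : K) != 0 := char0_succ_neq0 charK0 1.
have two u v : u * (2 * u ^+ 2 + a * v ^+ 2) = 0 -> v * (2 * v ^+ 2 + a * u ^+ 2) = 0 ->
    u = 0 /\ v = 0.
  have [->|u0] := eqVneq u 0.
    move=> _; rewrite expr0n /= mulr0 addr0 => /eqP.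
    by rewrite !(mulf_eq0, expf_eq0) (negbTE n2) /= !orbb => /eqP.
  move/eqP; rewrite mulf_eq0 (negbTE u0) => /eqP Hu.
  have [v0|v0] := eqVneq v 0.
    move: Hu; rewrite v0 expr0n /= mulr0 addr0 => /eqP.
    by rewrite !(expf_eq0, mulf_eq0) (negbTE n2) !(negbTE u0).
  move/eqP; rewrite mulf_eq0 (negbTE v0) => /eqP Hv.
  have : (2 - a) * (2 + a) * u ^+ 2 = 0.
    by apply: (lincomb2 (c1 := 2) (c2 := - a) Hu Hv); ring.
  by move/eqP; rewrite !(expf_eq0, mulf_eq0) (negbTE am) (negbTE ap) !(negbTE u0).
have [->|x0] := eqVneq x 0.
  by rewrite expr0n /= ?add0r ?addr0 => _ Hy Hz; case: (two y z Hy Hz) => -> ->.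
have [->|y0] := eqVneq y 0.
  by rewrite expr0n /= ?add0r ?addr0 => Hx _ Hz; case: (two z x Hz Hx) => -> ->.
have [->|z0] := eqVneq z 0.
  by rewrite expr0n /= ?add0r ?addr0 => Hx Hy _; case: (two x y Hx Hy) => -> ->.
move=> /eqP; rewrite mulf_eq0 (negbTE x0) => /eqP Hx.
move=> /eqP; rewrite mulf_eq0 (negbTE y0) => /eqP Hy.
move=> /eqP; rewrite mulf_eq0 (negbTE z0) => /eqP Hz.
have : 2 * (1 + a) * (x ^+ 2 + y ^+ 2 + z ^+ 2) = 0.
  by apply: (lincomb3 (c1 := 1) (c2 := 1) (c3 := 1) Hx Hy Hz); ring.
move/eqP; rewrite !mulf_eq0 (negbTE n2) (negbTE a1) => /eqP S.
have : (2 - a) * x ^+ 2 = 0 by apply: (lincomb2 (c1 := 1) (c2 := - a) Hx S); ring.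
by move/eqP; rewrite !(expf_eq0, mulf_eq0) (negbTE am) !(negbTE x0).
Qed.

(** The pullback of [quartic_form a] by A. It has the zeros of F, but an explicit equation from
    which smoothness and centers can be computed. *)
Definition klein_model : {mpoly K[3]} :=
  klein_form (@mpolyC 3 K) a (tnth (lin_forms A) 0) (tnth (lin_forms A) 1) (tnth (lin_forms A) (2 : 'I_3)).

Lemma klein_model_eval (x : V) (y := x *m A) :
  klein_model.@[x 0] = klein_form idfun a (y 0 0) (y 0 1) (y 0 (2 : 'I_3)).
Proof.
rewrite /klein_model /klein_form.
by rewrite !(rmorphXn, mevalD, mevalM, mevalC) /= !lin_forms_eval.
Qed.

Lemma klein_model_smooth : smooth_plane_curve 4 klein_model.
Proof.
have homL i n : tnth (lin_forms A) i ^+ n \is n.-homog.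
  by rewrite -[X in X.-homog]mul1n dhomogMn // lin_forms_homog.
split.
- rewrite /klein_model /klein_form mul_mpolyC !(rpredD, rpredZ) //;
    exact: (dhomogM (homL _ _) (homL _ _)).
- apply/eqP=> G0; have := klein_model_eval (delta_mx 0 0 *m invmx A).
  rewrite G0 meval0 mulmxKV // /klein_form !mxE /= => /esym/eqP.
  by rewrite !expr1n !expr0n /= !(mulr0, mul0r, addr0) oner_eq0.
move=> x x0 _; apply: NNPP => Hx.
have [y Ey] : exists y, y = x *m A by exists (x *m A).
pose g (u v w : K) := 2 * (u * (2 * u ^+ 2 + a * (v ^+ 2 + w ^+ 2))).
have D i : klein_model^`M(i).@[x 0] = g (y 0 0) (y 0 1) (y 0 (2 : 'I_3)) * A i 0
    + g (y 0 1) (y 0 (2 : 'I_3)) (y 0 0) * A i 1 + g (y 0 (2 : 'I_3)) (y 0 0) (y 0 1) * A i (2 : 'I_3).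
  rewrite /klein_model /klein_form.
  have dl j : (tnth (lin_forms A) j)^`M(i) = (A i j)%:MP.
    rewrite tnth_mktuple /lform raddf_sum (bigD1 i) //= big1 => [|l li].
      by rewrite addr0 mderivZ mderivX mnm1E eqxx -[X in (X - _)%MM]add0m addmK scale1r -mul_mpolyC mpolyX0 mulr1.
    by rewrite mderivZ mderivX mnm1E (negbTE li) scale0r scaler0.
  rewrite !exprS !expr0 !mulr1 !(mderivD, mderivM, mderivC, dl).
  rewrite !(mevalD, mevalM, mevalC, meval0) !lin_forms_eval -Ey /g.
  ring.
pose G : V := row3 (g (y 0 0) (y 0 1) (y 0 (2 : 'I_3))) (g (y 0 1) (y 0 (2 : 'I_3)) (y 0 0))
  (g (y 0 (2 : 'I_3)) (y 0 0) (y 0 1)).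
(* The chain rule: the gradient in the old coordinates is the gradient in the new ones times the
   transpose of the invertible A. *)
have GA : G *m A^T = 0.
  apply/rowP=> i; rewrite !mxE !big_ord_recl big_ord0 !mxE /= addr0 addrA.
  have Di : klein_model^`M(i).@[x 0] = 0.
    by have [//|Hi] := eqVneq (klein_model^`M(i).@[x 0]) 0; case: Hx; exists i.
  rewrite -[RHS]Di D; congr (_ * A _ _ + _ * A _ _ + _ * A _ _); exact/val_inj.
have G0 : G = 0 by rewrite -[G](mulmxK (_ : A^T \in unitmx)) ?unitmx_tr // GA mul0mx.
have n2 : (2 : K) != 0 := char0_succ_neq0 charK0 1.
have /(congr1 (fun M : V => M 0 0)) := G0; have /(congr1 (fun M : V => M 0 1)) := G0.
have /(congr1 (fun M : V => M 0 (2 : 'I_3))) := G0.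
rewrite !mxE /= /g => /eqP; rewrite mulf_eq0 (negbTE n2) => /eqP E2.
move=> /eqP; rewrite mulf_eq0 (negbTE n2) => /eqP E1.
move=> /eqP; rewrite mulf_eq0 (negbTE n2) => /eqP E0.
case: (klein_critical E0 E1 E2) => y0 y1 y2.
have Y0 : y = 0 by apply: row3_eq; rewrite mxE.
by move/eqP: x0; apply; rewrite -[x](mulmxK Au) -Ey Y0 mul0mx.
Qed.


(** With F the diagonal of Psi, 6 F(x + y) - 2 F(x - y) - F(x + 2 y) equals 24 Psi(x,x,x,y) up to
    diagonal terms; the other entries follow by polarizing again. *)
Lemma tensor_diag_eq0 (Psi : V -> V -> V -> V -> K) : quartic_tensor Psi ->
  (forall x, Psi x x x x = 0) -> forall x y z t, Psi x y z t = 0.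
Proof.
move=> H D.
have nz n (c : K) : n.+1%:R * c = 0 -> c = 0 := @nat_mul_eq0 K charK0 n c.
have H3 x y : Psi x x x y = 0.
  have := D (x + y); have := D (x - y); have := D (x + 2 *: y).
  rewrite !(tens_lin H) !(tens_sort H x y) !D => E3 E2 E1; apply: (nz 23%N).
  by apply: (lincomb3 (c1 := 6) (c2 := -2) (c3 := -1) E1 E2 E3); ring.
have H2 x y z : Psi x x y z = 0.
  have := H3 (x - y) z; have := H3 (x + y) z.
  rewrite !(tens_lin H) !(tens_sort H x y) !H3 => E1 E2; apply: (nz 5%N).
  by apply: (lincomb2 (c1 := 1) (c2 := -1) E1 E2); ring.
move=> x y z t; have := H2 (x + y) z t.
rewrite !(tens_lin H) !(tens_sort H x y) !H2 => E; apply: (nz 1%N).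
by apply: (lincomb1 (c1 := 1) E); ring.
Qed.

Lemma tensor_diag_eq (Psi Psi' : V -> V -> V -> V -> K) : quartic_tensor Psi -> quartic_tensor Psi' ->
  (forall x, Psi x x x x = Psi' x x x x) -> forall x y z t, Psi x y z t = Psi' x y z t.
Proof.
move=> H H' E x y z t; apply/eqP; rewrite -subr_eq0; apply/eqP.
apply: (@tensor_diag_eq0 (fun x y z t => Psi x y z t - Psi' x y z t)) => [|u]; last by rewrite E subrr.
case: H H' => [h1 h2 h3 h4 h5] [h1' h2' h3' h4' h5'].
split=> *; first by rewrite h1 h1'; ring.
- by rewrite h2 h2'; ring.
- by rewrite h3 h3'.
- by rewrite h4 h4'.
- by rewrite h5 h5'.
Qed.

(** The polarization written by hand, with a / 6 because [mixed] polarizes 6 x^2 y^2. Uniqueness of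
    the polarization identifies it with [tensor], without computing fourth derivatives. *)
Definition klein_tensor (x y z t : V) : K :=
  let X := x *m A in let Y := y *m A in let Z := z *m A in let T := t *m A in
  let diag i := X 0 i * Y 0 i * Z 0 i * T 0 i in
  let mix i j := mixed (X 0 i) (Y 0 i) (Z 0 i) (T 0 i) (X 0 j) (Y 0 j) (Z 0 j) (T 0 j) in
  diag 0 + diag 1 + diag (2 : 'I_3) + a / 6 * (mix 0 1 + mix 0 (2 : 'I_3) + mix 1 (2 : 'I_3)).

Lemma klein_tensor_quartic : quartic_tensor klein_tensor.
Proof.
have D u u' i : ((u + u') *m A) 0 i = (u *m A) 0 i + (u' *m A) 0 i by rewrite mulmxDl mxE.
have Z c u i : ((c *: u) *m A) 0 i = c * (u *m A) 0 i by rewrite -scalemxAl mxE.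
by split=> *; rewrite /klein_tensor ?(D, Z) /mixed /=; ring.
Qed.

Lemma klein_model_tensor x y z t : tensor klein_model idfun x y z t = klein_tensor x y z t.
Proof.
apply: tensor_diag_eq => {x y z t} [||x]; [exact: Phi_quartic|exact: klein_tensor_quartic|].
rewrite (Phi_eval charK0 klein_model_smooth) klein_model_eval /klein_form /klein_tensor /mixed /=.
have n6 : (6 : K) != 0 := char0_succ_neq0 charK0 5.
by field.
Qed.

Lemma klein_model_frame : exists v w r b, klein_frame (tensor klein_model idfun) v w r b.
Proof.
pose e i := delta_mx 0 i *m invmx A : V.
have eA i j : (e i *m A) 0 j = (j == i)%:R by rewrite mulmxKV // mxE.
exists (e 0), (e 1), (e (2 : 'I_3)), (a / 6).
have n6 : (6 : K) != 0 := char0_succ_neq0 charK0 5.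
have cen i : center (tensor klein_model idfun) (e i).
  split=> [|x y z]; rewrite !klein_model_tensor /klein_tensor !eA /mixed.
    by case: i => [[|[|[|//]]] Hi]; rewrite /=; ring.
  by case: i => [[|[|[|//]]] Hi]; rewrite /=; field.
split; [split; split=> //|..]; rewrite ?klein_model_tensor /klein_tensor ?eA /mixed /=; try by field.
rewrite (_ : 6 * (a / 6) = a) //; by field.
Qed.

End KleinQuartic.

Theorem theorem6p9 (K : closedFieldType) (charK0 : [pchar K] =i pred0)
    (F : {mpoly K[3]}) (smoothF : smooth_plane_curve 4 F) :
  exists n : nat,
    [/\ outer_qgalois_number F 2 n,
        (n <= 21)%N
      & n = 21%N <->
        exists2 a : K, a ^+ 2 + 3 * a + 18 = 0
                     & projectively_equivalent F (quartic_form a)].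
Proof.
case: (outer_count charK0 smoothF) => n [Hn n21 Heq]; exists n; split=> //; split.
  by case/Heq => v [w [r [b Hk]]]; apply: (klein_equivalent charK0 smoothF Hk).
case=> a Ha [A Au HA].
have smoothG := klein_model_smooth charK0 Ha Au.
case: (klein_model_frame charK0 Ha Au) => v [w [r [b Hk]]].
case: (klein_centers charK0 (Phi_quartic _) Hk) => l [sl ul] [Hq Hl].
(* The equivalence concerns nonzero vectors; at the zero vector both quartic forms vanish. *)
have FG : same_zeros F (klein_model a A).
  move=> x; have [->|x0] := eqVneq x 0.
    have E0 (H : {mpoly K[3]}) : smooth_plane_curve 4 H -> H.@[(0 : 'rV[K]_3) 0] = 0.
      by move=> sH; rewrite -(Phi_eval charK0 sH) (tens0 (Phi_quartic H)).
    by rewrite !E0.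
  by rewrite (HA _ x0) quartic_form_eval klein_model_eval.
apply/eqP; rewrite eqn_leq n21 -sl -(size_map (fun y => <[y]>%VS)).
apply: (card_mod_ge _ _ Hn); first (rewrite map_inj_in_uniq //).
  move=> y z yl zl E; have /vlineP [k Ek] : y \in <[z]>%VS by rewrite -E memv_line.
  exact: (Hl y z k).
move=> P /mapP [y yl ->].
have [_ [iP cP _ gP]] := proj1 (outer_quasi_center charK0 smoothG y) (Hq y yl).
split=> //; first by move/(same_on_curve FG).
exact/(same_galois_order FG).
Qed.
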